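(* Let $p>3$ be the characteristic of $\mathbb F$. For all integers $m,n>2$, every $\underline r\in\mathbb N^{p+2}$ and every $\underline t\in\mathbb N^m$, the Lie superalgebra $SKO(p+2,p+3;(p-1)/2,\underline r)$ is not isomorphic to $S(m,n;\underline t)$, $HO(m,m;\underline t)$ or $K(m,n;\underline t)$.
   Context: $\mathbb F$ is a field of characteristic $p>3$, $\mathbb N$ the positive integers. For $\underline t\in\mathbb N^m$ put $\pi_i=p^{t_i}-1$; $\mathcal O(m;\underline t)$ is the divided power algebra with basis $x^{(\alpha)}$, $\alpha\in\mathbb N_0^m$, $\alpha_i\le\pi_i$, and $x^{(\alpha)}x^{(\beta)}=\binom{\alpha+\beta}{\alpha}x^{(\alpha+\beta)}$ (zero if some exponent exceeds $\pi_i$); $x_i=x^{(\varepsilon_i)}$. $\mathcal O(m,n;\underline t)=\mathcal O(m;\underline t)\otimes\Lambda(n)$, $\Lambda(n)$ the exterior superalgebra in odd variables $x_{m+1},\dots,x_{m+n}$; $\mathrm p$ is parity (formulas with $\mathrm p(a)$ are for homogeneous $a$, extended linearly). $\partial_r$ is the superderivation of $\mathcal O(m,n;\underline t)$ (parity $\mu(r)=0$ for $r\le m$, $\mu(r)=1$ for $r>m$) with $\partial_r(x^{(\alpha)})=x^{(\alpha-\varepsilon_r)}$ for $r\le m$, $\partial_r(x_s)=\delta_{rs}$. $S(m,n;\underline t)$ is the span of all $D_{ij}(a)=(-1)^{\mu(i)\mu(j)}\partial_i(a)\partial_j-(-1)^{(\mu(i)+\mu(j))\mathrm p(a)}\partial_j(a)\partial_i$,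 $a\in\mathcal O(m,n;\underline t)$, $1\le i,j\le m+n$. $K(m,n;\underline t)$ (defined for $m=2r+1$ odd): for $i\le r$ let $i'=i+r$, for $r<i\le2r$ let $i'=i-r$, for $m<i\le m+n$ let $i'=i$; $\sigma(i)=-1$ for $r<i\le2r$ and $\sigma(i)=1$ for other $i\ne m$. For $f\in\mathcal O(m,n;\underline t)$ let $D_K(f)=\sum_{i=1}^{m+n}f_i\partial_i$ with $f_i=(-1)^{\mu(i)\mathrm p(f)}(x_i\partial_m(f)+\sigma(i')\partial_{i'}(f))$ for $i\neq m$ and $f_m=2f-\sum_{i\ne m}x_i\partial_i(f)$; then $K(m,n;\underline t)=[\widetilde K,\widetilde K]$ where $\widetilde K=\{D_K(f):f\in\mathcal O(m,n;\underline t)\}$. For $N\ge3$ and $\underline t\in\mathbb N^N$, put $i'=i+N$ for $i\le N$, $i'=i-N$ for $N<i\le2N$; $\Delta=\sum_{i=1}^N\partial_i\partial_{i'}$; $\mathfrak D=\sum_{i=1}^{2N}x_i\partial_i$; $T_H(a)=\sum_{i=1}^{2N}(-1)^{\mu(i')\mathrm p(a)}\partial_{i'}(a)\partial_i$ (with $\mu(i)=0$ for $i\le N$, $1$ for $i>N$). $HO(N,N;\underline t)=\{T_H(a):a\in\mathcal O(N,N;\underline t)\}$. In $\mathcal O(N,N+1;\underline t)$ put $D_{KO}(a)=T_H(a)+(-1)^{\mathrm p(a)}\partial_{2N+1}(a)\mathfrak D+(\mathfrak D(a)-2a)\partial_{2N+1}$. For $\lambda\in\mathbb F$, $\mathrm{div}_\lambda(a)=(-1)^{\mathrm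 p(a)}2(\Delta(a)+(\mathfrak D-N\lambda\,\mathrm{id})\partial_{2N+1}(a))$, $SKO''(N,N+1;\lambda,\underline t)=\{D_{KO}(a):\mathrm{div}_\lambda(a)=0\}$, $SKO'=[SKO'',SKO'']$, $SKO(N,N+1;\lambda,\underline t)=[SKO',SKO']$. In the claim $N=p+2$ and $\lambda$ is the image of the integer $(p-1)/2$ in $\mathbb F$. *)

(* Defs.v *)
From HB Require Import structures.
From mathcomp Require Import all_boot all_order all_algebra.

Set Implicit Arguments.
Unset Strict Implicit.
Unset Printing Implicit Defensive.

Import GRing.Theory.
Local Open Scope ring_scope.

(* A superspace is given by a space V together with its projections pr false
   and pr true onto the even and the odd part. *)
Section OperatorSuperalgebra.

Variables (F : fieldType) (V : vectType F) (pr : bool -> 'End(V)).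
Implicit Types (D E : 'End(V)) (e : bool).

(* The homogeneous component of parity e of an operator. *)
Definition op_part e D : 'End(V) :=
  \sum_(e' : bool) (pr (e (+) e') \o D \o pr e')%VF.

Definition bracket D E : 'End(V) :=
  \sum_(d : bool) \sum_(e : bool)
    ((op_part d D \o op_part e E)
     - (-1) ^+ (d && e) *: (op_part e E \o op_part d D))%VF.

Definition derived (L : {vspace 'End(V)}) : {vspace 'End(V)} :=
  <<[seq bracket D E | D <- vbasis L, E <- vbasis L]>>%VS.

Fact op_part_linear e : linear (op_part e).
Proof.
move=> x D E; rewrite /op_part scaler_sumr -big_split /=.
apply: eq_bigr => e' _.
by rewrite comp_lfunDr comp_lfunDl -comp_lfunZr -comp_lfunZl.
Qed.
HB.instance Definition _ e :=
  GRing.isLinear.Build F 'End(V) 'End(V) _ (op_part e) (op_part_linear e).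

Fact bracket_linear D : linear (bracket D).
Proof.
move=> x E G; rewrite /bracket scaler_sumr -big_split; apply: eq_bigr => d _ /=.
rewrite scaler_sumr -big_split; apply: eq_bigr => e _ /=.
rewrite linearP comp_lfunDr -comp_lfunZr comp_lfunDl -comp_lfunZl.
by rewrite scalerDr scalerBr !scalerA [x * _]mulrC opprD addrACA.
Qed.
HB.instance Definition _ D :=
  GRing.isLinear.Build F 'End(V) 'End(V) _ (bracket D) (bracket_linear D).

Fact bracket_linearl E : linear (bracket^~ E).
Proof.
move=> x D G; rewrite /bracket scaler_sumr -big_split; apply: eq_bigr => d _ /=.
rewrite scaler_sumr -big_split; apply: eq_bigr => e _ /=.
rewrite linearP comp_lfunDr -comp_lfunZr comp_lfunDl -comp_lfunZl.
by rewrite scalerDr scalerBr !scalerA [x * _]mulrC opprD addrACA.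
Qed.

(* derived L is the span of all brackets, not only of those of basis vectors. *)
Fact mem_derived (L : {vspace 'End(V)}) D E :
  D \in L -> E \in L -> bracket D E \in derived L.
Proof.
move=> LD /coord_vbasis->; rewrite linear_sum /=.
apply: memv_suml => j _; rewrite linearZ /=; apply: memvZ; set E' := _`_j.
pose linB := GRing.isLinear.Build F _ _ _ _ (bracket_linearl E').
pose B : {linear 'End(V) -> 'End(V)} := HB.pack (bracket^~ E') linB.
rewrite (coord_vbasis LD) [bracket _ _](linear_sum B).
apply: memv_suml => i _; rewrite linearZ; apply: memvZ => /=.
by apply/memv_span/allpairs_f; apply: mem_nth; rewrite size_tuple.
Qed.

End OperatorSuperalgebra.

(* Isomorphism of Lie superalgebras of operators: an even linear bijection from
   L onto M that respects the brackets.  The linear map phi is defined on the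
   whole space of operators but is constrained on L only. *)
Definition super_isom (F : fieldType) (V V' : vectType F)
    (pr : bool -> 'End(V)) (pr' : bool -> 'End(V'))
    (L : {vspace 'End(V)}) (M : {vspace 'End(V')}) : Prop :=
  exists phi : 'Hom('End(V), 'End(V')),
    [/\ (phi @: L)%VS = M,
        {in L &, injective phi},
        forall (e : bool) D, D \in L -> op_part pr e D = D ->
          op_part pr' e (phi D) = phi D
      & {in L &, forall D E, phi (bracket pr D E) = bracket pr' (phi D) (phi E)}].

(* Conventions.  The m + n variables x_1, ..., x_{m+n} and the derivations
   d_1, ..., d_{m+n} are indexed by natural numbers starting from 1; the
   variables with index k <= m are even, the others odd.  The basis monomial
   x^(alpha) x_u of O(m) (x) Lambda(n), with u a subset of the odd variables
   and the odd variables multiplied in increasing order, is encoded by a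
   single exponent function on 'I_(m + n) that takes values in {0, 1} on odd
   variables; its value at i is the exponent of x_{i+1}. *)

Section DividedPowerSuperalgebra.

Variables (F : fieldType) (p m n : nat) (t : 'I_m -> nat).

Definition expo_bound (i : 'I_(m + n)) : nat :=
  match split i with inl j => p ^ t j | inr _ => 2 end.

Definition monomial := {dffun forall i : 'I_(m + n), 'I_(expo_bound i)}.

(* Bundled as a vectType: unfolding to the finite functions in every canonical
   structure search makes the proofs very slow. *)
Definition dpsa : vectType F := {ffun monomial -> F^o}.

Definition coef (f : dpsa) (a : monomial) : F :=
  fun_of_fin (f : {ffun monomial -> F^o}) a.

Implicit Types (f g : dpsa) (k : nat) (e : bool).

Fact coefP f g : (forall a, coef f a = coef g a) -> f = g.
Proof. by move=> eq_fg; apply/ffunP. Qed.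

Fact coef_linE (x : F) f g a : coef (x *: f + g) a = x * coef f a + coef g a.
Proof. by rewrite /coef !ffunE. Qed.

Definition mu k : bool := (m < k)%N.

Definition mono_par (a : monomial) : bool := odd (\sum_(i < m + n | mu i.+1) a i).

Definition hpart e f : dpsa :=
  [ffun a : monomial => if mono_par a == e then coef f a else 0].

(* The sign reorders the odd variables; a product whose exponents do not match
   those of any basis monomial c (overflow, or a repeated odd variable)
   vanishes.  The binomials are 1 on odd variables. *)
Definition dp_mul f g : dpsa :=
  [ffun c : monomial => \sum_(a : monomial)
     \sum_(b : monomial | [forall i, c i == a i + b i :> nat]%N)
       ((-1) ^+ (\sum_(i < m + n | mu i.+1)
                   \sum_(j < m + n | mu j.+1 && (j < i)) a i * b j)%N
        * (\prod_i 'C(a i + b i, a i))%:R * (coef f a * coef g b) : F)].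

Definition var k : dpsa :=
  [ffun a : monomial => ((0 < k <= m + n)%N
            && [forall i, a i == (i.+1 == k) :> nat])%:R].

(* For an odd index k the sign comes from moving d_k past the odd variables
   that precede x_k; for an even index the exponent of -1 is an empty sum. *)
Definition partial_fun k f : dpsa :=
  [ffun b : monomial => if (0 < k <= m + n)%N then
     (-1) ^+ (\sum_(i < m + n | mu i.+1 && (i.+1 < k)%N) b i)%N
     * \sum_(a : monomial | [forall i, a i == b i + (i.+1 == k) :> nat]%N) coef f a
   else 0 : F].

Fact hpart_linear e : linear (hpart e).
Proof.
have E h a : coef (hpart e h) a = if mono_par a == e then coef h a else 0.
  exact: ffunE.
move=> x f g; apply: coefP => a; rewrite coef_linE !E coef_linE.
by case: ifP => // _; rewrite mulr0 addr0.
Qed.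
HB.instance Definition _ e :=
  GRing.isLinear.Build F dpsa dpsa _ (hpart e) (hpart_linear e).

Fact coef_mul f g c : coef (dp_mul f g) c = \sum_(a : monomial)
     \sum_(b : monomial | [forall i, c i == a i + b i :> nat]%N)
       (-1) ^+ (\sum_(i < m + n | mu i.+1)
                  \sum_(j < m + n | mu j.+1 && (j < i)) a i * b j)%N
        * (\prod_i 'C(a i + b i, a i))%:R * (coef f a * coef g b).
Proof. exact: ffunE. Qed.

Fact mul_linear f : linear (dp_mul f).
Proof.
move=> x g h; apply: coefP => c; rewrite coef_linE !coef_mul mulr_sumr -big_split.
apply: eq_bigr => a _ /=; rewrite mulr_sumr -big_split; apply: eq_bigr => b _ /=.
rewrite coef_linE 2!mulrDr [coef f a * _]mulrCA; congr (_ + _); exact: mulrCA.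
Qed.
HB.instance Definition _ f :=
  GRing.isLinear.Build F dpsa dpsa _ (dp_mul f) (mul_linear f).

Fact partial_linear k : linear (partial_fun k).
Proof.
have E h b : coef (partial_fun k h) b = if (0 < k <= m + n)%N then
    (-1) ^+ (\sum_(i < m + n | mu i.+1 && (i.+1 < k)%N) b i)%N
    * \sum_(a : monomial | [forall i, a i == b i + (i.+1 == k) :> nat]%N) coef h a
  else 0 by exact: ffunE.
move=> x f g; apply: coefP => b; rewrite coef_linE !E.
case: ifP => _; last by rewrite mulr0 addr0.
set s := _ ^+ _; under eq_bigr do rewrite coef_linE.
by rewrite big_split -mulr_sumr mulrDr; congr (_ + _); exact: mulrCA.
Qed.
HB.instance Definition _ k :=
  GRing.isLinear.Build F dpsa dpsa _ (partial_fun k) (partial_linear k).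

Definition parity_proj e : 'End(dpsa) := linfun (hpart e).

Definition partial k : 'End(dpsa) := linfun (partial_fun k).

(* f D, for an operator D *)
Definition smul f (D : 'End(dpsa)) : 'End(dpsa) := (linfun (dp_mul f) \o D)%VF.

Fact smul_linear D : linear (smul^~ D).
Proof.
move=> x f g; apply/lfunP=> h.
rewrite !(add_lfunE, scale_lfunE, comp_lfunE) !lfunE /=.
apply: coefP => c; rewrite coef_linE !coef_mul mulr_sumr -big_split.
apply: eq_bigr => a _ /=; rewrite mulr_sumr -big_split; apply: eq_bigr => b _ /=.
rewrite coef_linE mulrDl mulrDr -[x * coef f a * _]mulrA.
congr (_ + _); exact: mulrCA.
Qed.

(* Extension by linearity of a formula T e a, linear in a, that is meant for
   a homogeneous of parity e. *)
Definition extend (V : zmodType) (T : bool -> dpsa -> V) (a : dpsa) : V :=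
  \sum_(e : bool) T e (hpart e a).

Fact extend_linear (V : lmodType F) (T : bool -> dpsa -> V) :
  (forall e, linear (T e)) -> linear (extend T).
Proof.
move=> linT x a b; rewrite /extend scaler_sumr -big_split /=.
by apply: eq_bigr => e _; rewrite linearP linT.
Qed.

Section S.

Definition D_S (i j : nat) : dpsa -> 'End(dpsa) := extend (fun e a =>
  (-1) ^+ (mu i * mu j) *: smul (partial i a) (partial j)
  - (-1) ^+ ((mu i + mu j) * e) *: smul (partial j a) (partial i)).

Definition Lie_S : {vspace 'End(dpsa)} :=
  (\sum_(1 <= i < (m + n).+1) \sum_(1 <= j < (m + n).+1)
     limg (linfun (D_S i j)))%VS.

End S.

(* Only meaningful when m = 2r + 1. *)
Section K.

Let r := m./2.

Definition prime_K (i : nat) : nat :=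
  if (i <= r)%N then (i + r)%N else if (i <= r.*2)%N then (i - r)%N else i.

Definition sigma_K (i : nat) : F := if (r < i <= r.*2)%N then -1 else 1.

Definition coef_K (e : bool) (f : dpsa) (i : nat) : dpsa :=
  if i == m then
    2 *: f - \sum_(1 <= j < (m + n).+1 | j != m) dp_mul (var j) (partial j f)
  else
    (-1) ^+ (mu i * e) *: (dp_mul (var i) (partial m f)
      + sigma_K (prime_K i) *: partial (prime_K i) f).

Definition D_K : dpsa -> 'End(dpsa) := extend (fun e f =>
  \sum_(1 <= i < (m + n).+1) smul (coef_K e f i) (partial i)).

Definition Lie_K : {vspace 'End(dpsa)} := derived parity_proj (limg (linfun D_K)).

End K.

(* Used with n = m (for HO) and n = m + 1 (for KO); N := m below. *)
Section TH.

Definition prime_H (i : nat) : nat := if (i <= m)%N then (i + m)%N else (i - m)%N.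

Definition T_H : dpsa -> 'End(dpsa) := extend (fun e a =>
  \sum_(1 <= i < m.*2.+1)
    (-1) ^+ (mu (prime_H i) * e) *: smul (partial (prime_H i) a) (partial i)).

Definition Delta : 'End(dpsa) :=
  \sum_(1 <= i < m.+1) (partial i \o partial (prime_H i))%VF.

Definition Euler : 'End(dpsa) :=
  \sum_(1 <= i < m.*2.+1) smul (var i) (partial i).

Definition D_KO : dpsa -> 'End(dpsa) := extend (fun e a =>
  T_H a + (-1) ^+ e *: smul (partial m.*2.+1 a) Euler
  + smul (Euler a - 2 *: a) (partial m.*2.+1)).

Definition div_KO (lambda : F) : dpsa -> dpsa := extend (fun e a =>
  ((-1) ^+ e * 2) *: (Delta a
    + (Euler - (m%:R * lambda) *: \1)%VF (partial m.*2.+1 a))).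

End TH.

Fact D_S_linear i j : linear (D_S i j).
Proof.
apply: extend_linear => e x a b; rewrite !linearP /= !smul_linear.
by rewrite !scalerDr !scalerN !scalerA ![x * _]mulrC opprD addrACA.
Qed.
HB.instance Definition _ i j :=
  GRing.isLinear.Build F dpsa 'End(dpsa) _ (D_S i j) (D_S_linear i j).

Fact coef_K_linear e i : linear (coef_K e ^~ i).
Proof.
move=> x f g; rewrite /coef_K; case: ifP => _.
  rewrite scalerBr scaler_sumr scalerDr addrACA -opprD -big_split /=.
  rewrite !scalerA [x * _]mulrC; congr (_ - _).
  by apply: eq_bigr => j _; rewrite !linearP.
rewrite !linearP /= !scalerDr !scalerA.
by rewrite mulrA [_ * x]mulrC addrACA.
Qed.

Fact D_K_linear : linear D_K.
Proof.
apply: extend_linear => e x f g; rewrite scaler_sumr -big_split /=.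
by apply: eq_bigr => i _; rewrite coef_K_linear smul_linear.
Qed.
HB.instance Definition _ :=
  GRing.isLinear.Build F dpsa 'End(dpsa) _ D_K D_K_linear.

Fact T_H_linear : linear T_H.
Proof.
apply: extend_linear => e x f g; rewrite scaler_sumr -big_split /=.
apply: eq_bigr => i _.
by rewrite linearP smul_linear scalerDr !scalerA [x * _]mulrC.
Qed.
HB.instance Definition _ :=
  GRing.isLinear.Build F dpsa 'End(dpsa) _ T_H T_H_linear.

Fact D_KO_linear : linear D_KO.
Proof.
apply: extend_linear => e x f g; rewrite !linearP /=.
rewrite [X in smul X (partial _)]addrACA -scalerDr !smul_linear.
rewrite !scalerDr !scalerA [x * _]mulrC.
by rewrite [X in X + _ = _]addrACA [LHS]addrACA.
Qed.
HB.instance Definition _ :=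
  GRing.isLinear.Build F dpsa 'End(dpsa) _ D_KO D_KO_linear.

Fact div_KO_linear lambda : linear (div_KO lambda).
Proof.
apply: extend_linear => e x f g; rewrite !linearP /=.
by rewrite !scalerDr addrACA !scalerA [x * _]mulrC.
Qed.
HB.instance Definition _ lambda :=
  GRing.isLinear.Build F dpsa dpsa _ (div_KO lambda) (div_KO_linear lambda).

End DividedPowerSuperalgebra.

Definition Lie_HO (F : fieldType) (p N : nat) (t : 'I_N -> nat) :
    {vspace 'End(dpsa F p N t)} :=
  limg (linfun (@T_H F p N N t)).

Definition Lie_SKO'' (F : fieldType) (p N : nat) (lambda : F) (t : 'I_N -> nat) :
    {vspace 'End(dpsa F p N.+1 t)} :=
  (linfun (@D_KO F p N N.+1 t) @: lker (linfun (@div_KO F p N N.+1 t lambda)))%VS.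

Definition Lie_SKO (F : fieldType) (p N : nat) (lambda : F) (t : 'I_N -> nat) :
    {vspace 'End(dpsa F p N.+1 t)} :=
  let pr := parity_proj F p N.+1 t in
  derived pr (derived pr (Lie_SKO'' p lambda t)).

Definition dpsa_isom (F : fieldType) (p m n m' n' : nat)
    (t : 'I_m -> nat) (t' : 'I_m' -> nat)
    (L : {vspace 'End(dpsa F p n t)}) (M : {vspace 'End(dpsa F p n' t')}) : Prop :=
  super_isom (parity_proj F p n t) (parity_proj F p n' t') L M.

(* Main.v *)
(* The superalgebras are told apart by the dimensions of their even and odd
   parts.  Put N = p + 2, k0 = (p + 3) / 2, C = binomial(N, k0), and write d for
   the dimension of the superalgebra of functions in each case.

   SKO: N = 2 and N lambda = -1 in F.  With Dop q = Delta + (Euler - q) d_tau one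
   has Dop (-1) Dop 1 = 0 and, for f and g in the kernel of Dop (-1), the bracket
   of D_KO f and D_KO g is D_KO of +- Dop 1 (f g); as Dop (-1) is adjoint to Dop 1
   for the top coefficient, f g has zero top coefficient when f and g lie in the
   image of Dop 1.  It follows that SKO is the image under D_KO (Dop 1) of the
   functions with zero top coefficient.  Hence both parts have dimension d / 4,
   less 1 in the even part, and less C in the odd part if k0 is even and in the
   even part if k0 is odd.

   HO has superdimension 1.  K contains D_K of every monomial except possibly the
   top one, so its superdimension is at most 1 in absolute value.  As C > 2, this
   differs from C - 1 and from C + 1.

   S: the even and odd dimensions are (m + n - 1) d / 2, from one of which m - 1
   is subtracted.  Comparing superdimensions gives m = C if p = 1 mod 4, and then
   comparing dimensions gives 4 = 0 mod p.  If p = 3 mod 4, then n is even,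
   m = C + 2 and (m + n - 1) 2^n = 2^N up to odd factors; since C is even,
   m + n - 1 is odd, so n = N is odd, a contradiction. *)

Require Import Defs.
From HB Require Import structures.
From mathcomp Require Import all_boot all_order all_algebra.
From mathcomp Require Import ring zify.

Set Implicit Arguments.
Unset Strict Implicit.
Unset Printing Implicit Defensive.

Import GRing.Theory.
Local Open Scope ring_scope.

(** * Divided power monomials *)

(** Each algebra receives a homogeneous basis indexed by monomials (for S, by pairs of a monomial
    and a derivation), so that dimensions become cardinalities, and these are computed with
    involutions of the set of monomials. The quarter d / 4 for SKO comes from two halvings: one by
    parity, and one by the relation Dop 1 o Dop 3 = 0, which leaves only the monomials that contain
    a certain xi_j. The second halving breaks down where no product x_i xi_i can be added or
    removed. Then the exponents of each pair (x_i, xi_i) are (top, 0) or (0, 1), and the pair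
    contributes -1 or 1 mod p to the degree. With k of the xi_i present the degree is 2 k - N = 2 k
    - 2, and Dop 1 kills such a monomial times tau exactly when this degree is 1, that is, when 2 k
    = 3 mod p. For k <= p + 2 the only solution is k0 = (p + 3) / 2: this is the origin of k0 and C.
    The bracket formulas of K and KO are instances of one computation in a frame of superderivations
    Y_j, Z; the two cases differ in the parity of Z. *)

Section Base.

Variables (F : fieldType) (p m n : nat) (t : 'I_m -> nat).
Notation O := (dpsa F p n t).
Notation X := (monomial p n t).
Notation bnd := (@expo_bound p m n t).
Implicit Types (f g h : O) (a b c : {ffun 'I_(m + n) -> nat}) (k : nat) (i : 'I_(m + n)).

Lemma coefD f g x : coef (f + g) x = coef f x + coef g x.
Proof. by rewrite -[f]scale1r coef_linE mul1r scale1r. Qed.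

Lemma dcoef0 (x : X) : coef (0 : O) x = 0.
Proof. by have := coef_linE 1 (0 : O) 0 x; rewrite scale1r addr0 mul1r => /esym/eqP; rewrite -subr_eq0 addrK => /eqP. Qed.

Lemma coefZ (s : F) f x : coef (s *: f) x = s * coef f x.
Proof. by rewrite -[s *: f]addr0 coef_linE dcoef0 addr0. Qed.

Lemma coefN f x : coef (- f) x = - coef f x.
Proof. by rewrite -scaleN1r coefZ mulN1r. Qed.

Lemma coef_sum I (r : seq I) (P : pred I) (G : I -> O) x :
  coef (\sum_(i <- r | P i) G i) x = \sum_(i <- r | P i) coef (G i) x.
Proof. by apply: (big_morph (fun f => coef f x)) => [f g|]; rewrite ?coefD ?dcoef0. Qed.

Definition coef_lin := (coefD, coefN, coefZ, dcoef0).

Definition expo (x : X) : {ffun 'I_(m + n) -> nat} := [ffun i => x i : nat].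

Definition bounded a := [forall i, (a i < bnd i)%N].

(** Total in the exponent: an exponent out of bounds gives 0 ([mon_out]), so the formulas for
    products and derivatives carry no boundedness conditions. *)
Definition mon a : O := [ffun x : X => (expo x == a)%:R].

Lemma coef_mon a x : coef (mon a) x = (expo x == a)%:R.
Proof. exact: ffunE. Qed.

Lemma expo_bounded x : bounded (expo x).
Proof. by apply/forallP => i; rewrite ffunE. Qed.

Lemma expo_inj : injective expo.
Proof. by move=> x y /ffunP exy; apply/ffunP => i; apply/val_inj; have := exy i; rewrite !ffunE. Qed.

Lemma boundedP a : reflect (exists x, expo x = a) (bounded a).
Proof.
apply: (iffP forallP) => [ba|[x <-] i]; last by rewrite ffunE.
exists [ffun i => Ordinal (ba i)] ; apply/ffunP => i; by rewrite !ffunE.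
Qed.

Lemma mon_out a : ~~ bounded a -> mon a = 0.
Proof.
move=> nba; apply: coefP => x; rewrite coef_mon dcoef0.
by case: eqP => // xa; rewrite -xa expo_bounded in nba.
Qed.

Lemma coef_monx x y : coef (mon (expo x)) y = (x == y)%:R.
Proof. by rewrite coef_mon (inj_eq expo_inj) eq_sym. Qed.

Lemma mon_expand f : f = \sum_x coef f x *: mon (expo x).
Proof.
apply: coefP => y; rewrite coef_sum (bigD1 y) //= coefZ coef_monx eqxx mulr1.
rewrite big1 ?addr0 // => x xy; by rewrite coefZ coef_monx (negPf xy) mulr0.
Qed.

Definition sgn a b : nat :=
  (\sum_(i < m + n | mu m i.+1) \sum_(j < m + n | mu m j.+1 && (j < i)) a i * b j)%N.

Definition bin_mul a b : F := (\prod_i 'C(a i + b i, a i))%:R.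

Definition sgnk k a : nat := (\sum_(i < m + n | mu m i.+1 && (i.+1 < k)) a i)%N.

(** If a factor is out of bounds then so is the sum of the exponents, and both sides vanish;
    overflow of the sum alone is absorbed by [mon]. *)
Lemma mul_mon a b :
  dp_mul (mon a) (mon b) = ((-1) ^+ sgn a b * bin_mul a b) *: mon [ffun i => a i + b i]%N.
Proof.
apply: coefP => c; rewrite coef_mul coefZ coef_mon.
case: (boolP (bounded a)) => [/boundedP[x <-]|nba]; last first.
  rewrite big1 => [|x _]; last first.
    rewrite big1 // => y _; rewrite mon_out // dcoef0 mul0r mulr0 //.
  case: eqP => [cab|_]; last by rewrite mulr0.
  case/negP: nba; apply/forallP => i; have /forallP/(_ i) := expo_bounded c.
  by rewrite cab ffunE; apply: leq_ltn_trans; rewrite leq_addr.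
case: (boolP (bounded b)) => [/boundedP[y <-]|nba]; last first.
  rewrite big1 => [|x' _]; last first.
    by rewrite big1 // => y _; rewrite [mon b]mon_out // dcoef0 !mulr0.
  case: eqP => [cab|_]; last by rewrite mulr0.
  case/negP: nba; apply/forallP => i; have /forallP/(_ i) := expo_bounded c.
  by rewrite cab ffunE; apply: leq_ltn_trans; rewrite leq_addl.
rewrite (bigD1 x) //= [X in _ + X]big1 ?addr0; last first.
  move=> x' xx'; rewrite big1 // => y' _.
  by rewrite coef_monx eq_sym (negPf xx') mul0r mulr0.
rewrite big_mkcond (bigD1 y) //= [X in _ + X]big1 ?addr0; last first.
  move=> y' yy'; case: ifP => // _.
  by rewrite [coef (mon (expo y)) _]coef_monx eq_sym (negPf yy') !mulr0.
rewrite !coef_monx !eqxx !mulr1.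
have -> : [forall i, c i == (x i + y i)%N :> nat]
   = (expo c == [ffun i => expo x i + expo y i]%N).
  apply/forallP/eqP => [cxy|/ffunP cxy i].
    by apply/ffunP => i; rewrite !ffunE; apply/eqP.
  by have := cxy i; rewrite !ffunE => ->.
case: ifP => _; rewrite ?mulr0 // mulr1; congr (_ ^+ _ * _).
  by apply: eq_bigr => i _; apply: eq_bigr => j _; rewrite !ffunE.
by congr (_%:R); apply: eq_bigr => i _; rewrite !ffunE.
Qed.

Lemma mulDl f g h : dp_mul (f + g) h = dp_mul f h + dp_mul g h.
Proof.
have := smul_linear (\1%VF : 'End(O)) 1 f g => /lfunP/(_ h).
by rewrite !scale1r add_lfunE !comp_lfunE !lfunE.
Qed.

Lemma mulZl (s : F) f h : dp_mul (s *: f) h = s *: dp_mul f h.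
Proof.
have := smul_linear (\1%VF : 'End(O)) s f 0 => /lfunP/(_ h).
rewrite addr0 add_lfunE scale_lfunE !comp_lfunE !lfunE /= => ->.
by have := mulDl 0 0 h; rewrite addr0 => /esym/eqP; rewrite -subr_eq0 addrK => /eqP->; rewrite addr0.
Qed.

Definition mulby h f := dp_mul f h.
Fact mulby_linear h : linear (mulby h).
Proof. by move=> s f g; rewrite /mulby mulDl mulZl. Qed.
HB.instance Definition _ h := GRing.isLinear.Build F O O _ (mulby h) (mulby_linear h).

Lemma mul0l h : dp_mul 0 h = 0.
Proof. exact: (linear0 (mulby h)). Qed.
Lemma mul_oppl f h : dp_mul (- f) h = - dp_mul f h.
Proof. exact: (linearN (mulby h)). Qed.
Lemma mul_suml I (r : seq I) (P : pred I) (G : I -> O) h :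
  dp_mul (\sum_(i <- r | P i) G i) h = \sum_(i <- r | P i) dp_mul (G i) h.
Proof. exact: (linear_sum (mulby h)). Qed.
Lemma mulZr (s : F) f h : dp_mul f (s *: h) = s *: dp_mul f h.
Proof. exact: linearZ. Qed.
Lemma mulDr f g h : dp_mul f (g + h) = dp_mul f g + dp_mul f h.
Proof. exact: linearD. Qed.
Lemma mul_oppr f g : dp_mul f (- g) = - dp_mul f g.
Proof. exact: linearN. Qed.
Lemma mulf0 f : dp_mul f 0 = 0.
Proof. exact: linear0. Qed.
Lemma mul_sumr I (r : seq I) (P : pred I) (G : I -> O) h :
  dp_mul h (\sum_(i <- r | P i) G i) = \sum_(i <- r | P i) dp_mul h (G i).
Proof. exact: linear_sum. Qed.

Definition mul_lin := (mulDl, mulDr, mulZl, mulZr, mul_oppl, mul_oppr, mul0l, mulf0).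

Lemma mon_ind (P : O -> Prop) : P 0 ->
  (forall f g, P f -> P g -> P (f + g)) -> (forall s f, P f -> P (s *: f)) ->
  (forall x, P (mon (expo x))) -> forall f, P f.
Proof. by move=> P0 PD PZ Px f; rewrite (mon_expand f); apply: big_ind => // x _; apply: PZ. Qed.

Definition addx a b : {ffun 'I_(m + n) -> nat} := [ffun i => a i + b i]%N.

Lemma sgnDl a b c : sgn (addx a b) c = (sgn a c + sgn b c)%N.
Proof.
rewrite -big_split; apply: eq_bigr => i _; rewrite -big_split; apply: eq_bigr => j _ /=.
by rewrite ffunE mulnDl.
Qed.

Lemma sgnDr a b c : sgn a (addx b c) = (sgn a b + sgn a c)%N.
Proof.
rewrite -big_split; apply: eq_bigr => i _; rewrite -big_split; apply: eq_bigr => j _ /=.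
by rewrite ffunE mulnDr.
Qed.

Lemma mulA f g h : dp_mul f (dp_mul g h) = dp_mul (dp_mul f g) h.
Proof.
elim/mon_ind: f => [|f f' IH IH'|s f IH|x]; rewrite ?mul_lin ?IH ?IH' //.
elim/mon_ind: g => [|g g' IH IH'|s g IH|y]; rewrite ?mul_lin ?IH ?IH' //.
elim/mon_ind: h => [|h h' IH IH'|s h IH|z]; rewrite ?mul_lin ?IH ?IH' //.
move: (expo x) (expo y) (expo z) => a b c; rewrite !mul_mon !mul_lin !mul_mon !scalerA.
rewrite -!/(addx _ _).
have -> : addx a (addx b c) = addx (addx a b) c by apply/ffunP => i; rewrite !ffunE addnA.
congr (_ *: _); rewrite sgnDl sgnDr !exprD.
have : bin_mul b c * bin_mul a (addx b c) = bin_mul a b * bin_mul (addx a b) c.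
  rewrite -!natrM -!big_split /=; congr (_%:R); apply: eq_bigr => i _; rewrite !ffunE.
  (* Both products of binomials are the multinomial (a+b+c)! / (a! b! c!); multiplying by the
     factorials keeps the comparison among natural numbers. *)
  apply/eqP; rewrite -(@eqn_pmul2r ((a i)`! * (b i)`! * (c i)`!)) ?muln_gt0 ?fact_gt0 //.
  apply/eqP.
  have e1 := bin_fact (leq_addr (b i) (a i)); have e2 := bin_fact (leq_addr (c i) (b i)).
  have e3 := bin_fact (leq_addr (b i + c i) (a i)); have e4 := bin_fact (leq_addr (c i) (a i + b i)).
  rewrite !addKn in e1 e2 e3 e4.
  transitivity ((a i + b i + c i)`!)%N.
    by rewrite -addnA -e3 -e2; nia.
  by rewrite -e4 -e1; nia.
by move=> eB; transitivity ((-1) ^+ sgn a b * (-1) ^+ sgn a c * (-1) ^+ sgn b c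
    * (bin_mul b c * bin_mul a (addx b c))); [ring | rewrite eB; ring].
Qed.

Definition parx a : bool := odd (\sum_(i < m + n | mu m i.+1) a i).

Lemma mono_parE x : mono_par x = parx (expo x).
Proof. by congr (odd _); apply: eq_bigr => i _; rewrite ffunE. Qed.

Lemma parxD a b : parx (addx a b) = parx a (+) parx b.
Proof. by rewrite -oddD -big_split; congr (odd _); apply: eq_bigr => i _; rewrite ffunE. Qed.

(** The sign twist by (-1)^(e p(f)), extended linearly: it allows super Leibniz rules to be stated
    for inhomogeneous functions. *)
Definition sg (e : bool) f : O := [ffun x => (-1) ^+ (e && mono_par x) * coef f x].

Lemma coef_sg e f x : coef (sg e f) x = (-1) ^+ (e && mono_par x) * coef f x.
Proof. exact: ffunE. Qed.

Fact sg_linear e : linear (sg e).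
Proof. by move=> s f g; apply: coefP => x; rewrite !(coef_sg, coef_linE); ring. Qed.
HB.instance Definition _ e := GRing.isLinear.Build F O O _ (sg e) (sg_linear e).

Lemma sg_mon e a : sg e (mon a) = (-1) ^+ (e && parx a) *: mon a.
Proof.
apply: coefP => x; rewrite coef_sg coefZ coef_mon mono_parE.
by case: eqP => [->//|_]; rewrite !mulr0.
Qed.

Definition hom (e : bool) f := hpart e f = f.

Lemma coef_hpart e f x : coef (hpart e f) x = if mono_par x == e then coef f x else 0.
Proof. exact: ffunE. Qed.

Lemma homP e f : hom e f <-> forall x, mono_par x != e -> coef f x = 0.
Proof.
split=> [<- x|H]; first by rewrite coef_hpart => /negPf->.
by apply: coefP => x; rewrite coef_hpart; case: ifP => // /negbT/H->.
Qed.

Lemma hom_hpart e f : hom e (hpart e f).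
Proof. by apply/homP => x /negPf; rewrite coef_hpart => ->. Qed.

Lemma hpartD f : f = hpart false f + hpart true f.
Proof. by apply: coefP => x; rewrite coefD !coef_hpart; case: mono_par; rewrite ?addr0 ?add0r. Qed.

Lemma sg_hom e e' f : hom e' f -> sg e f = (-1) ^+ (e && e') *: f.
Proof.
move=> /homP hf; apply: coefP => x; rewrite coef_sg coefZ.
by case: (eqVneq (mono_par x) e') => [->//|/hf->]; rewrite !mulr0.
Qed.

Lemma hom0 e : hom e 0. Proof. exact: linear0. Qed.
Lemma homD e f g : hom e f -> hom e g -> hom e (f + g).
Proof. by rewrite /hom linearD /= => -> ->. Qed.
Lemma homZ e (s : F) f : hom e f -> hom e (s *: f).
Proof. by rewrite /hom linearZ /= => ->. Qed.
Lemma homN e f : hom e f -> hom e (- f).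
Proof. by rewrite /hom linearN /= => ->. Qed.
Lemma hom_sum e I (r : seq I) (P : pred I) (G : I -> O) :
  (forall u, P u -> hom e (G u)) -> hom e (\sum_(u <- r | P u) G u).
Proof. by move=> H; apply: big_ind => //; [apply: hom0 | apply: homD]. Qed.

Lemma hom_mon a : hom (parx a) (mon a).
Proof. by apply/homP => x; rewrite coef_mon mono_parE; case: (expo x =P a) => [->|//]; rewrite eqxx. Qed.

Lemma hom_ind e (P : O -> Prop) : P 0 ->
  (forall f g, P f -> P g -> P (f + g)) -> (forall s f, P f -> P (s *: f)) ->
  (forall x, mono_par x = e -> P (mon (expo x))) -> forall f, hom e f -> P f.
Proof.
move=> P0 PD PZ Px f /homP hf; rewrite (mon_expand f); apply: big_ind => // x _.
case: (eqVneq (mono_par x) e) => [xe|/hf->]; first exact/PZ/Px.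
by rewrite scale0r.
Qed.

Lemma homM e e' f g : hom e f -> hom e' g -> hom (e (+) e') (dp_mul f g).
Proof.
move=> hf hg; elim/hom_ind: hf => [|u v|s u|x xe];
  rewrite ?mul_lin; [exact: hom0|exact: homD|exact: homZ|].
elim/hom_ind: hg => [|u v|s u|y ye];
  rewrite ?mul_lin; [exact: hom0|exact: homD|exact: homZ|].
rewrite mul_mon; apply: homZ; rewrite -/(addx _ _) -xe -ye !mono_parE -parxD; exact: hom_mon.
Qed.

Lemma bnd_odd i : mu m i.+1 -> bnd i = 2%N.
Proof. by rewrite /mu /expo_bound; case: splitP => // j ->; rewrite ltnS leqNgt ltn_ord. Qed.

Lemma bnd_even i : ~~ mu m i.+1 -> exists j : 'I_m, i = j :> nat /\ bnd i = (p ^ t j)%N.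
Proof.
rewrite /mu /expo_bound; case: splitP => [j ij _|j ->]; first by exists j.
by rewrite ltnS leq_addr.
Qed.

(** Every ordered pair of distinct odd variables, one from each factor, is counted by exactly one of
    the two sums, and the diagonal products a_i b_i vanish because a_i + b_i < 2. *)
Lemma sgnC a b : bounded (addx a b) -> bounded a -> bounded b ->
  odd (sgn a b + sgn b a) = parx a && parx b.
Proof.
move=> /forallP bab /forallP ba /forallP bb.
rewrite -oddM; congr odd; rewrite big_distrl /= /sgn.
rewrite [X in (_ + X)%N](exchange_big_dep (fun i : 'I_(m + n) => mu m i.+1)) /=; last by move=> ? ? ? /andP[].
rewrite -big_split; apply: eq_bigr => i mi /=; rewrite big_distrr /=.
rewrite [RHS](bigID (fun j : 'I_(m + n) => j < i)%N) /=; congr (_ + _)%N.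
rewrite (eq_bigr (fun j : 'I_(m + n) => a i * b j))%N => [|j _]; last by rewrite mulnC.
rewrite [RHS](bigID (fun j => j == i)) /=.
rewrite (_ : (\sum_(j < m + n | mu m j.+1 && ~~ (j < i) && (j == i)) a i * b j = 0)%N) ?add0n.
  by apply: eq_bigl => j; rewrite mi -leqNgt -andbA ltn_neqAle andTb -val_eqE /= eq_sym [X in _ && X]andbC.
rewrite big1 // => j /andP[_ /eqP->]; have := bab i; have := ba i; have := bb i; rewrite ffunE bnd_odd //.
by case: (a i) => [|[]] //; case: (b i) => [|[]].
Qed.

Lemma mulC e e' f g : hom e f -> hom e' g ->
  dp_mul f g = (-1) ^+ (e && e') *: dp_mul g f.
Proof.
move=> hf hg; elim/hom_ind: hf => [|u v Hu Hv|s u Hu|x xe].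
- by rewrite !mul_lin scaler0.
- by rewrite !mul_lin Hu Hv scalerDr.
- by rewrite !mul_lin Hu !scalerA mulrC.
elim/hom_ind: hg => [|u v Hu Hv|s u Hu|y ye].
- by rewrite !mul_lin scaler0.
- by rewrite !mul_lin Hu Hv scalerDr.
- by rewrite !mul_lin Hu !scalerA mulrC.
rewrite !mul_mon -!/(addx _ _) -xe -ye !mono_parE.
have -> : addx (expo y) (expo x) = addx (expo x) (expo y) by apply/ffunP => i; rewrite !ffunE addnC.
case: (boolP (bounded (addx (expo x) (expo y)))) => [bxy|/mon_out->]; last by rewrite !scaler0.
rewrite scalerA mulrA -(sgnC bxy (expo_bounded x) (expo_bounded y)) signr_odd -exprD; congr (_ *: _); congr (_ * _).
  by rewrite -addnA exprD addnn -mul2n exprM sqrrN !expr1n mulr1.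
by congr (_%:R); apply: eq_bigr => i _; rewrite -[LHS]bin_sub ?leq_addr // addKn addnC.
Qed.

Definition one : O := mon [ffun => 0%N].

Lemma mul1f f : dp_mul one f = f.
Proof.
elim/mon_ind: f => [|f g If Ig|s f If|x]; rewrite ?mul_lin ?If ?Ig //.
rewrite mul_mon /sgn big1 => [|i _]; last by rewrite big1 // => j _; rewrite ffunE.
rewrite /bin_mul big1 => [|i _]; last by rewrite !ffunE bin0.
by rewrite expr0 mulr1 scale1r; congr mon; apply/ffunP => i; rewrite !ffunE.
Qed.

Lemma hom_one : hom false one.
Proof. by have := hom_mon [ffun => 0%N]; rewrite /parx big1 // => i _; rewrite ffunE. Qed.

Lemma mulf1 f : dp_mul f one = f.
Proof.
have H e g : hom e g -> dp_mul g one = g.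
  by move=> hg; rewrite (mulC hg hom_one) andbF expr0 scale1r mul1f.
by rewrite {1}(hpartD f) mulDl !(H _ _ (hom_hpart _ _)) -hpartD.
Qed.

End Base.

(** * Partial derivatives *)

(** If p did not divide the binomial, then k C(p^e, k) = p^e C(p^e - 1, k - 1) would force p^e to
    divide k. *)
Lemma bin_pchar (F : fieldType) p e k : p \in [pchar F] -> (0 < k < p ^ e)%N ->
  'C(p ^ e, k)%:R = 0 :> F.
Proof.
move=> charFp /andP[k0 kpe]; have pr_p := pcharf_prime charFp.
apply/eqP; rewrite -(dvdn_pcharf charFp); apply: contraLR kpe => ndv.
case: k k0 ndv => // k _ ndv; rewrite -leqNgt dvdn_leq //.
have cop : coprime (p ^ e) 'C(p ^ e, k.+1) by rewrite coprimeXl // prime_coprime.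
by rewrite -(Gauss_dvdl _ cop) -mul_bin_diag dvdn_mulr.
Qed.

(** Reduces every power of -1 to its parity bit, splits on the bits and leaves a polynomial
    identity. *)
Ltac sign_ring :=
  rewrite ?exprD;
  repeat match goal with |- context [GRing.exp (- 1) ?n] =>
    lazymatch n with nat_of_bool _ => fail | O => fail | S _ => fail
    | _ => rewrite -(signr_odd _ n); case: (odd n) end end;
  rewrite /= ?expr0 ?expr1; ring.

Section Leibniz.

Variables (F : fieldType) (p m n : nat) (t : 'I_m -> nat).
Notation O := (dpsa F p n t).
Notation X := (monomial p n t).
Notation bnd := (@expo_bound p m n t).
Notation mon := (@mon F p m n t).
Implicit Types (f g h : O) (a b c : {ffun 'I_(m + n) -> nat}) (k : nat) (i : 'I_(m + n)).

Definition low i a : {ffun 'I_(m + n) -> nat} := [ffun j => a j - (j == i)]%N.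

Definition up i a : {ffun 'I_(m + n) -> nat} := [ffun j => a j + (j == i)]%N.

Lemma upK i a : low i (up i a) = a.
Proof. by apply/ffunP => j; rewrite !ffunE addnK. Qed.

Lemma lowK i a : (0 < a i)%N -> up i (low i a) = a.
Proof.
move=> ai; apply/ffunP => j; rewrite !ffunE; case: eqP => [->|_]; last by rewrite subn0 addn0.
by rewrite subn1 addn1 prednK.
Qed.

Lemma coef_partial i f x : coef (partial_fun i.+1 f) x =
  (-1) ^+ sgnk i.+1 (expo x) * \sum_(y | expo y == up i (expo x)) coef f y.
Proof.
transitivity (if (0 < i.+1 <= m + n)%N then
     (-1) ^+ (\sum_(j < m + n | mu m j.+1 && (j.+1 < i.+1)%N) x j)%N
     * \sum_(a : X | [forall j, a j == x j + (j.+1 == i.+1) :> nat]%N) coef f a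
   else 0 : F); first exact: ffunE.
rewrite ltn_ord /=; congr (_ ^+ _ * _); first by apply: eq_bigr => j _; rewrite ffunE.
apply: eq_bigl => y; apply/forallP/eqP => [H|/ffunP H j].
  by apply/ffunP => j; rewrite !ffunE (eqP (H j)).
by have := H j; rewrite !ffunE eqSS -val_eqE => ->.
Qed.

Lemma partial_out k f : ~~ (0 < k <= m + n)%N -> partial_fun k f = 0.
Proof.
move=> /negPf kP; apply: coefP => x; rewrite dcoef0 [LHS]ffunE.
by rewrite kP.
Qed.

Lemma sgnk_up i a : sgnk i.+1 (up i a) = sgnk i.+1 a.
Proof.
apply: eq_bigr => j /andP[_]; rewrite ltnS ffunE => ji.
by rewrite (_ : (j == i) = false) ?addn0 // -val_eqE /= ltn_eqF.
Qed.

Lemma partial_mon i a : partial_fun i.+1 (mon a) =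
  (((0 < a i)%N && (a i != bnd i))%:R * (-1) ^+ sgnk i.+1 a) *: mon (low i a).
Proof.
apply: coefP => x; rewrite coef_partial coefZ coef_mon.
case: (posnP (a i)) => [ai|ai].
  rewrite !mul0r big1 ?mulr0 // => y /eqP eyx; rewrite coef_mon.
  by case: eqP => // ya; move: ai; rewrite -ya eyx !ffunE eqxx addn1.
rewrite /=; case: (eqVneq (a i) (bnd i)) => [aib|aib] /=.
  rewrite !mul0r big1 ?mulr0 // => y /eqP eyx; rewrite coef_mon.
  case: eqP => // ya; have /forallP/(_ i) := expo_bounded y.
  by rewrite ya aib ltnn.
rewrite mul1r; case: (expo x =P low i a) => [xa|nxa]; last first.
  rewrite mulr0 big1 ?mulr0 // => y /eqP eyx; rewrite coef_mon; case: eqP => // ya.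
  by case: nxa; rewrite -ya eyx upK.
have exa : up i (expo x) = a by rewrite xa lowK.
rewrite mulr1 -{2}exa sgnk_up; case: (boolP (bounded p t a)) => [/boundedP[y ya]|/negP nb].
  rewrite (big_pred1 y) ?coef_mon ?ya ?eqxx ?mulr1 // => z.
  by rewrite exa -ya (inj_eq (@expo_inj _ _ _ _)).
case: nb; apply/forallP => j; have /forallP/(_ j) := expo_bounded x; rewrite xa !ffunE.
case: (eqVneq j i) => [->|_]; last by rewrite subn0.
rewrite subn1 => H; rewrite ltn_neqAle aib; lia.
Qed.

Definition binx i a b : F := (\prod_(j < m + n | j != i) 'C(a j + b j, a j))%:R.

Lemma bin_mulE i a b : bin_mul F a b = 'C(a i + b i, a i)%:R * binx i a b.
Proof. by rewrite /bin_mul (bigD1 i) //= natrM. Qed.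

Lemma binx_lowl i a b : binx i (low i a) b = binx i a b.
Proof. by congr (_%:R); apply: eq_bigr => j /negPf ji; rewrite ffunE ji subn0. Qed.

Lemma binx_lowr i a b : binx i a (low i b) = binx i a b.
Proof. by congr (_%:R); apply: eq_bigr => j /negPf ji; rewrite ffunE ji subn0. Qed.

Lemma sgnk_addx k a b : sgnk k (addx a b) = (sgnk k a + sgnk k b)%N.
Proof. by rewrite -big_split; apply: eq_bigr => j _; rewrite ffunE. Qed.

Lemma sgnk_even i a : ~~ mu m i.+1 -> sgnk i.+1 a = 0%N.
Proof.
rewrite /sgnk /mu -leqNgt => im; rewrite big_pred0 // => j; apply/negbTE.
by rewrite negb_and -!leqNgt; lia.
Qed.

Definition unitx i : {ffun 'I_(m + n) -> nat} := [ffun j => (j == i) : nat].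

Lemma sgn_unitl i b : sgn (unitx i) b = if mu m i.+1 then sgnk i.+1 b else 0%N.
Proof.
rewrite /sgn; case: ifP => mi.
  rewrite (bigD1 i) //= [X in (_ + X)%N]big1 ?addn0; last first.
    by move=> j /andP[_ /negPf ji]; rewrite big1 // => l _; rewrite ffunE ji.
  by apply: eq_big => [j|j _]; rewrite ?ltnS // ffunE eqxx mul1n.
rewrite big1 // => j mj; rewrite big1 // => l _; rewrite ffunE.
by case: eqP => // ji; rewrite ji mi in mj.
Qed.

Definition sgnr i a : nat := (\sum_(j < m + n | mu m j.+1 && (i < j)) a j)%N.

Lemma sgn_unitr i a : sgn a (unitx i) = if mu m i.+1 then sgnr i a else 0%N.
Proof.
rewrite /sgn (eq_bigr (fun j : 'I_(m + n) => if mu m i.+1 && (i < j)%N then a j else 0%N)).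
  case: ifP => mi /=; last by rewrite big1.
  by rewrite -big_mkcondr.
move=> j mj; case: ifP => [/andP[mi ij]|nij].
  rewrite (bigD1 i) ?mi ?ij //= ffunE eqxx muln1 big1 ?addn0 // => l /andP[_ /negPf li].
  by rewrite ffunE li muln0.
rewrite big1 // => l ml; rewrite ffunE; case: eqP => [li|_]; last by rewrite muln0.
by rewrite -li ml in nij.
Qed.

Lemma low_unit i a : (0 < a i)%N -> a = addx (low i a) (unitx i).
Proof. by move=> ai; rewrite -{1}(lowK ai); apply/ffunP => j; rewrite !ffunE. Qed.

Lemma parx_unit i : parx (unitx i) = mu m i.+1.
Proof.
rewrite /parx big_mkcond (bigD1 i) //= ffunE eqxx [X in (_ + X)%N]big1 ?addn0; first by case: ifP.
by move=> j /negPf ji; rewrite ffunE ji if_same.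
Qed.

Lemma parx_split i a : mu m i.+1 -> parx a = odd (sgnk i.+1 a + a i + sgnr i a).
Proof.
move=> mi; rewrite /parx (bigD1 i) //= (bigID (fun j : 'I_(m + n) => j < i)%N) /= addnCA addnA.
congr (odd (_ + _ + _)); apply: eq_bigl => j; rewrite -val_eqE /=; case: (mu m j.+1) => //=; lia.
Qed.

Lemma low_addxl i a b : (0 < a i)%N -> addx (low i a) b = low i (addx a b).
Proof.
move=> ai; apply/ffunP => j; rewrite !ffunE; case: eqP => [->|_]; last by rewrite !subn0.
by rewrite addnC addnBA // addnC.
Qed.

Lemma low_addxr i a b : (0 < b i)%N -> addx a (low i b) = low i (addx a b).
Proof.
by move=> bi; apply/ffunP => j; rewrite !ffunE; case: eqP => [->|_]; rewrite ?subn0 ?addnBA.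
Qed.

Hypothesis charFp : p \in [pchar F].

(** For an even variable this is Pascal's rule, apart from the overflow that characteristic p takes
    care of; for an odd variable the four cases of exponents 0 and 1 are checked with their
    signs. *)
Lemma leibniz_mon i (x y : X) (a := expo x) (b := expo y) :
  partial_fun i.+1 (dp_mul (mon a) (mon b)) =
  dp_mul (partial_fun i.+1 (mon a)) (mon b)
  + dp_mul (sg (mu m i.+1) (mon a)) (partial_fun i.+1 (mon b)).
Proof.
have /forallP/(_ i) ba := expo_bounded x; have /forallP/(_ i) bb := expo_bounded y.
rewrite -/a -/b in ba bb.
rewrite mul_mon linearZ /=.
rewrite !partial_mon sg_mon !mul_lin !mul_mon -!/(addx _ _) !scalerA.
rewrite (ltn_eqF ba) (ltn_eqF bb) !andbT /=.
have ab : addx a b i = (a i + b i)%N by rewrite ffunE.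
rewrite !(bin_mulE i) ab binx_lowl binx_lowr.
have lowa : low i a i = (a i).-1 by rewrite ffunE eqxx subn1.
have lowb : low i b i = (b i).-1 by rewrite ffunE eqxx subn1.
rewrite lowa lowb.
set B := binx _ _ _.
have [mi|mi] := boolP (mu m i.+1).
  have b2 := bnd_odd p t mi; rewrite b2 in ba bb *.
  rewrite sgnk_addx (parx_split _ mi) !signr_odd !exprD.
  have sa c : (0 < a i)%N -> sgn a c = (sgn (low i a) c + sgnk i.+1 c)%N.
    by move=> ai; rewrite [in LHS](low_unit ai) sgnDl sgn_unitl mi.
  have sb c : (0 < b i)%N -> sgn c b = (sgn c (low i b) + sgnr i c)%N.
    by move=> bi; rewrite [in LHS](low_unit bi) sgnDr sgn_unitr mi.
  have lr : (0 < a i)%N -> sgnr i (low i a) = sgnr i a.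
    move=> _; apply: eq_bigr => j /andP[_ ij]; rewrite ffunE.
    by case: eqP ij => [->|_]; rewrite ?ltnn ?subn0.
  have lk : sgnk i.+1 (low i b) = sgnk i.+1 b.
    by apply: eq_bigr => j /andP[_ ji]; rewrite ffunE; case: eqP ji => [->|_]; rewrite ?ltnn ?subn0.
  case ai : (a i) ba => [|[|//]] _; case bi : (b i) bb => [|[|//]] _ //=;
    rewrite ?ai ?bi in sa sb lr.
  - by rewrite !mul0r !mulr0 !mul0r !scale0r addr0.
  - rewrite !mul0r scale0r add0r low_addxr ?bi //; congr (_ *: _).
    by rewrite sb // addn0; sign_ring.
  - rewrite !(mul0r, mulr0) scale0r addr0 low_addxl ?ai //; congr (_ *: _).
    by rewrite sa //; sign_ring.
  (* The odd variable occurs in both factors: the product is 0, and the two terms on the right must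
     cancel. *)
  - rewrite !(mul0r, mulr0) scale0r low_addxl ?ai // low_addxr ?bi // -scalerDl.
    rewrite [X in X *: _](_ : _ = 0) ?scale0r // (sa (low i b)) // (sb (low i a)) // lr // lk.
    by sign_ring.
have [j [_ bij]] := bnd_even p t mi.
have sa : sgn (low i a) b = sgn a b.
  case: (posnP (a i)) => ai; last by rewrite [in RHS](low_unit ai) sgnDl sgn_unitl (negPf mi) addn0.
  by congr (sgn _ _); apply/ffunP => l; rewrite ffunE; case: eqP => [->|]; rewrite ?ai ?subn0.
have sb : sgn a (low i b) = sgn a b.
  case: (posnP (b i)) => bi; last by rewrite [in RHS](low_unit bi) sgnDr sgn_unitr (negPf mi) addn0.
  by congr (sgn _ _); apply/ffunP => l; rewrite ffunE; case: eqP => [->|]; rewrite ?bi ?subn0.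
rewrite sa sb !sgnk_even // !expr0 !mulr1 !mul1r bij in ba bb *.
case ai : (a i) ba => [|k] ba; case bi : (b i) bb => [|l] bb /=.
- by rewrite !(mul0r, mulr0) !scale0r addr0.
- rewrite !(mul0r, mulr0) scale0r add0r low_addxr ?bi // ltn_eqF ?add0n //=.
  by congr (_ *: _); rewrite !bin0; sign_ring.
- rewrite !(mul0r, mulr0) scale0r addr0 low_addxl ?ai // addn0 ltn_eqF //=.
  by congr (_ *: _); rewrite !addn0 !binn; sign_ring.
rewrite low_addxl ?ai // low_addxr ?bi // -scalerDl.
have -> : (k.+1 + l.+1 = (k + l.+1).+1)%N by lia.
have -> : (k.+1 + l = k + l.+1)%N by lia.
case: (eqVneq (k + l.+1).+1 (p ^ t j))%N => [E|nE] /=; last first.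
  by rewrite binS natrD; congr (_ *: _); sign_ring.
(* The product overflows by exactly one: Pascal's rule adds the two coefficients on the right to a
   binomial of p^t, which is 0 mod p. *)
rewrite !mulr0 scale0r [X in X *: _](_ : _ = 0) ?scale0r // !mul1r -mulrDr -mulrDl -natrD addnC -binS E.
by rewrite bin_pchar ?mul0r ?mulr0 // -E; lia.
Qed.

Lemma leibniz k f g : partial_fun k (dp_mul f g) =
  dp_mul (partial_fun k f) g + dp_mul (sg (mu m k) f) (partial_fun k g).
Proof.
case: (boolP (0 < k <= m + n)%N) => [/andP[k0 kmn]|nk]; last first.
  by rewrite !partial_out // !mul_lin addr0.
have -> : k = (Ordinal (leq_trans (n := k) (eq_leq (prednK k0)) kmn)).+1 by rewrite /= prednK.
move: (Ordinal _) => i {k k0 kmn}.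
elim/mon_ind: f => [|f f' IH IH'|s f IH|x];
  rewrite ?mul_lin ?(linear0, linearD, linearZ) /= ?mul_lin ?addr0 ?IH ?IH' //.
- by rewrite addrACA.
- by rewrite scalerDr.
elim/mon_ind: g => [|g g' IH IH'|s g IH|y];
  rewrite ?mul_lin ?(linear0, linearD, linearZ) /= ?mul_lin ?addr0 ?IH ?IH' //.
- by rewrite addrACA.
- by rewrite scalerDr.
exact: leibniz_mon.
Qed.

End Leibniz.

Section Partial.

Variables (F : fieldType) (p m n : nat) (t : 'I_m -> nat).
Notation O := (dpsa F p n t).
Notation X := (monomial p n t).
Notation bnd := (@expo_bound p m n t).
Notation mon := (@mon F p m n t).
Notation one := (one F p n t).
Implicit Types (f g h : O) (a b c : {ffun 'I_(m + n) -> nat}) (k : nat) (i j : 'I_(m + n)).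

Lemma sgnk_low i j a : (i < j)%N -> (0 < a i)%N ->
  sgnk j.+1 a = (sgnk j.+1 (low i a) + mu m i.+1)%N.
Proof.
move=> ij ai; rewrite [in LHS](low_unit ai) sgnk_addx; congr (_ + _)%N.
rewrite /sgnk big_mkcond (bigD1 i) //= big1 ?addn0.
  by rewrite ltnS ij andbT ffunE eqxx; case: ifP.
by move=> l /negPf li; rewrite ffunE li if_same.
Qed.

Lemma sgnk_low_ge i j a : (j <= i)%N -> sgnk j.+1 (low i a) = sgnk j.+1 a.
Proof.
move=> ji; apply: eq_bigr => l /andP[_]; rewrite ltnS ffunE => lj.
by case: eqP lj => [->|_]; rewrite ?subn0 // ltnNge ji.
Qed.

Lemma partialC_lt i j f : (i < j)%N -> partial_fun i.+1 (partial_fun j.+1 f) =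
  (-1) ^+ (mu m i.+1 && mu m j.+1) *: partial_fun j.+1 (partial_fun i.+1 f).
Proof.
move=> ij; elim/mon_ind: f => [|f f' IH IH'|s f IH|x];
  rewrite ?(linear0, linearD, linearZ) /= ?(linear0, linearD, linearZ) /= ?scaler0 ?IH ?IH' //.
  by rewrite !scalerA mulrC.
set a := expo x; rewrite !partial_mon. rewrite !linearZ /= !partial_mon !scalerA.
have nij : (i == j) = false by rewrite -val_eqE ltn_eqF.
have -> : low j a i = a i by rewrite ffunE nij subn0.
have -> : low i a j = a j by rewrite ffunE eq_sym nij subn0.
have -> : low i (low j a) = low j (low i a) by apply/ffunP => l; rewrite !ffunE subnAC.
congr (_ *: _); rewrite (sgnk_low_ge _ (ltnW ij)).
case: (posnP (a i)) => ai /=; first by rewrite !(mul0r, mulr0).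
rewrite [in LHS](sgnk_low ij ai); have -> : (mu m i.+1 && mu m j.+1) = mu m i.+1.
  by rewrite /mu; case: (ltnP m i.+1) => //= H; apply/idP; apply: leq_trans H _; rewrite ltnW // ltnS.
by case: (mu m i.+1); sign_ring.
Qed.

Lemma partial_odd2 i f : mu m i.+1 -> partial_fun i.+1 (partial_fun i.+1 f) = 0.
Proof.
move=> mi; elim/mon_ind: f => [|f f' IH IH'|s f IH|x];
  rewrite ?(linear0, linearD, linearZ) /= ?(linear0, linearD, linearZ) /= ?IH ?IH' ?addr0 ?scaler0 //.
have /forallP/(_ i) := expo_bounded x; move: (expo x) => a; rewrite bnd_odd // => H.
have E : low i a i = 0%N by rewrite ffunE eqxx; case: (a i) H => [|[]].
by rewrite partial_mon linearZ /= partial_mon E mul0r scale0r scaler0.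
Qed.

Lemma validP k : (0 < k <= m + n)%N -> exists i : 'I_(m + n), k = i.+1.
Proof. by case: k => // k /= kmn; exists (Ordinal kmn). Qed.

Lemma partialC k l f : partial_fun k (partial_fun l f) =
  (-1) ^+ (mu m k && mu m l) *: partial_fun l (partial_fun k f).
Proof.
case: (boolP (0 < k <= m + n)%N) => [/validP[i ->]|nk]; last first.
  by rewrite !(partial_out _ nk) linear0 scaler0.
case: (boolP (0 < l <= m + n)%N) => [/validP[j ->]|nl]; last first.
  by rewrite !(partial_out _ nl) linear0 scaler0.
case: (ltngtP i j) => [ij|ji|/val_inj <-]; first exact: partialC_lt.
  by rewrite (partialC_lt _ ji) scalerA andbC -signr_addb addbb expr0 scale1r.
case: (boolP (mu m i.+1)) => [mi|_]; last by rewrite expr0 scale1r.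
by rewrite partial_odd2 // scaler0.
Qed.

Lemma hom_partial e k f : hom e f -> hom (e (+) mu m k) (partial_fun k f).
Proof.
case: (boolP (0 < k <= m + n)%N) => [/validP[i ->]|nk]; last first.
  by rewrite !(partial_out _ nk) => _; exact: hom0.
move=> hf; elim/hom_ind: hf => [|u v|s u|x xe];
  rewrite ?(linear0, linearD, linearZ) /=; [exact: hom0|exact: homD|exact: homZ|].
rewrite partial_mon; case: posnP => ai; first by rewrite mul0r scale0r; exact: hom0.
apply: homZ; rewrite -xe mono_parE [in parx _](low_unit ai) parxD parx_unit addbK; exact: hom_mon.
Qed.

Lemma sg_partial e k f : sg e (partial_fun k f) = (-1) ^+ (e && mu m k) *: partial_fun k (sg e f).
Proof.
have H e' g : hom e' g -> sg e (partial_fun k g) = (-1) ^+ (e && mu m k) *: partial_fun k (sg e g).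
  move=> hg; rewrite (sg_hom _ (hom_partial k hg)) (sg_hom _ hg) linearZ /= scalerA.
  by rewrite andb_addr signr_addb mulrC.
by rewrite (hpartD f) !linearD /= !(H _ _ (hom_hpart _ _)) ?linearD ?scalerDr.
Qed.

Lemma sgK e f : sg e (sg e f) = f.
Proof. by apply: coefP => x; rewrite !coef_sg; case: (e && _); ring. Qed.

Lemma partial_one k : partial_fun k one = 0.
Proof.
case: (boolP (0 < k <= m + n)%N) => [/validP[i ->]|/partial_out -> //].
by rewrite partial_mon ffunE mul0r scale0r.
Qed.

Lemma varE i : var F p n t i.+1 = mon (unitx i).
Proof.
apply: coefP => x; rewrite coef_mon [LHS]ffunE ltn_ord /=; congr (nat_of_bool _)%:R.
apply/forallP/eqP => [H|H j].
  by apply/ffunP => j; rewrite !ffunE (eqP (H j)) eqSS.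
by have /ffunP/(_ j) := H; rewrite !ffunE eqSS -val_eqE => ->.
Qed.

Lemma var_out k : ~~ (0 < k <= m + n)%N -> var F p n t k = 0.
Proof. by move=> /negPf nk; apply: coefP => x; rewrite dcoef0 [LHS]ffunE nk. Qed.

Hypothesis bnd_gt1 : forall i, (1 < bnd i)%N.

Lemma partial_var k l : partial_fun k (var F p n t l) = ((k == l) && (0 < k <= m + n)%N)%:R *: one.
Proof.
case: (boolP (0 < k <= m + n)%N) => [/validP[i ->]|nk]; last by rewrite partial_out // andbF scale0r.
rewrite andbT; case: (boolP (0 < l <= m + n)%N) => [/validP[j ->]|nl]; last first.
  rewrite var_out // linear0; case: eqP => [E|_]; rewrite ?scale0r //.
  by rewrite -E ltn_ord in nl.
rewrite varE partial_mon ffunE eqSS -val_eqE; case: (eqVneq (i : nat) j) => [/val_inj <-|_]; last first.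
  by rewrite mul0r !scale0r.
rewrite /= (ltn_eqF (bnd_gt1 i)) mul1r scale1r.
have -> : low i (unitx i) = [ffun => 0%N] by apply/ffunP => l'; rewrite !ffunE subnn.
by rewrite /sgnk big1 ?expr0 ?scale1r // => l0 /andP[_ li]; rewrite ffunE -val_eqE /= ltn_eqF.
Qed.

Lemma hom_var k : hom (mu m k) (var F p n t k).
Proof.
case: (boolP (0 < k <= m + n)%N) => [/validP[i ->]|/var_out->]; last exact: hom0.
rewrite varE -parx_unit; exact: hom_mon.
Qed.

Lemma coef_partial_up i f x y : expo x = up i (expo y) ->
  coef (partial_fun i.+1 f) y = (-1) ^+ sgnk i.+1 (expo y) * coef f x.
Proof.
move=> E; rewrite coef_partial (big_pred1 x) // => z.
by rewrite -E (inj_eq (@expo_inj _ _ _ _)).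
Qed.

Lemma low_bounded i (x : X) : exists y : X, expo y = low i (expo x).
Proof.
apply/boundedP/forallP => j; have /forallP/(_ j) := expo_bounded x.
by rewrite !ffunE; apply: leq_ltn_trans; rewrite leq_subr.
Qed.

Lemma partial_eq0 f : (forall k, partial_fun k f = 0) -> f = coef f [ffun => Ordinal (ltnW (bnd_gt1 _))] *: one.
Proof.
move=> H; apply: coefP => x; rewrite coefZ coef_mon.
case: (pickP (fun i => 0 < expo x i)%N) => [i xi|x0].
  have [y yx] := low_bounded i x.
  have := coef_partial_up f (etrans (esym (lowK xi)) (congr1 (up i) (esym yx))).
  rewrite H dcoef0 => /esym/eqP; rewrite mulf_eq0 signr_eq0 => /eqP->.
  by case: eqP => [E|_]; rewrite ?mulr0 //; rewrite E ffunE in xi.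
have -> : expo x = [ffun => 0%N].
  by apply/ffunP => i; rewrite [RHS]ffunE; apply/eqP; rewrite -leqn0 leqNgt x0.
rewrite eqxx mulr1; congr coef; apply/ffunP => i; apply/val_inj; rewrite ffunE /=.
by have := x0 i; rewrite ffunE; case: (x i : nat).
Qed.

End Partial.

(** * Dimensions of the even and odd parts *)

Section Vspace.

Variables (F : fieldType) (V : vectType F) (I : finType) (S : {set I}) (v : I -> V).

(** Independence of a family indexed by a finite set, so that sets of monomials need not be
    enumerated as sequences. *)
Definition indep := forall w : I -> F, \sum_(i in S) w i *: v i = 0 -> forall i, i \in S -> w i = 0.

Lemma dim_indep (L : {vspace V}) : indep -> (forall i, i \in S -> v i \in L) -> (#|S| <= \dim L)%N.
Proof.
move=> H HL; pose X := [tuple v (enum_val i) | i < #|S|].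
have XE (i : 'I_#|S|) : X`_i = v (enum_val i) by rewrite -tnth_nth tnth_mktuple.
have /eqP fX : free X.
  apply/freeP => k k0 i; pose w j := \sum_(l | enum_val l == j) k l.
  have wE (l : 'I_#|S|) : w (enum_val l) = k l.
    by apply: big_pred1 => l'; rewrite (inj_eq enum_val_inj).
  rewrite -wE; apply: H (enum_valP i); rewrite big_enum_val -[RHS]k0.
  by apply: eq_bigr => l _; rewrite wE XE.
rewrite -(size_tuple X) -fX dimvS //; apply/span_subvP => _ /mapP[i _ ->].
exact/HL/enum_valP.
Qed.

End Vspace.

Section Invariant.

Variable F : fieldType.

Definition fixpart (V : vectType F) (pr : bool -> 'End(V)) e : {vspace 'End(V)} :=
  fixedSpace (linfun (op_part pr e)).

Lemma fixpartP (V : vectType F) (pr : bool -> 'End(V)) e D :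
  reflect (op_part pr e D = D) (D \in fixpart pr e).
Proof. by apply: (iffP fixedSpaceP); rewrite lfunE. Qed.

(** The last clause stands for spanning: with independence it makes the family a basis, and as an
    inequality it can be proved through any spanning family of the same size. *)
Definition graded_basis (V : vectType F) (pr : bool -> 'End(V)) (L : {vspace 'End(V)})
    (I : finType) (S : {set I}) (v : I -> 'End(V)) (par : I -> bool) : Prop :=
  [/\ forall i, i \in S -> v i \in L,
      forall i, i \in S -> op_part pr (par i) (v i) = v i,
      indep S v & (\dim L <= #|S|)%N].

Lemma indep_sub (V : vectType F) (I : finType) (S : {set I}) (v : I -> V) (P : pred I) :
  indep S v -> indep [set i in S | P i] v.
Proof.
move=> H w w0 i; rewrite inE => /andP[iS Pi].
have := H (fun i => if P i then w i else 0) _ i iS; rewrite Pi; apply.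
rewrite -[RHS]w0 [RHS]big_mkcond [LHS]big_mkcond; apply: eq_bigr => j _; rewrite inE.
by case: (j \in S); case: (P j); rewrite /= ?scale0r.
Qed.

Lemma card_bipart (I : finType) (S : {set I}) (par : I -> bool) :
  (#|[set i in S | par i == false]| + #|[set i in S | par i == true]| = #|S|)%N.
Proof.
rewrite -(cardsID [set i | par i == false] S); congr (_ + _)%N; apply: eq_card => i; rewrite !inE //.
by case: (par i); case: (i \in S).
Qed.

Lemma graded_basis_dim (V : vectType F) (pr : bool -> 'End(V)) L I S v par :
  (fixpart pr false :&: fixpart pr true = 0)%VS ->
  @graded_basis V pr L I S v par -> forall e, \dim (L :&: fixpart pr e) = #|[set i in S | par i == e]|.
Proof.
move=> dis [vL vpar indv dimL].
have H e : (#|[set i in S | par i == e]| <= \dim (L :&: fixpart pr e))%N.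
  apply: (dim_indep (v := v)); first exact: (indep_sub (P := fun i => par i == e)).
  move=> i; rewrite inE => /andP[iS /eqP<-]; rewrite memv_cap vL //; exact/fixpartP/vpar.
have D : (\dim (L :&: fixpart pr false) + \dim (L :&: fixpart pr true) <= #|S|)%N.
  apply: leq_trans dimL; rewrite -dimv_disjoint_sum.
    by apply: dimvS; rewrite subv_add !capvSl.
  apply/eqP; rewrite -subv0 -dis subv_cap.
  by rewrite (subv_trans (capvSl _ _)) ?capvSr // (subv_trans (capvSr _ _)) // capvSr.
have := H false; have := H true; have := card_bipart S par.
by move=> E H1 H2 []; apply/eqP; rewrite eqn_leq H andbT; lia.
Qed.

(** Preservation of parity gives one inequality in each parity, from L to M. Surjectivity bounds the
    total for M by the total for L, so both inequalities are equalities. *)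
Lemma super_isom_card (V V' : vectType F) (pr : bool -> 'End(V)) (pr' : bool -> 'End(V'))
    L M I S v par I' S' v' par' :
  (fixpart pr false :&: fixpart pr true = 0)%VS ->
  (fixpart pr' false :&: fixpart pr' true = 0)%VS ->
  @graded_basis V pr L I S v par -> @graded_basis V' pr' M I' S' v' par' ->
  super_isom pr pr' L M ->
  forall e, #|[set i in S | par i == e]| = #|[set i in S' | par' i == e]|.
Proof.
move=> dis dis' gL gM [phi [phiL inj par_phi _]].
have dL := graded_basis_dim dis gL; have dM := graded_basis_dim dis' gM.
have lim (U : {vspace 'End(V)}) : (U <= L)%VS -> \dim (phi @: U) = \dim U.
  move=> UL; apply: limg_dim_eq; apply/eqP; rewrite -subv0; apply/subvP => D.
  rewrite memv_cap memv_ker memv0 => /andP[/(subvP UL) DL /eqP D0].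
  by apply/eqP; apply: (inj D 0); rewrite ?mem0v ?linear0.
have H e : (\dim (L :&: fixpart pr e) <= \dim (M :&: fixpart pr' e))%N.
  rewrite -lim ?capvSl //; apply: dimvS; apply/subvP => D' /memv_imgP[D].
  rewrite memv_cap => /andP[DL /fixpartP De] ->.
  rewrite memv_cap -phiL memv_img //; exact/fixpartP/par_phi.
have c1 : (#|S'| <= #|S|)%N.
  case: gM => [vM _ iM _]; apply: leq_trans (dim_indep iM vM) _.
  by rewrite -phiL lim //; case: gL.
have := H false; have := H true; rewrite !dL !dM.
have := card_bipart S par; have := card_bipart S' par'.
by move=> E1 E2 H1 H2 []; lia.
Qed.

End Invariant.

Section Operators.

Variables (F : fieldType) (p m n : nat) (t : 'I_m -> nat).
Notation O := (dpsa F p n t).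
Notation pr := (parity_proj F p n t).
Implicit Types (f g h : O) (D E : 'End(O)) (d e : bool) (k : nat).

Definition pardeg d D := forall e f, hom e f -> hom (e (+) d) (D f).

Lemma op_partE d e D : pardeg d D -> op_part pr e D = if e == d then D else 0.
Proof.
move=> hD; apply/lfunP => f; rewrite /op_part sum_lfunE.
have E e' : (pr (e (+) e') \o D \o pr e')%VF f = if e == d then D (hpart e' f) else 0.
  rewrite !comp_lfunE !lfunE /=.
  have hD' := hD _ _ (hom_hpart e' f); case: eqP => [->|ed]; first by rewrite addbC.
  apply: coefP => x; rewrite coef_hpart dcoef0; case: eqP => // xe.
  by move/homP: hD' => -> //; rewrite xe addbC; apply/eqP => /addbI.
under eq_bigr do rewrite E.
rewrite big_bool /=; case: ifP => _; last by rewrite addr0 zero_lfunE.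
by rewrite -linearD addrC -hpartD.
Qed.

Lemma pardeg_op_part d D : op_part pr d D = D -> pardeg d D.
Proof.
move=> <- e f he; rewrite /op_part sum_lfunE; apply: hom_sum => e' _.
rewrite !comp_lfunE !lfunE /=; case: (eqVneq e' e) => [->|e'e].
  by rewrite addbC; exact: hom_hpart.
rewrite (_ : hpart e' f = 0) ?linear0; first exact: hom0.
apply: coefP => x; rewrite coef_hpart dcoef0; case: eqP => // xe.
by move/homP: he => -> //; rewrite xe.
Qed.

Lemma fixpart_dis : (fixpart pr false :&: fixpart pr true = 0)%VS.
Proof.
apply/eqP; rewrite -subv0; apply/subvP => D; rewrite memv_cap memv0.
case/andP => /fixpartP/pardeg_op_part D0 /fixpartP E1.
by rewrite -E1 (op_partE _ D0).
Qed.

Lemma bracketE d e D E : pardeg d D -> pardeg e E ->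
  bracket pr D E = (D \o E)%VF - (-1) ^+ (d && e) *: (E \o D)%VF.
Proof.
move=> hD hE; rewrite /bracket !big_bool /= !(op_partE _ hD) !(op_partE _ hE).
by case: d hD => hD; case: e hE => hE; rewrite /= ?comp_lfun0l ?comp_lfun0r ?scaler0 ?subr0 ?addr0 ?add0r.
Qed.

Lemma comm_lfunE (s : F) D E f : ((D \o E)%VF - s *: (E \o D)%VF) f = D (E f) - s *: E (D f).
Proof. by rewrite add_lfunE opp_lfunE scale_lfunE !comp_lfunE. Qed.

Lemma op_partD e D E : op_part pr e (D + E) = op_part pr e D + op_part pr e E.
Proof. exact: linearD. Qed.

Lemma pardeg0 d : pardeg d 0.
Proof. by move=> e f _; rewrite zero_lfunE; exact: hom0. Qed.
Lemma pardegD d D E : pardeg d D -> pardeg d E -> pardeg d (D + E).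
Proof. by move=> hD hE e f hf; rewrite add_lfunE; apply: homD; [apply: hD|apply: hE]. Qed.
Lemma pardegZ d (s : F) D : pardeg d D -> pardeg d (s *: D).
Proof. by move=> hD e f hf; rewrite scale_lfunE; apply/homZ/hD. Qed.
Lemma pardeg_sum d I (r : seq I) (P : pred I) (G : I -> 'End(O)) :
  (forall u, P u -> pardeg d (G u)) -> pardeg d (\sum_(u <- r | P u) G u).
Proof. by move=> H; apply: big_ind => //; [apply: pardeg0 | apply: pardegD]. Qed.
Lemma pardeg_partial k : pardeg (mu m k) (partial F p n t k).
Proof. by move=> e f hf; rewrite lfunE; apply: hom_partial. Qed.

Lemma smulE f D g : smul f D g = dp_mul f (D g).
Proof. by rewrite comp_lfunE lfunE. Qed.

Lemma partialE k g : partial F p n t k g = partial_fun k g.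
Proof. by rewrite lfunE. Qed.

Lemma pardeg_smul d e f D : hom e f -> pardeg d D -> pardeg (e (+) d) (smul f D).
Proof. by move=> hf hD e' g hg; rewrite smulE addbCA; apply: homM hf (hD _ _ hg). Qed.

Lemma extendE (V : lmodType F) (T : bool -> O -> V) e a :
  (forall e', linear (T e')) -> hom e a -> extend T a = T e a.
Proof.
move=> linT ha; rewrite /extend big_bool /=.
have T0 e' : T e' 0 = 0.
  have := linT e' 1 0 0; rewrite scaler0 scale1r addr0 => /eqP.
  by rewrite -subr_eq0 opprD addNKr oppr_eq0 => /eqP.
have Z e' : e' != e -> hpart e' a = 0.
  move=> ee'; apply: coefP => x; rewrite coef_hpart dcoef0; case: eqP => // xe.
  by move/homP: ha => -> //; rewrite xe.
by rewrite /hom in ha; case: e ha Z => ha Z; rewrite ha (Z true, Z false) // T0 ?addr0 ?add0r.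
Qed.

End Operators.

(** * Vector fields *)

Lemma dim_le_family (F : fieldType) (V : vectType F) (I : finType) (S : {set I}) (v : I -> V)
    (L : {vspace V}) :
  (forall u, u \in L -> exists w : I -> F, u = \sum_(i in S) w i *: v i) -> (\dim L <= #|S|)%N.
Proof.
move=> H; rewrite cardE -(size_map v) (leq_trans _ (dim_span _)) //.
apply/dimvS/subvP => u /H[w ->]; apply: memv_suml => i iS; apply/memvZ/memv_span.
by rewrite map_f // mem_enum.
Qed.

Section Count.

Variables (F : fieldType) (p m n : nat) (t : 'I_m -> nat).
Notation O := (dpsa F p n t).
Notation X := (monomial p n t).
Notation bnd := (@expo_bound p m n t).
Notation mon := (@mon F p m n t).
Notation pf := (@partial_fun F p m n t).
Notation var := (var F p n t).
Notation one := (one F p n t).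
Implicit Types (f g h : O) (a b c : {ffun 'I_(m + n) -> nat}) (k : nat) (i j : 'I_(m + n)).

(** The argument [x] is only a default value, returned when [a] is out of bounds. *)
Definition mkx (x : X) a : X := odflt x [pick y | expo y == a].

Lemma mkxE x a : bounded p t a -> expo (mkx x a) = a.
Proof. by case/boundedP => y <-; rewrite /mkx; case: pickP => [z /eqP //|/(_ y)]; rewrite eqxx. Qed.

(** For an odd variable: inserts it or removes it. This is an involution of the monomials that
    reverses parity, so a set stable under it has as many even as odd members. *)
Definition flip i a : {ffun 'I_(m + n) -> nat} := [ffun j => if j == i then 1 - a j else a j]%N.

Lemma flipE i a j : flip i a j = if j == i then (1 - a j)%N else a j.
Proof. exact: ffunE. Qed.

Lemma flip_bounded i (x : X) : mu m i.+1 -> bounded p t (flip i (expo x)).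
Proof.
move=> mi; apply/forallP => j; rewrite flipE; case: eqP => [->|_].
  by rewrite bnd_odd // ltnS leq_subr.
exact: (forallP (expo_bounded x)).
Qed.

Lemma parx_flip i (x : X) : mu m i.+1 -> parx (flip i (expo x)) = ~~ parx (expo x).
Proof.
move=> mi; rewrite /parx (bigD1 i) //= [in RHS](bigD1 i) //= !oddD.
rewrite (eq_bigr (expo x)) => [|j /andP[_ ji]]; last by rewrite flipE (negPf ji).
rewrite flipE eqxx -addNb; congr addb.
have /forallP/(_ i) := expo_bounded x; rewrite bnd_odd //.
by case: (expo x i) => [|[]].
Qed.

Lemma flipK i (x : X) : mu m i.+1 -> flip i (flip i (expo x)) = expo x.
Proof.
move=> mi; apply/ffunP => j; rewrite !flipE; case: eqP => // ->.
by have /forallP/(_ i) := expo_bounded x; rewrite bnd_odd // => H; rewrite subKn.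
Qed.

Definition flipx i x := mkx x (flip i (expo x)).

Lemma flipxE i x : mu m i.+1 -> expo (flipx i x) = flip i (expo x).
Proof. by move=> mi; rewrite mkxE // flip_bounded. Qed.

Lemma flipx_inj i : mu m i.+1 -> injective (flipx i).
Proof.
move=> mi x y /(congr1 (@expo _ _ _ _)); rewrite !flipxE // => /(congr1 (flip i)).
by rewrite !flipK // => /expo_inj.
Qed.

Lemma card_flip i (P : pred X) e : mu m i.+1 -> (forall x, P (flipx i x) = P x) ->
  #|[set x | P x && (parx (expo x) == e)]| = #|[set x | P x && (parx (expo x) == ~~ e)]|.
Proof.
move=> mi HP; rewrite -(card_imset _ (flipx_inj mi)); apply: eq_card => x.
apply/imsetP/idP => [[y]|]; rewrite !inE => /andP[Px xe].
  by move=> ->; rewrite HP flipxE // parx_flip // (eqP xe) Px eqxx.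
exists (flipx i x); last by apply: (@expo_inj p m n t); rewrite !flipxE // flipK.
by rewrite inE HP Px flipxE // parx_flip // (eqP xe) negbK eqxx.
Qed.

Lemma card_flip2 i (P : pred X) e : mu m i.+1 -> (forall x, P (flipx i x) = P x) ->
  (2 * #|[set x | P x && (parx (expo x) == e)]| = #|[set x | P x]|)%N.
Proof.
move=> mi HP; have := card_bipart [set x | P x] (fun x => parx (expo x)).
have -> e' : [set i0 in [set x | P x] | parx (expo i0) == e'] = [set x | P x && (parx (expo x) == e')].
  by apply/setP => x; rewrite !inE.
have -> e' : [set i0 in [set x | P x] | parx (expo i0) == e'] = [set x | P x && (parx (expo x) == e')].
  by apply/setP => x; rewrite !inE.
have := card_flip false mi HP; case: e => /=; lia.
Qed.

Lemma card_monomial : (#|{: X}| = p ^ (\sum_(i < m) t i) * 2 ^ n)%N.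
Proof.
rewrite card_dep_ffun foldrE big_map big_enum /=.
under eq_bigr do rewrite card_ord.
rewrite big_split_ord /= -[X in (_ * _ ^ X)%N]card_ord -prod_nat_const expn_sum; congr (_ * _)%N.
  by apply: eq_bigr => i _; rewrite /expo_bound -[lshift _ _]/(unsplit (inl i)) unsplitK.
by apply: eq_bigr => i _; rewrite /expo_bound -[rshift _ _]/(unsplit (inr i)) unsplitK.
Qed.

Definition vec (g : nat -> O) : 'End(O) := \sum_(1 <= k < (m + n).+1) smul (g k) (partial F p n t k).

Lemma vecE (g : nat -> O) h : vec g h = \sum_(1 <= k < (m + n).+1) dp_mul (g k) (pf k h).
Proof. by rewrite sum_lfunE; apply: eq_bigr => k _; rewrite smulE partialE. Qed.

Lemma smulZ s g D : smul (s *: g) D = s *: smul g D :> 'End(O).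
Proof. by apply/lfunP => h; rewrite scale_lfunE !smulE mulZl. Qed.

Lemma smulDl g h D : smul (g + h) D = smul g D + smul h D :> 'End(O).
Proof. by rewrite -{1}[g]scale1r smul_linear scale1r. Qed.

Lemma smul0l D : smul 0 D = 0 :> 'End(O).
Proof. by rewrite -(scale0r (0 : O)) smulZ scale0r. Qed.

Lemma smulDr g D D' : smul g (D + D') = smul g D + smul g D' :> 'End(O).
Proof. exact: comp_lfunDr. Qed.

Lemma smulZr s g D : smul g (s *: D) = s *: smul g D :> 'End(O).
Proof. exact: esym (comp_lfunZr _ _ _). Qed.

Lemma pardeg_vec d (g : nat -> O) : (forall k, (0 < k <= m + n)%N -> hom (d (+) mu m k) (g k)) -> pardeg d (vec g).
Proof.
move=> H; rewrite /vec big_nat; apply: pardeg_sum => k kP.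
have := pardeg_smul (H k kP) (@pardeg_partial F p m n t k).
by rewrite -addbA addbb addbF.
Qed.

Lemma sgE (b : bool) f : sg b f = hpart false f + (-1) ^+ b *: hpart true f.
Proof.
apply: coefP => x; rewrite coef_sg coefD coefZ !coef_hpart.
by case: mono_par; case: b => /=; rewrite ?expr0 ?expr1; ring.
Qed.

Hypothesis bnd_gt1 : forall i, (1 < bnd i)%N.

Lemma vec_var (g : nat -> O) k : (0 < k <= m + n)%N -> vec g (var k) = g k.
Proof.
move=> kP; rewrite vecE (bigD1_seq k) ?mem_index_iota ?iota_uniq //=; last first.
rewrite partial_var // eqxx kP scale1r mulf1 big1_seq ?addr0 // => l /andP[lk _].
by rewrite partial_var // (negPf lk) scale0r mulf0.
Qed.

End Count.

Opaque dpsa dp_mul partial_fun coef var hpart sg mon smul partial.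

(* Coefficients are generalized because [ring] compares its atoms up to conversion. *)
Ltac gen_coef := repeat match goal with |- context [coef ?f ?x] => generalize (coef f x) end; intros.

Ltac coef_ring := apply: coefP => ?; rewrite ?mul_lin !coef_lin; first [by gen_coef; ring | ring].

(** * The odd Hamiltonian superalgebra HO *)

Lemma bnd_gt1 (p m n : nat) (t : 'I_m -> nat) : (1 < p)%N -> (forall i, 0 < t i)%N ->
  forall i, (1 < @expo_bound p m n t i)%N.
Proof.
move=> p1 t0 i; rewrite /expo_bound; case: split => // j.
by rewrite -(exp1n (t j)) ltn_exp2r.
Qed.

Lemma prime_H_inv N k : (0 < k <= N + N)%N -> prime_H N (prime_H N k) = k.
Proof. by rewrite /prime_H => H; case: (leqP k N) => kN; case: leqP; lia. Qed.

Lemma prime_H_valid N k : (0 < k <= N + N)%N -> (0 < prime_H N k <= N + N)%N.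
Proof. by rewrite /prime_H => H; case: (leqP k N) => kN; lia. Qed.

Lemma mu_prime_H N k : (0 < k <= N + N)%N -> mu N (prime_H N k) = ~~ mu N k.
Proof. by rewrite /mu /prime_H => H; case: (leqP k N) => kN; lia. Qed.

Section HO.

Variables (F : fieldType) (p N : nat) (t : 'I_N -> nat).
Hypothesis bnd_gt1 : forall i, (1 < @expo_bound p N N t i)%N.
Hypothesis N0 : (0 < N)%N.
Notation O := (dpsa F p N t).
Notation X := (monomial p N t).
Notation mon := (@mon F p N N t).
Notation pf := (@partial_fun F p N N t).
Notation TH := (@T_H F p N N t).
Implicit Types (f g h : O) (k : nat).

Lemma T_HE f : TH f = vec (fun k => pf (prime_H N k) (sg (mu N (prime_H N k)) f)).
Proof.
rewrite /T_H /extend big_bool /vec -!addnn -big_split; apply: eq_bigr => k _ /=.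
rewrite sgE linearD linearZ smulDl smulZ !lfunE /= addrC.
by case: (mu N _); rewrite ?expr0 ?expr1 ?scale1r.
Qed.

Lemma pardeg_T_H e f : hom e f -> pardeg (~~ e) (TH f).
Proof.
move=> hf; rewrite T_HE; apply: pardeg_vec => k kP.
have := hom_partial (prime_H N k) (homZ ((-1) ^+ (mu N (prime_H N k) && e)) hf).
by rewrite -(sg_hom _ hf) mu_prime_H // addNb -addbN.
Qed.

(** The value of the field at the variable with index k' is the k-th derivative of f up to sign. *)
Lemma T_H_eq0 f : TH f = 0 -> forall k, pf k f = 0.
Proof.
move=> f0 k; case: (boolP (0 < k <= N + N)%N) => [kP|/partial_out -> //].
have := vec_var bnd_gt1 (fun l => pf (prime_H N l) (sg (mu N (prime_H N l)) f)) (prime_H_valid kP).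
rewrite -T_HE f0 zero_lfunE prime_H_inv // => /(congr1 (sg (mu N k))).
rewrite linear0 sg_partial sgK => /esym/eqP; rewrite scaler_eq0 signr_eq0 => /eqP //.
Qed.

(** The kernel of [T_H] consists of the constants; since [T_H] is odd, parities are reversed. *)
Lemma Lie_HO_basis : graded_basis (parity_proj F p N t) (Lie_HO F p t)
  [set x : X | expo x != [ffun => 0%N]] (fun x => TH (mon (expo x))) (fun x => ~~ parx (expo x)).
Proof.
split.
- by move=> x _; rewrite /Lie_HO -[TH _](lfunE (@T_H F p N N t)) memv_img // memvf.
- by move=> x _; rewrite (op_partE _ (pardeg_T_H (hom_mon _ _ _ _))) eqxx.
- move=> w w0 x; rewrite inE => x0.
  pose f : O := \sum_(y | expo y != [ffun => 0%N]) w y *: mon (expo y).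
  have f0 : TH f = 0.
    rewrite linear_sum -[RHS]w0; apply: eq_big => [y|y _]; first by rewrite inE.
    by rewrite linearZ.
  have cf : coef f x = w x.
    rewrite coef_sum (bigD1 x) //= coefZ coef_monx eqxx mulr1 big1 ?addr0 // => y /andP[_ yx].
    by rewrite coefZ coef_monx (negPf yx) mulr0.
  have := partial_eq0 bnd_gt1 (T_H_eq0 f0) => /(congr1 (fun g => coef g x)).
  by rewrite cf coefZ coef_mon (negPf x0) mulr0.
apply: (dim_le_family (v := fun x => TH (mon (expo x)))) => u /memv_imgP[f _ ->].
exists (fun x => coef f x); rewrite lfunE /= {1}(mon_expand f) linear_sum /=.
rewrite [RHS]big_mkcond; apply: eq_bigr => x _; rewrite linearZ /= inE.
case: eqP => //= ->; rewrite T_HE (_ : vec _ = 0) ?scaler0 //.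
rewrite /vec big1 // => k _; rewrite sg_mon /parx big1 ?andbF => [|l _]; last by rewrite ffunE.
by rewrite scale1r partial_one smul0l.
Qed.

Lemma Lie_HO_card : let S := [set x : X | expo x != [ffun => 0%N]] in
  (#|[set x in S | ~~ parx (expo x) == true]|.+1 = #|[set x in S | ~~ parx (expo x) == false]|)%N.
Proof.
move=> S; have mi : mu N (rshift N (Ordinal N0)).+1 by rewrite /mu /= addn0.
pose x0 : X := [ffun => Ordinal (ltnW (bnd_gt1 _))].
have ex0 : expo x0 = [ffun => 0%N] by apply/ffunP => i; rewrite !ffunE.
have px0 : parx (expo x0) = false by rewrite ex0 /parx big1 // => i _; rewrite ffunE.
have : #|[set x : X | parx (expo x) == false]| = #|[set x : X | parx (expo x) == true]|.
  exact: (card_flip (P := predT) false mi (fun _ => erefl)).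
rewrite (cardsD1 x0 [set x | parx (expo x) == false]) inE px0 eqxx add1n.
rewrite (_ : _ :\ x0 = [set x in S | ~~ parx (expo x) == true]); last first.
  by apply/setP => x; rewrite !inE -ex0 (inj_eq (@expo_inj _ _ _ _)); case: (parx _).
move=> ->; apply: eq_card => x; rewrite !inE -ex0 (inj_eq (@expo_inj _ _ _ _)).
by case: (x =P x0) => [->|_]; rewrite ?px0 //; case: (parx _).
Qed.

End HO.

(** * Brackets of contact fields *)

Section Superder.

Variables (F : fieldType) (p m n : nat) (t : 'I_m -> nat).
Notation O := (dpsa F p n t).
Notation "f ** g" := (dp_mul f g) (at level 40, left associativity).
Implicit Types (f g h w : O) (D E : 'End(O)) (d e : bool) (k : nat).

Definition superder d D := pardeg d D /\ forall f g, D (f ** g) = D f ** g + sg d f ** D g.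

Lemma sg_sg d e f : sg d (sg e f) = sg (d (+) e) f.
Proof. by apply: coefP => x; rewrite !coef_sg; case: d; case: e; case: mono_par => /=; ring. Qed.

Lemma mul_sg e f g : hom e f -> f ** g = sg e g ** f.
Proof.
have H e' h : hom e f -> hom e' h -> f ** h = sg e h ** f.
  by move=> hf hh; rewrite (mulC hf hh) (sg_hom _ hh) mulZl.
by move=> hf; rewrite (hpartD g) mulDr linearD /= mulDl !(H _ _ hf (hom_hpart _ _)).
Qed.

Lemma superderM d D e f g : superder d D -> hom e f ->
  D (f ** g) = D f ** g + (-1) ^+ (d && e) *: (f ** D g).
Proof. by move=> [_ ->] hf; rewrite (sg_hom _ hf) mulZl. Qed.

Lemma superder_smul d D e f : hom e f -> superder d D -> superder (e (+) d) (smul f D).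
Proof.
move=> hf [hD lD]; split=> [|g h]; first exact: pardeg_smul.
by rewrite !smulE lD mulDr !mulA (mul_sg (sg d g) hf) sg_sg.
Qed.

Lemma superderD d D E : superder d D -> superder d E -> superder d (D + E).
Proof.
move=> [hD lD] [hE lE]; split=> [|g h]; first exact: pardegD.
by rewrite !add_lfunE lD lE mulDl mulDr addrACA.
Qed.

Lemma superderZ d (s : F) D : superder d D -> superder d (s *: D).
Proof.
move=> [hD lD]; split=> [|g h]; first exact: pardegZ.
by rewrite !scale_lfunE lD scalerDr mulZl mulZr.
Qed.

Lemma superder0 d : superder d 0.
Proof. by split=> [|g h]; [exact: pardeg0 | rewrite !zero_lfunE mul0l mulf0 addr0]. Qed.

Lemma superder_sum d I (r : seq I) (P : pred I) (G : I -> 'End(O)) :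
  (forall u, P u -> superder d (G u)) -> superder d (\sum_(u <- r | P u) G u).
Proof. by move=> H; apply: big_ind => //; [apply: superder0 | apply: superderD]. Qed.

End Superder.

Lemma sum_if_eq (I : eqType) (V : nmodType) (r : seq I) i (A : V) : uniq r -> i \in r ->
  \sum_(l <- r) (if l == i then A else 0) = A.
Proof. by move=> ur ir; rewrite (bigD1_seq i) //= eqxx big1 ?addr0 // => l /negPf->. Qed.

(* A contact frame: superderivations Y_j and Z whose only nonzero brackets are
   [Y_i, Y_(pr i)] = om_i Z.  The conditions on c, om and kap make the
   fields contact f closed under brackets.  Both K (z = false) and KO (z = true) are
   of this form. *)
Section Contact.

Variables (F : fieldType) (p m n : nat) (t : 'I_m -> nat).
Notation O := (dpsa F p n t).
Notation "f ** g" := (dp_mul f g) (at level 40, left associativity).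
Implicit Types (f g h w : O) (d e : bool) (i j k l : nat).

Variables (r : seq nat) (pr : nat -> nat) (nu : nat -> bool) (c om : nat -> F) (kap : F) (z : bool).
Variables (Y : nat -> 'End(O)) (Z : 'End(O)).
Hypothesis r_uniq : uniq r.
Hypothesis pr_r : forall j, j \in r -> pr j \in r.
Hypothesis prK : forall j, j \in r -> pr (pr j) = j.
Hypothesis nu_pr : forall j, j \in r -> nu (pr j) = nu j (+) z.
Hypothesis Yder : forall j, j \in r -> superder (nu j) (Y j).
Hypothesis Zder : superder z Z.
Hypothesis YY : forall i j f, i \in r -> j \in r -> Y i (Y j f) =
  (-1) ^+ (nu i && nu j) *: Y j (Y i f) + ((j == pr i)%:R * om i) *: Z f.
Hypothesis ZY : forall i f, i \in r -> Z (Y i f) = (-1) ^+ (z && nu i) *: Y i (Z f).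
Hypothesis ZZ : forall f, z -> Z (Z f) = 0.
Hypothesis c_pr : forall j, j \in r -> c (pr j) = (-1) ^+ (~~ z && ~~ nu j) * c j.
Hypothesis c_om : forall i, i \in r -> c i * (-1) ^+ nu i * om i = - kap.
Hypothesis c_om' : forall i, i \in r -> c i * (-1) ^+ (nu i && z) * om (pr i) = kap.

(** Here [e] stands for the parity of [f]. For K one has kap = 2 and c = sigma, for KO kap = -2 and
    c = 1. *)
Definition contact e f : 'End(O) :=
  kap *: smul f Z + \sum_(j <- r) (c j * (-1) ^+ (nu j && e)) *: smul (Y j f) (Y (pr j)).

Lemma contactE e f w : contact e f w =
  kap *: (f ** Z w) + \sum_(j <- r) (c j * (-1) ^+ (nu j && e)) *: (Y j f ** Y (pr j) w).
Proof.
rewrite add_lfunE scale_lfunE smulE sum_lfunE; congr (_ + _); apply: eq_bigr => j _.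
by rewrite scale_lfunE smulE.
Qed.

Lemma hom_Y e j f : j \in r -> hom e f -> hom (e (+) nu j) (Y j f).
Proof. by move=> jr; apply: (Yder jr).1. Qed.

Lemma hom_Z e f : hom e f -> hom (e (+) z) (Z f).
Proof. by apply: Zder.1. Qed.

Lemma contact_der e f : hom e f -> superder (e (+) z) (contact e f).
Proof.
move=> hf; apply: superderD; first exact/superderZ/superder_smul.
rewrite big_seq; apply: superder_sum => j jr; apply/superderZ.
have := superder_smul (hom_Y jr hf) (Yder (pr_r jr)); rewrite nu_pr //.
by rewrite -addbA [nu j (+) _]addKb.
Qed.

(** The bracket of Y_i with a contact field has no Z component: kap (Y_i f) Z cancels against the
    term l = i, where [Y_i, Y_(pr i)] = om_i Z, by [c_om]. So contact fields preserve the
    distribution spanned by the Y_j. *)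
Lemma Y_contact i e f w : i \in r -> hom e f ->
  Y i (contact e f w) = (-1) ^+ (nu i && (e (+) z)) *: contact e f (Y i w)
   + \sum_(l <- r) (c l * (-1) ^+ (nu l && e)) *: (Y i (Y l f) ** Y (pr l) w).
Proof.
move=> ir hf; rewrite !contactE linearD linearZ /= (superderM _ (Yder ir) hf).
have YZ : Y i (Z w) = (-1) ^+ (z && nu i) *: Z (Y i w).
  by rewrite ZY // scalerA -signr_addb addbb scale1r.
rewrite YZ linear_sum /=.
have E l : l \in r -> Y i ((c l * (-1) ^+ (nu l && e)) *: (Y l f ** Y (pr l) w)) =
   (c l * (-1) ^+ (nu l && e)) *: (Y i (Y l f) ** Y (pr l) w) +
   ((-1) ^+ (nu i && (e (+) z)) * (c l * (-1) ^+ (nu l && e))) *: (Y l f ** Y (pr l) (Y i w))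
   + (if l == i then - kap *: (Y i f ** Z w) else 0).
  move=> lr; rewrite linearZ /= (superderM _ (Yder ir) (hom_Y lr hf)) (YY w ir (pr_r lr)) !mul_lin.
  have -> : (pr l == pr i) = (l == i).
    by apply/eqP/eqP => [H|->//]; rewrite -(prK lr) H prK.
  rewrite nu_pr // !scalerDr !scalerA -addrA; congr (_ + (_ + _)).
    by congr (_ *: _); case: (nu i); case: (nu l); case: e {hf}; case: z; rewrite /= ?expr0 ?expr1; ring.
  case: eqP => [->|_]; last by rewrite mul0r mulr0 scale0r.
  congr (_ *: _); rewrite -(c_om ir); case: (nu i); case: e {hf}; rewrite /= ?expr0 ?expr1; ring.
rewrite (eq_big_seq _ E) !big_split /= sum_if_eq //.
rewrite !scalerDr !scalerA scaler_sumr.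
under [X in _ = _ + X + _]eq_bigr do rewrite scalerA.
rewrite !mul_lin; move: (\sum_(_ <- _) _) (\sum_(_ <- _) _) => A1 A2.
apply: coefP => x; rewrite !coef_lin; gen_coef.
by case: (nu i); case: (e); case: z; rewrite /= ?expr0 ?expr1; ring.
Qed.

Lemma Z_contact e f w : hom e f ->
  Z (contact e f w) = (-1) ^+ (z && (e (+) z)) *: contact e f (Z w) + contact (e (+) z) (Z f) w.
Proof.
move=> hf; rewrite !contactE linearD linearZ /= (superderM _ Zder hf) linear_sum /=.
have E l : l \in r -> Z ((c l * (-1) ^+ (nu l && e)) *: (Y l f ** Y (pr l) w)) =
   (c l * (-1) ^+ (nu l && (e (+) z))) *: (Y l (Z f) ** Y (pr l) w) +
   ((-1) ^+ (z && (e (+) z)) * (c l * (-1) ^+ (nu l && e))) *: (Y l f ** Y (pr l) (Z w)).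
  move=> lr; rewrite linearZ /= (superderM _ Zder (hom_Y lr hf)) ZY // ZY ?pr_r // nu_pr //.
  rewrite !mul_lin !scalerDr !scalerA; congr (_ *: _ + _ *: _);
  by case: (nu l); case: (e); case: z; rewrite /= ?expr0 ?expr1; ring.
rewrite (eq_big_seq _ E) big_split /= !scalerDr !scalerA [X in _ = _ + X + _]scaler_sumr.
under [X in _ = _ + X + _]eq_bigr do rewrite scalerA.
move: (\sum_(_ <- _) _) (\sum_(_ <- _) _) => A1 A2.
apply: coefP => x; rewrite !coef_lin.
(* For odd Z the two terms in f Z(Z w) carry opposite signs and agree only because Z^2 = 0; for even
   Z the signs are equal. *)
have : z -> coef (f ** Z (Z w)) x = 0 by move=> zT; rewrite ZZ // mulf0 dcoef0.
by case: z => [-> //|_]; case: (e); rewrite /= ?expr0 ?expr1; ring.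
Qed.

Lemma big_pr (V : nmodType) (G : nat -> V) : \sum_(j <- r) G j = \sum_(j <- r) G (pr j).
Proof.
rewrite -(big_map pr predT); apply: perm_big; apply: uniq_perm => //.
  rewrite map_inj_in_uniq // => i j ir jr E; by rewrite -(prK ir) E prK.
move=> j; apply/idP/mapP => [jr|[i ir ->]]; last exact: pr_r.
by exists (pr j); rewrite ?prK ?pr_r.
Qed.

Opaque contact.

(** The contact (Lagrange) bracket of functions: the generating function of the bracket of two
    contact fields. *)
Definition cbracket e f g := contact e f g - ((-1) ^+ (z && (e (+) z)) * kap) *: (Z f ** g).

(** The field of f is moved through that of g by the Leibniz rule, its commutators with Z and Y_j
    being known ([DZ], [DY]). What remains is first order in w, and the coefficients of Z w and of
    Y_(pr l) w are compared with those of the field of [cbracket e f g]. *)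
Lemma contact_bracket e e' f g w : hom e f -> hom e' g ->
  contact e f (contact e' g w) - (-1) ^+ ((e (+) z) && (e' (+) z)) *: contact e' g (contact e f w)
  = contact (e (+) e' (+) z) (cbracket e f g) w.
Proof.
move=> hf hg; set d := e (+) z; have Dder := contact_der hf.
pose R i u := \sum_(l <- r) (c l * (-1) ^+ (nu l && e)) *: (Y i (Y l f) ** Y (pr l) u).
have DZ u : contact e f (Z u) = (-1) ^+ (z && d) *: (Z (contact e f u) - contact d (Z f) u).
  by rewrite Z_contact // addrK scalerA -signr_addb addbb scale1r.
have DY i u : i \in r ->
    contact e f (Y i u) = (-1) ^+ (nu i && d) *: (Y i (contact e f u) - R i u).
  by move=> ir; rewrite Y_contact // addrK scalerA -signr_addb addbb scale1r.
have -> : contact e f (contact e' g w) =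
   (-1) ^+ (d && (e' (+) z)) *: contact e' g (contact e f w)
   + (kap *: (contact e f g ** Z w) - (kap * (-1) ^+ (d && (e' (+) z))) *: (g ** contact d (Z f) w)
   + (\sum_(j <- r) (c j * (-1) ^+ (nu j && e')) *: (contact e f (Y j g) ** Y (pr j) w)
   - \sum_(j <- r) (c j * (-1) ^+ ((nu j && e') (+) (d && e') (+) (d && z))) *: (Y j g ** R (pr j) w))).
  rewrite [in LHS](contactE e') linearD linearZ /= (superderM _ Dder hg) DZ linear_sum /=.
  have E j : j \in r -> contact e f ((c j * (-1) ^+ (nu j && e')) *: (Y j g ** Y (pr j) w)) =
     (c j * (-1) ^+ (nu j && e')) *: (contact e f (Y j g) ** Y (pr j) w)
     + ((-1) ^+ (d && (e' (+) z)) * (c j * (-1) ^+ (nu j && e'))) *: (Y j g ** Y (pr j) (contact e f w))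
     - (c j * (-1) ^+ ((nu j && e') (+) (d && e') (+) (d && z))) *: (Y j g ** R (pr j) w).
    move=> jr; rewrite linearZ /= (superderM _ Dder (hom_Y jr hg)) (DY _ w (pr_r jr)) nu_pr // -/d.
    rewrite !mul_lin; apply: coefP => x; rewrite !coef_lin; gen_coef.
    by case: (nu j); case: (d); case: (e'); case: z; rewrite /= ?expr0 ?expr1; ring.
  rewrite (eq_big_seq _ E) !big_split /= [in RHS](contactE e').
  rewrite [X in _ = X + _]scalerDr scaler_sumr.
  under [X in _ = _ + X + _]eq_bigr do rewrite scalerA.
  rewrite sumrN -/d !mul_lin; move: (\sum_(_ <- _) _) (\sum_(_ <- _) _) (\sum_(_ <- _) _) => A1 A2 A3.
  apply: coefP => x; rewrite !coef_lin; gen_coef.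
  by case: (d); case: (e'); case: z; rewrite /= ?expr0 ?expr1; ring.
rewrite [LHS]addrC addKr [contact d (Z f) w]contactE [RHS]contactE.
(* The sum over j is reflected by [pr] and Y_j Y_l f is reordered, which turns it into [R l g]; the
   bracket [Y_j, Y_l] contributes only at j = pr l, namely the term in Z f. *)
have Q l : l \in r -> \sum_(j <- r) (c j * (-1) ^+ ((nu j && e') (+) (d && e') (+) (d && z))
      * (c l * (-1) ^+ (nu l && e))) *: (Y j g ** Y (pr j) (Y l f)) =
    - (c l * (-1) ^+ (nu l && (d (+) e'))) *:
      (R l g - ((-1) ^+ ((d && z) (+) (nu l && d)) * kap) *: (Z f ** Y l g)).
  move=> lr; rewrite big_pr.
  have E j : j \in r -> (c (pr j) * (-1) ^+ ((nu (pr j) && e') (+) (d && e') (+) (d && z))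
      * (c l * (-1) ^+ (nu l && e))) *: (Y (pr j) g ** Y (pr (pr j)) (Y l f)) =
     - (c l * (-1) ^+ (nu l && (d (+) e'))) *:
        ((c j * (-1) ^+ (nu j && e)) *: (Y l (Y j f) ** Y (pr j) g)
        - if j == pr l then ((-1) ^+ ((d && z) (+) (nu l && d)) * kap) *: (Z f ** Y l g) else 0).
    move=> jr; rewrite prK // YY // mulDr !mulZr.
    have -> : (l == pr j) = (j == pr l) by apply/eqP/eqP => ->; rewrite prK.
    rewrite (mulC (hom_Y (pr_r jr) hg) (hom_Y lr (hom_Y jr hf))).
    rewrite (mulC (hom_Y (pr_r jr) hg) (hom_Z hf)) nu_pr // c_pr //.
    rewrite !scalerDr !scalerA scalerN; congr (_ + _).
      congr (_ *: _); case: (nu l); case: (nu j); rewrite /d; case: (e); case: (e'); case: z;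
      by rewrite /= ?expr0 ?expr1; ring.
    case: eqP => [->|_]; last by rewrite mul0r mulr0 mul0r scale0r scaler0 oppr0.
    rewrite prK // ?(scalerN, scaleNr, opprK) !scalerA; congr (_ *: _).
    rewrite -(c_om' lr) nu_pr // (c_pr lr).
    case: (nu l); rewrite /d; case: (e); case: (e'); case: z;
      by rewrite /= ?expr0 ?expr1; ring.
  rewrite (eq_big_seq _ E) -scaler_sumr; congr (_ *: _).
  by rewrite big_split /= sumrN sum_if_eq ?pr_r.
have -> : \sum_(j <- r) (c j * (-1) ^+ ((nu j && e') (+) (d && e') (+) (d && z))) *: (Y j g ** R (pr j) w)
   = \sum_(l <- r) (- (c l * (-1) ^+ (nu l && (d (+) e'))) *:
      ((R l g - ((-1) ^+ ((d && z) (+) (nu l && d)) * kap) *: (Z f ** Y l g)) ** Y (pr l) w)).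
  rewrite [RHS]big_seq; under [RHS]eq_bigr => l lr do rewrite -mulZl -Q // mul_suml.
  rewrite -big_seq exchange_big /=; apply: eq_bigr => j _; rewrite /R mul_sumr scaler_sumr.
  by apply: eq_bigr => l _; rewrite !mul_lin scalerA mulA.
have E l : l \in r -> (c l * (-1) ^+ (nu l && (e (+) e' (+) z))) *: (Y l (cbracket e f g) ** Y (pr l) w) =
  (c l * (-1) ^+ (nu l && e')) *: (contact e f (Y l g) ** Y (pr l) w)
  + ((c l * (-1) ^+ (nu l && (d (+) e'))) *:
      ((R l g - ((-1) ^+ ((d && z) (+) (nu l && d)) * kap) *: (Z f ** Y l g)) ** Y (pr l) w))
  - (kap * (-1) ^+ (d && (e' (+) z)) * (c l * (-1) ^+ (nu l && d))) *: (g ** (Y l (Z f) ** Y (pr l) w)).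
  move=> lr; rewrite /cbracket linearB linearZ /= Y_contact // -/(R l g) (superderM _ (Yder lr) (hom_Z hf)).
  rewrite [in RHS]mulA (mulC hg (hom_Y lr (hom_Z hf))) !mul_lin.
  apply: coefP => x; rewrite !coef_lin; gen_coef.
  by case: (nu l); rewrite /d; case: (e); case: (e'); case: z; rewrite /= ?expr0 ?expr1; ring.
rewrite (eq_big_seq _ E) !big_split /= sumrN.
have -> : \sum_(l <- r) (kap * (-1) ^+ (d && (e' (+) z)) * (c l * (-1) ^+ (nu l && d))) *:
     (g ** (Y l (Z f) ** Y (pr l) w)) = (kap * (-1) ^+ (d && (e' (+) z))) *:
     (g ** \sum_(l <- r) (c l * (-1) ^+ (nu l && d)) *: (Y l (Z f) ** Y (pr l) w)).
  by rewrite mul_sumr scaler_sumr; apply: eq_bigr => l _; rewrite mulZr scalerA.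
under [X in _ + (_ - X) = _]eq_bigr do rewrite scaleNr.
rewrite sumrN opprK mulDr mulZr !mulA (mulC hg (hom_Z hf)) /cbracket !mul_lin.
move: (\sum_(_ <- _) _) (\sum_(_ <- _) _) (\sum_(_ <- _) _) => A1 A2 A3.
apply: coefP => x; rewrite !coef_lin; gen_coef.
by rewrite /d; case: (e); case: (e'); case: z; rewrite /= ?expr0 ?expr1; ring.
Qed.

End Contact.

(** * The contact superalgebra K *)

Section Derived.

Variables (F : fieldType) (p m n : nat) (t : 'I_m -> nat).
Notation O := (dpsa F p n t).
Notation pr := (parity_proj F p n t).
Implicit Types (f g : O).

Lemma bracketDl (D D' E : 'End(O)) : bracket pr (D + D') E = bracket pr D E + bracket pr D' E.
Proof. by have := bracket_linearl pr E 1 D D'; rewrite !scale1r. Qed.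

Lemma derived_sub (T : 'Hom(O, 'End(O))) (U : {vspace O}) (W : {vspace 'End(O)}) :
  (forall e f, f \in U -> hpart e f \in U) ->
  (forall e e' f g, hom e f -> hom e' g -> f \in U -> g \in U -> bracket pr (T f) (T g) \in W) ->
  (derived pr (T @: U) <= W)%VS.
Proof.
move=> gU H; apply/span_subvP => _ /allpairsP[[D E] /= [/vbasis_mem/memv_imgP[f fU ->] /vbasis_mem/memv_imgP[g gU' ->] ->]].
rewrite (hpartD f) (hpartD g) !linearD /= !bracketDl ?linearD /=.
by rewrite ?linearD /= !rpredD //; apply: H; rewrite ?gU //; apply: hom_hpart.
Qed.

End Derived.

Section K.

Variables (F : fieldType) (p m n : nat) (t : 'I_m -> nat).
Hypothesis charFp : p \in [pchar F].
Hypothesis two : (2 : F) != 0.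
Hypothesis bnd_gt1 : forall i, (1 < @expo_bound p m n t i)%N.
Hypothesis modd : odd m.
Notation O := (dpsa F p n t).
Notation X := (monomial p n t).
Notation mon := (@mon F p m n t).
Notation pf := (@partial_fun F p m n t).
Notation var := (var F p n t).
Notation one := (one F p n t).
Notation DK := (@D_K F p m n t).
Notation "f ** g" := (dp_mul f g) (at level 40, left associativity).
Notation sigma := (sigma_K F m).
Notation pr := (prime_K m).
Implicit Types (f g h w : O) (d e : bool) (i j k l : nat).

Definition rK := [seq k <- index_iota 1 (m + n).+1 | k != m].

Lemma mem_rK k : (k \in rK) = (0 < k <= m + n)%N && (k != m).
Proof. by rewrite mem_filter mem_index_iota ltnS andbC. Qed.

Lemma m_half : m = (m./2).*2.+1.
Proof. by rewrite -[LHS]odd_double_half modd. Qed.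

Lemma pr_rK j : j \in rK -> pr j \in rK.
Proof. rewrite !mem_rK /prime_K; have := m_half; case: (leqP j m./2); [|case: (leqP j (m./2).*2)]; lia. Qed.

Lemma prK_K j : j \in rK -> pr (pr j) = j.
Proof.
rewrite !mem_rK /prime_K; have := m_half => E H.
case: (leqP j m./2) => h1.
  by case: leqP => h2; [|case: leqP => h3]; lia.
by case: (leqP j (m./2).*2) => h2; case: leqP => h3; rewrite ?(leqNgt j) ?h1 ?h2 /=; lia.
Qed.

Lemma mu_pr_K j : j \in rK -> mu m (pr j) = mu m j.
Proof. rewrite mem_rK /prime_K /mu; have := m_half; case: (leqP j m./2); [|case: (leqP j (m./2).*2)]; lia. Qed.

Lemma sigma_pr j : j \in rK -> sigma (pr j) = (-1) ^+ (~~ mu m j) * sigma j.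
Proof.
rewrite mem_rK /prime_K /sigma_K /mu => H; have := m_half => E.
case: (leqP j m./2) => h1.
  by rewrite (_ : (m < j)%N = false) /= ?ifT ?ifF; try lia; ring.
case: (leqP j (m./2).*2) => h2 /=.
  by rewrite (_ : (m < j)%N = false) /= ?ifF; try lia; ring.
by rewrite (_ : (m < j)%N = true) /= ?ifF; try lia; ring.
Qed.

Lemma sigma2 j : sigma j * sigma j = 1.
Proof. by rewrite /sigma_K; case: ifP => _; ring. Qed.

Lemma sigma_neq0 j : sigma j != 0.
Proof. by apply/eqP => s0; have := sigma2 j; rewrite s0 mul0r => /eqP; rewrite eq_sym oner_eq0. Qed.

(** For j other than m the coefficient f_j of [D_K] f is [YK j f] up to sign, which is what puts
    [D_K] into the form of [contact]. The brackets are [Y_i, Y_(i')] = 2 sigma(i') d_m. *)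
Definition YK j : 'End(O) := smul (var j) (partial F p n t m) + sigma (pr j) *: partial F p n t (pr j).

Lemma YKE j f : YK j f = var j ** pf m f + sigma (pr j) *: pf (pr j) f.
Proof. by rewrite add_lfunE smulE scale_lfunE !partialE. Qed.

Lemma YK_def j : YK j = smul (var j) (partial F p n t m) + sigma (pr j) *: partial F p n t (pr j).
Proof. by []. Qed.

Opaque YK.

Lemma partial_der k : superder (mu m k) (partial F p n t k).
Proof. by split=> [|f g]; [exact: pardeg_partial | rewrite !partialE leibniz]. Qed.

Lemma mum : mu m m = false. Proof. by rewrite /mu ltnn. Qed.

Lemma YK_der j : j \in rK -> superder (mu m j) (YK j).
Proof.
move=> jr; apply: superderD.
  have := superder_smul (hom_var F p n t j) (partial_der m); by rewrite mum addbF.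
by apply: superderZ; rewrite -(mu_pr_K jr); apply: partial_der.
Qed.

Lemma partial_mulvar k l f : pf k (var l ** f) =
  ((k == l) && (0 < k <= m + n)%N)%:R *: f + (-1) ^+ (mu m k && mu m l) *: (var l ** pf k f).
Proof.
by rewrite leibniz // partial_var // mulZl mul1f (sg_hom _ (hom_var _ _ _ _ l)) mulZl.
Qed.

Lemma m_valid : (0 < m <= m + n)%N.
Proof. by have := m_half; lia. Qed.

Lemma YK_YK i j f : i \in rK -> j \in rK -> YK i (YK j f) =
  (-1) ^+ (mu m i && mu m j) *: YK j (YK i f) + ((j == pr i)%:R * (2 * sigma (pr i))) *: partial F p n t m f.
Proof.
move=> ir jr; have [ir' jr'] := (pr_rK ir, pr_rK jr).
have := mem_rK i; have := mem_rK j; have := mem_rK (pr i); have := mem_rK (pr j).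
rewrite ir jr ir' jr' => /esym/andP[vj' nj'] /esym/andP[vi' ni'] /esym/andP[vj nj] /esym/andP[vi ni].
rewrite partialE !YKE !linearD !linearZ /= !partial_mulvar !mum.
rewrite !(eq_sym m) (negPf ni) (negPf nj) vi' vj' !andbT /= !mu_pr_K // !scale0r !add0r.
rewrite !(partialC (pr i)) !(partialC (pr j) m) !mu_pr_K // mum /= expr0 !scale1r andbF.
have -> : (pr j == i) = (j == pr i) by apply/eqP/eqP => [<-|->]; rewrite prK_K.
rewrite (eq_sym (pr i)) !mul_lin mulA (mulC (hom_var F p n t i) (hom_var F p n t j)) !mul_lin -!mulA.
rewrite (partialC m (pr j)) mum /= expr0 scale1r.
apply: coefP => x; rewrite !coef_lin; gen_coef.
case: eqP => [->|_] /=; last by case: (mu m i); case: (mu m j); rewrite /= ?expr0 ?expr1; ring.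
rewrite prK_K // mu_pr_K // (sigma_pr ir).
by case: (mu m i); rewrite /= ?expr0 ?expr1; ring.
Qed.

Lemma rK_uniq : uniq rK.
Proof. by rewrite filter_uniq // iota_uniq. Qed.

Lemma smul_smul f g D : smul f (smul g D) = smul (f ** g) D :> 'End(O).
Proof. by apply/lfunP => h; rewrite !smulE mulA. Qed.

Lemma smul_sum I (r : seq I) (G : I -> O) D : smul (\sum_(u <- r) G u) D = \sum_(u <- r) smul (G u) D :> 'End(O).
Proof. by apply: (big_morph (fun f => smul f D)) => [f g|]; rewrite ?smulDl ?smul0l. Qed.

(** The terms x_(j') x_j d_m f for j and j' are opposite and cancel, which uses 2 != 0 when j = j';
    the remaining Euler sum turns 2 f into the coefficient f_m. *)
Lemma euler_K e f : hom e f ->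
  \sum_(j <- rK) (sigma j * (-1) ^+ (mu m j && e)) *: (YK j f ** var (pr j))
  = - \sum_(j <- rK) var j ** pf j f.
Proof.
move=> hf.
pose G j := (sigma j * (-1) ^+ mu m j) *: ((var (pr j) ** var j) ** pf m f).
have E j : j \in rK -> (sigma j * (-1) ^+ (mu m j && e)) *: (YK j f ** var (pr j)) =
    G j - var (pr j) ** pf (pr j) f.
  move=> jr; rewrite (mulC ((YK_der jr).1 _ _ hf) (hom_var F p n t (pr j))) YKE mu_pr_K // /G -mulA.
  rewrite !mul_lin sigma_pr //; apply: coefP => x; rewrite !coef_lin; gen_coef.
  by case: (mu m j); case: (e); rewrite /= ?expr0 ?expr1; have := sigma2 j => S2; ring: S2.
rewrite (eq_big_seq _ E) big_split sumrN /= -(big_pr rK_uniq pr_rK prK_K (fun j => var j ** pf j f)).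
suff -> : \sum_(j <- rK) G j = 0 by rewrite add0r.
have GG : \sum_(j <- rK) G j = - \sum_(j <- rK) G j.
  rewrite {1}(big_pr rK_uniq pr_rK prK_K G) -sumrN; apply: eq_big_seq => j jr.
  rewrite /G prK_K // mu_pr_K // sigma_pr // (mulC (hom_var F p n t j) (hom_var F p n t (pr j))) mu_pr_K //.
  rewrite !mul_lin; apply: coefP => x; rewrite !coef_lin; gen_coef.
  by case: (mu m j); rewrite /= ?expr0 ?expr1; ring.
apply/eqP; have : 2 *: \sum_(j <- rK) G j == 0 by rewrite scaler_nat mulr2n {1}GG addNr.
by rewrite scaler_eq0 (negPf two).
Qed.

Lemma D_K_contact e f : hom e f ->
  DK f = contact rK pr (mu m) sigma 2 YK (partial F p n t m) e f.
Proof.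
move=> hf; rewrite /D_K (extendE _ hf); last first.
  move=> e' x g h; rewrite scaler_sumr -big_split /=.
  by apply: eq_bigr => i _; rewrite coef_K_linear smul_linear.
rewrite (bigD1_seq m) ?mem_index_iota ?iota_uniq ?ltnS ?m_valid //=; last first.
rewrite -big_filter -/rK /contact.
have E j : j \in rK -> (sigma j * (-1) ^+ (mu m j && e)) *: smul (YK j f) (YK (pr j)) =
   smul ((sigma j * (-1) ^+ (mu m j && e)) *: (YK j f ** var (pr j))) (partial F p n t m)
   + smul (coef_K e f j) (partial F p n t j).
  move=> jr; have := jr; rewrite mem_rK => /andP[vj /negPf nj].
  rewrite /coef_K nj (YK_def (pr j)) prK_K // smulDr scalerDr smul_smul smulZ; congr (_ + _).
  rewrite smulZr !scalerA smulZ; congr (_ *: _); last by congr smul; rewrite YKE !partialE.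
  have := sigma2 j; case: (mu m j); case: (e); rewrite /= ?expr0 ?expr1 => S2; ring: S2.
rewrite (eq_big_seq _ E) big_split /= -smul_sum (euler_K hf) addrA -smulZ -smulDl; congr (smul _ _ + _).
rewrite /coef_K eqxx; congr (_ - _); rewrite -[LHS]big_filter; apply: eq_bigr => j _.
by rewrite partialE.
Qed.

Let Dc := contact rK pr (mu m) sigma 2 YK (partial F p n t m).
Let h1 j : j \in rK -> mu m (pr j) = mu m j (+) false.
Proof. by move=> jr; rewrite mu_pr_K // addbF. Qed.
Let h2 : superder false (partial F p n t m).
Proof. by have := partial_der m; rewrite mum. Qed.
Let h3 i f : i \in rK -> partial F p n t m (YK i f) = (-1) ^+ (false && mu m i) *: YK i (partial F p n t m f).
Proof.
rewrite mem_rK => /andP[vi /negPf ni]; rewrite expr0 scale1r !partialE !YKE linearD linearZ /= partial_mulvar.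
by rewrite eq_sym ni mum scale0r add0r expr0 scale1r (partialC m (pr i)) mum expr0 scale1r.
Qed.
Let h4 f : false -> partial F p n t m (partial F p n t m f) = 0. Proof. by []. Qed.
Let h5 j : j \in rK -> sigma (pr j) = (-1) ^+ (~~ false && ~~ mu m j) * sigma j.
Proof. exact: sigma_pr. Qed.
Let h6 i : i \in rK -> sigma i * (-1) ^+ mu m i * (2 * sigma (pr i)) = - 2.
Proof.
move=> ir; rewrite sigma_pr //; have := sigma2 i; case: (mu m i) => /= S2;
by rewrite ?expr0 ?expr1; ring: S2.
Qed.
Let h7 i : i \in rK -> sigma i * (-1) ^+ (mu m i && false) * (2 * sigma (pr (pr i))) = 2.
Proof. by move=> ir; rewrite prK_K // andbF; have S2 := sigma2 i; ring: S2. Qed.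

Opaque D_K.

Lemma pardeg_D_K e f : hom e f -> pardeg e (DK f).
Proof.
move=> hf; rewrite (D_K_contact hf); rewrite -[X in pardeg X]addbF.
exact: (contact_der sigma 2 pr_rK h1 YK_der h2 hf).1.
Qed.

Lemma D_K_bracket e e' f g : hom e f -> hom e' g ->
  bracket (parity_proj F p n t) (DK f) (DK g) = DK (DK f g - 2 *: (pf m f ** g)).
Proof.
move=> hf hg; rewrite (bracketE (pardeg_D_K hf) (pardeg_D_K hg)).
have hh : hom (e (+) e') (DK f g - 2 *: (pf m f ** g)).
  rewrite addbC; apply: homD; first exact: (pardeg_D_K hf).
  apply/homN/homZ; rewrite addbC -[e]addbF -mum; apply: homM hg; exact: hom_partial.
rewrite (D_K_contact hh); apply/lfunP => w.
have := contact_bracket rK_uniq pr_rK prK_K h1 YK_der h2 YK_YK h3 h4 h5 h6 h7 w hf hg.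
rewrite /cbracket !addbF expr0 mul1r partialE -!(D_K_contact hf) -(D_K_contact hg) => <-.
by rewrite !(add_lfunE, opp_lfunE, scale_lfunE, comp_lfunE).
Qed.

Lemma op_part_D_K e f : op_part (parity_proj F p n t) e (DK f) = DK (hpart e f).
Proof.
have -> : DK f = DK (hpart false f) + DK (hpart true f) by rewrite -linearD -hpartD.
rewrite op_partD; apply: etrans (congr2 +%R (op_partE e (pardeg_D_K (hom_hpart false f))) (op_partE e (pardeg_D_K (hom_hpart true f)))) _.
by case: e; rewrite /= ?addr0 ?add0r.
Qed.

(** For homogeneous g, the values of the field at the variables other than x_m show that every Y_k g
    vanishes; its value at x_m is then 2 g. *)
Lemma D_K_inj f : DK f = 0 -> f = 0.
Proof.
have H e g : hom e g -> DK g = 0 -> g = 0.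
  move=> hg; rewrite (D_K_contact hg) => g0.
  have YV j k : j \in rK -> k \in rK -> YK (pr j) (var k) = (k == j)%:R *: (sigma j *: one).
    rewrite !mem_rK => /andP[vj nj] /andP[vk nk].
    rewrite YKE !partial_var // prK_K ?mem_rK ?vj // (eq_sym m) (negPf nk) scale0r mulf0 add0r.
    by rewrite ?vj andbT eq_sym scalerA mulrC -scalerA.
  have Y0 k : k \in rK -> YK k g = 0.
    move=> kr; have := congr1 (fun D : 'End(O) => D (var k)) g0.
    rewrite /= zero_lfunE contactE partialE partial_var //.
    have := kr; rewrite mem_rK => /andP[vk /negPf nk].
    rewrite eq_sym nk scale0r mulf0 scaler0 add0r.
    rewrite (bigD1_seq k) ?rK_uniq //= YV // eqxx scale1r mulZr mulf1 scalerA.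
    rewrite big1_seq ?addr0 => [|j /andP[jk jr]]; last first.
      by rewrite YV // eq_sym (negPf jk) scale0r mulf0 scaler0.
    move/eqP; rewrite scaler_eq0 => /orP[|/eqP //].
    rewrite mulrAC sigma2 mul1r signr_eq0 //.
  have := congr1 (fun D : 'End(O) => D (var m)) g0.
  rewrite /= zero_lfunE contactE partialE partial_var // eqxx m_valid scale1r mulf1.
  rewrite big1_seq ?addr0 => [|j /andP[_ jr]]; last by rewrite Y0 // mul0l scaler0.
  by move/eqP; rewrite scaler_eq0 (negPf two) => /eqP.
move=> f0; have h0 e : hpart e f = 0.
  by apply: H (hom_hpart e f) _; rewrite -op_part_D_K f0 linear0.
by rewrite (hpartD f) !h0 addr0.
Qed.

Definition topm : {ffun 'I_(m + n) -> nat} := [ffun i => (@expo_bound p m n t i).-1].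

Lemma mon_partial (x : X) : expo x != topm -> exists k g, mon (expo x) = pf k g.
Proof.
move=> nt; have [i xi] : exists i : 'I_(m + n), ((expo x i).+1 < @expo_bound p m n t i)%N.
  apply/existsP; apply: contraNT nt; rewrite negb_exists => /forallP H.
  apply/eqP/ffunP => i; rewrite [RHS]ffunE; move/forallP: (expo_bounded x) (H i) => /(_ i).
  by rewrite -leqNgt; move: (expo x i) (expo_bound _ _ _) => u v; lia.
exists i.+1, ((-1) ^+ sgnk i.+1 (up i (expo x)) *: mon (up i (expo x))).
rewrite linearZ /= partial_mon upK scalerA (_ : up i (expo x) i = (expo x i).+1); last first.
  by rewrite ffunE eqxx addn1.
by rewrite /= (ltn_eqF xi) mul1r -exprD addnn -mul2n exprM sqrrN !expr1n scale1r.
Qed.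

Lemma Lie_K_bracket e e' f g : hom e f -> hom e' g -> DK (DK f g - 2 *: (pf m f ** g)) \in Lie_K F p n t.
Proof.
have mem h : DK h \in limg (linfun DK) by rewrite -[DK h](lfunE (@D_K F p m n t)); apply/memv_img/memvf.
by move=> hf hg; rewrite -(D_K_bracket hf hg); apply: mem_derived.
Qed.

Lemma derived_K : (Lie_K F p n t <= limg (linfun DK))%VS.
Proof.
apply: derived_sub => [e f _|e e' f g hf hg _ _]; first exact: memvf.
rewrite !lfunE /= (D_K_bracket hf hg) -[DK (_ - _)](lfunE (@D_K F p m n t)); exact/memv_img/memvf.
Qed.

Opaque Lie_K.

(** [D_K] 1 = 2 d_m, and its bracket with [D_K] h is [D_K] (2 d_m h). *)
Lemma Lie_K_partial_m f : DK (pf m f) \in Lie_K F p n t.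
Proof.
suff H e h : hom e h -> DK (pf m h) \in Lie_K F p n t.
  by rewrite (hpartD f) linearD linearD /=; apply: rpredD; apply: H (hom_hpart _ f).
move=> hh; have := memvZ 2^-1 (Lie_K_bracket (hom_one F p n t) hh).
rewrite partial_one mul0l scaler0 subr0 (D_K_contact (hom_one F p n t)) contactE.
rewrite big1_seq => [|j _]; last by rewrite YKE !partial_one mulf0 scaler0 addr0 mul0l scaler0.
by rewrite mul1f addr0 partialE [DK (_ *: _)]linearZ /= scalerA (mulVf two) scale1r.
Qed.

(** The bracket of [D_K] x_(k') with [D_K] h is [D_K] of a combination of d_k h and x_(k') d_m h.
    The latter equals d_m (x_(k') h) and is covered by [Lie_K_partial_m], and d_k h has a nonzero
    coefficient. *)
Lemma Lie_K_partial k f : (0 < k <= m + n)%N -> DK (pf k f) \in Lie_K F p n t.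
Proof.
case: (eqVneq k m) => [-> _|nk vk]; first exact: Lie_K_partial_m.
have kr : k \in rK by rewrite mem_rK vk.
have ir := pr_rK kr; pose i := pr k; have := ir; rewrite mem_rK => /andP[vi /negPf ni].
have YV j : j \in rK -> YK j (var i) = ((j == k)%:R * sigma (pr j)) *: one.
  move=> jr; have := pr_rK jr; rewrite mem_rK => /andP[vj _].
  rewrite YKE !(partial_var F bnd_gt1) (eq_sym m) ni scale0r mulf0 add0r vj andbT scalerA mulrC.
  have -> // : (pr j == i) = (j == k).
  by rewrite /i; apply/eqP/eqP => [E|->//]; rewrite -(prK_K jr) E prK_K.
have pm h : var i ** pf m h = pf m (var i ** h).
  by rewrite partial_mulvar (eq_sym m) ni scale0r add0r mum expr0 scale1r.
suff H e h : hom e h -> DK (pf k h) \in Lie_K F p n t.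
  by rewrite (hpartD f) linearD linearD /=; apply: rpredD; apply: H (hom_hpart _ f).
move=> hh; have := Lie_K_bracket (hom_var F p n t i) hh.
rewrite (partial_var F bnd_gt1) (eq_sym m) ni scale0r mul0l scaler0 subr0.
rewrite (D_K_contact (hom_var F p n t i)) contactE partialE (bigD1_seq k kr rK_uniq) /=.
rewrite big1_seq => [|j /andP[jk jr]]; last by rewrite YV // (negPf jk) mul0r scale0r mul0l scaler0.
rewrite addr0 (YV k kr) eqxx mul1r mulZl mul1f scalerA YKE (prK_K kr) -/i pm.
rewrite scalerDr addrA -scalerDl linearD !linearZ /= => HH.
have := rpredB HH (memvZ (2 + sigma k * (-1) ^+ (mu m k && mu m i) * sigma i) (Lie_K_partial_m (var i ** h))).
rewrite addrC addKr scalerA.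
set s := (X in X *: _) => Hs; have s0 : s != 0 by rewrite !mulf_neq0 ?signr_eq0 ?sigma_neq0.
by have := memvZ s^-1 Hs; rewrite scalerA mulVf // scale1r.
Qed.

Definition setK : {set X} := [set x | DK (mon (expo x)) \in Lie_K F p n t].

Lemma setK_top x : expo x != topm -> x \in setK.
Proof.
move=> /mon_partial[k [g E]]; rewrite inE E.
case: (boolP (0 < k <= m + n)%N) => [vk|nk]; first exact: Lie_K_partial.
by rewrite partial_out // linear0 mem0v.
Qed.

(** Membership of the top monomial can stay undecided: if an element of K has a nonzero top
    coefficient, subtracting its other terms, which lie in K, places the top field in K as well. *)
Lemma Lie_K_basis : graded_basis (parity_proj F p n t) (Lie_K F p n t)
  setK (fun x => DK (mon (expo x))) (fun x => parx (expo x)).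
Proof.
split.
- by move=> x; rewrite inE.
- by move=> x _; rewrite (op_partE _ (pardeg_D_K (hom_mon _ _ _ _))) eqxx.
- move=> w w0 x xS; pose f : O := \sum_(y in setK) w y *: mon (expo y).
  have f0 : f = 0.
    apply: D_K_inj; rewrite linear_sum -[RHS]w0; apply: eq_bigr => y _; by rewrite linearZ.
  have : coef f x = w x.
    rewrite coef_sum (bigD1 x) //= coefZ coef_monx eqxx mulr1 big1 ?addr0 // => y /andP[_ yx].
    by rewrite coefZ coef_monx (negPf yx) mulr0.
  by rewrite f0 dcoef0.
apply: (dim_le_family (v := fun x => DK (mon (expo x)))) => u uK.
have : u \in limg (linfun DK).
  exact: (subvP derived_K).
case/memv_imgP => f _; rewrite lfunE /= => uf.
exists (fun x => coef f x); rewrite [RHS]big_mkcond uf {1}(mon_expand f) linear_sum /=.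
apply: eq_bigr => x _; rewrite linearZ /=; case: ifPn => // xS.
suff -> : coef f x = 0 by rewrite scale0r.
apply/eqP; apply: contraR xS => fx; rewrite inE.
case: (boolP (expo x == topm)) => [/eqP xt|/setK_top]; last by rewrite inE.
have ux : u = coef f x *: DK (mon (expo x)) + \sum_(y | y != x) coef f y *: DK (mon (expo y)).
  rewrite uf {1}(mon_expand f) linear_sum (bigD1 x) //= linearZ; congr (_ + _).
  by apply: eq_bigr => y _; rewrite linearZ.
have : coef f x *: DK (mon (expo x)) \in Lie_K F p n t.
  have -> : coef f x *: DK (mon (expo x)) = u - \sum_(y | y != x) coef f y *: DK (mon (expo y)).
    by rewrite ux addrK.
  apply: rpredB uK _; apply: memv_suml => y yx; apply: memvZ.
  suff /setK_top : expo y != topm by rewrite inE.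
  by rewrite -xt (inj_eq (@expo_inj _ _ _ _)).
by move/(memvZ (coef f x)^-1); rewrite scalerA mulVf // scale1r.
Qed.

Lemma Lie_K_card e : (0 < n)%N ->
  (#|[set x in setK | parx (expo x) == e]| <= #|[set x in setK | parx (expo x) == ~~ e]|.+1)%N.
Proof.
move=> n0; have mi : mu m (rshift m (Ordinal n0)).+1 by rewrite /mu /= addn0.
have E : #|[set x : X | parx (expo x) == e]| = #|[set x : X | parx (expo x) == ~~ e]|.
  exact: (card_flip (P := predT) e mi (fun _ => erefl)).
have [xt ext] : exists x : X, expo x = topm.
  by apply/boundedP/forallP => i; rewrite ffunE prednK // ltnW.
apply: leq_trans (_ : #|[set x : X | parx (expo x) == e]| <= _)%N.
  by apply/subset_leq_card/subsetP => x; rewrite !inE => /andP[].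
rewrite E (cardsD1 xt) -add1n; apply: leq_add; first by case: (_ \in _).
apply/subset_leq_card/subsetP => x; rewrite !in_set => /andP[xxt ->]; rewrite andbT.
have := setK_top (x := x); rewrite in_set; apply.
by rewrite -ext (inj_eq (@expo_inj _ _ _ _)); move: xxt; rewrite !inE.
Qed.

End K.

(** * The odd contact superalgebra KO *)

Section HamiltonianIndices.

Variable N : nat.
Notation pr := (prime_H N).
Notation mu := (mu N).
Notation tau := (N.*2.+1).
Implicit Types i j k : nat.

Definition rH := index_iota 1 N.*2.+1.

Lemma mem_rH k : (k \in rH) = (0 < k <= N.*2)%N.
Proof. by rewrite mem_index_iota ltnS. Qed.

Lemma rH_uniq : uniq rH. Proof. exact: iota_uniq. Qed.

Lemma pr_rH j : j \in rH -> pr j \in rH.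
Proof. by rewrite !mem_rH -!addnn; exact: prime_H_valid. Qed.

Lemma prK_H j : j \in rH -> pr (pr j) = j.
Proof. by rewrite !mem_rH -!addnn; exact: prime_H_inv. Qed.

Lemma mu_pr_H j : j \in rH -> mu (pr j) = ~~ mu j.
Proof. by rewrite mem_rH -!addnn; exact: mu_prime_H. Qed.

Lemma rH_valid j : j \in rH -> (0 < j <= N + N.+1)%N /\ (j == tau) = false.
Proof. by rewrite mem_rH => H; split; lia. Qed.

Lemma tau_valid : (0 < tau <= N + N.+1)%N. Proof. lia. Qed.

Lemma mu_tau : mu tau. Proof. by rewrite /Defs.mu; lia. Qed.

Lemma big_rH (V : zmodType) (G : nat -> V) :
  \sum_(j <- rH) G j = \sum_(1 <= i < N.+1) (G i + G (pr i)).
Proof.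
rewrite big_split /= /rH (@big_cat_nat _ _ _ N.+1) //=; last by rewrite ltnS -addnn leq_addr.
congr (_ + _); have {1}-> : N.+1 = (1 + N)%N by [].
rewrite big_addn (_ : (_ - N = N.+1)%N); last lia.
by apply: eq_big_nat => i iN; rewrite /prime_H ifT // -ltnS; case/andP: iN.
Qed.

End HamiltonianIndices.

Section KO.

Variables (F : fieldType) (p N : nat) (t : 'I_N -> nat).
Hypothesis charFp : p \in [pchar F].
Hypothesis two : (2 : F) != 0.
Hypothesis bnd_gt1 : forall i, (1 < @expo_bound p N N.+1 t i)%N.
Notation O := (dpsa F p N.+1 t).
Notation X := (monomial p N.+1 t).
Notation mon := (@mon F p N N.+1 t).
Notation pf := (@partial_fun F p N N.+1 t).
Notation var := (var F p N.+1 t).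
Notation one := (one F p N.+1 t).
Notation partial := (partial F p N.+1 t).
Notation DKO := (@D_KO F p N N.+1 t).
Notation "f ** g" := (dp_mul f g) (at level 40, left associativity).
Notation pr := (prime_H N).
Notation mu := (mu N).
Notation tau := (N.*2.+1).
Notation rH := (rH N).
Notation pard := (parity_proj F p N.+1 t).
Implicit Types (f g h w : O) (d e : bool) (i j k l : nat) (q : F).

(** The frame of KO, with Z = d_tau: the brackets are [Y_i, Y_(i')] = 2 (-1)^mu(i) d_tau. *)
Definition YH j : 'End(O) := partial j - (-1) ^+ mu j *: smul (var (pr j)) (partial tau).

Lemma YHE j f : YH j f = pf j f - (-1) ^+ mu j *: (var (pr j) ** pf tau f).
Proof. by rewrite add_lfunE opp_lfunE scale_lfunE smulE !partialE. Qed.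

Lemma YH_def j : YH j = partial j - (-1) ^+ mu j *: smul (var (pr j)) (partial tau).
Proof. by []. Qed.

Opaque YH.

Let pder k : superder (mu k) (partial k) := partial_der N.+1 t charFp k.

Lemma YH_der j : j \in rH -> superder (mu j) (YH j).
Proof.
move=> jr; apply: superderD; first exact: pder.
rewrite -scaleN1r; apply/superderZ/superderZ.
have := superder_smul (hom_var F p N.+1 t (pr j)) (pder tau).
by rewrite mu_tau addbT mu_pr_H // negbK.
Qed.

Let pmv := partial_mulvar charFp bnd_gt1.

Lemma pf_tau2 f : pf tau (pf tau f) = 0.
Proof.
have [i E] := validP (tau_valid N); rewrite E; apply: partial_odd2; rewrite -E; exact: mu_tau.
Qed.

Lemma YH_YH i j f : i \in rH -> j \in rH -> YH i (YH j f) =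
  (-1) ^+ (mu i && mu j) *: YH j (YH i f) + ((j == pr i)%:R * (2 * (-1) ^+ mu i)) *: partial tau f.
Proof.
move=> ir jr; have [ir' jr'] := (pr_rH ir, pr_rH jr).
have [vi ni] := rH_valid ir; have [vj nj] := rH_valid jr.
have [vi' ni'] := rH_valid ir'; have [vj' nj'] := rH_valid jr'.
rewrite partialE !YHE !linearB !linearZ /= !pmv !mu_tau /=.
rewrite !(eq_sym tau) ni' nj' vi vj !andbT /= !mu_pr_H // !scale0r !add0r !pf_tau2 !mulf0 !scaler0.
rewrite (partialC j i) (partialC tau i) (partialC tau j) mu_tau /=.
have -> : (i == pr j) = (j == pr i) by apply/eqP/eqP => ->; rewrite prK_H.
have -> : (j == pr i) = (pr i == j) by rewrite eq_sym.
rewrite !mul_lin; apply: coefP => x; rewrite !coef_lin.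
case: (eqVneq (pr i) j) => [<-|_] /=; last by gen_coef; case: (mu i); case: (mu j); rewrite /= ?expr0 ?expr1; ring.
rewrite prK_H // mu_pr_H //.
by gen_coef; case: (mu i); rewrite /= ?expr0 ?expr1; ring.
Qed.

Let h1 j : j \in rH -> mu (pr j) = mu j (+) true.
Proof. by move=> jr; rewrite mu_pr_H // addbT. Qed.
Let h2 : superder true (partial tau).
Proof. by have := pder tau; rewrite mu_tau. Qed.
Let h3 i f : i \in rH -> partial tau (YH i f) = (-1) ^+ (true && mu i) *: YH i (partial tau f).
Proof.
move=> ir; have [vi' ni'] := rH_valid (pr_rH ir).
rewrite !partialE !YHE linearB linearZ /= pmv (eq_sym tau) ni' scale0r add0r pf_tau2 !mulf0 !scaler0.
by rewrite !subr0 (partialC tau i) mu_tau.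
Qed.
Let h4 f : true -> partial tau (partial tau f) = 0. Proof. by rewrite !partialE pf_tau2. Qed.
Let cH (j : nat) : F := 1.
Let h5 j : j \in rH -> cH (pr j) = (-1) ^+ (~~ true && ~~ mu j) * cH j.
Proof. by rewrite mul1r. Qed.
Let h6 i : i \in rH -> cH i * (-1) ^+ mu i * (2 * (-1) ^+ mu i) = - (- 2).
Proof. by move=> _; case: (mu i); rewrite /cH /= ?expr0 ?expr1; ring. Qed.
Let h7 i : i \in rH -> cH i * (-1) ^+ (mu i && true) * (2 * (-1) ^+ mu (pr i)) = - 2.
Proof. by move=> ir; rewrite mu_pr_H // /cH; case: (mu i); rewrite /= ?expr0 ?expr1; ring. Qed.

Notation Dc := (contact rH pr (Defs.mu N) (fun=> 1 : F) (- 2) YH (partial tau)).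

Lemma EulerE f : Euler F p N.+1 t f = \sum_(j <- rH) var j ** pf j f.
Proof. by rewrite sum_lfunE; apply: eq_bigr => j _; rewrite smulE partialE. Qed.

(** As for K, the terms x_j x_(j') d_tau f cancel in pairs; what is left is the Euler part of the
    coefficient of d_tau. *)
Lemma euler_KO e f : hom e f ->
  \sum_(j <- rH) ((-1) ^+ (mu j && e) * (-1) ^+ mu j) *: (YH j f ** var j) = Euler F p N.+1 t f.
Proof.
move=> hf.
pose G j := (-1) ^+ mu j *: ((var j ** var (pr j)) ** pf tau f).
have E j : j \in rH -> ((-1) ^+ (mu j && e) * (-1) ^+ mu j) *: (YH j f ** var j) =
    var j ** pf j f - G j.
  move=> jr; rewrite (mulC ((YH_der jr).1 _ _ hf) (hom_var F p N.+1 t j)) YHE /G -mulA.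
  rewrite !mul_lin; apply: coefP => x; rewrite !coef_lin; gen_coef.
  by case: (mu j); case: (e); rewrite /= ?expr0 ?expr1; ring.
rewrite (eq_big_seq _ E) big_split sumrN /= EulerE.
suff -> : \sum_(j <- rH) G j = 0 by rewrite oppr0 addr0.
have GG : \sum_(j <- rH) G j = - \sum_(j <- rH) G j.
  rewrite {1}(big_pr (rH_uniq N) (@pr_rH N) (@prK_H N) G) -sumrN; apply: eq_big_seq => j jr.
  rewrite /G prK_H // mu_pr_H // (mulC (hom_var F p N.+1 t (pr j)) (hom_var F p N.+1 t j)) mu_pr_H //.
  rewrite !mul_lin; apply: coefP => x; rewrite !coef_lin; gen_coef.
  by case: (mu j); rewrite /= ?expr0 ?expr1; ring.
apply/eqP; have : 2 *: \sum_(j <- rH) G j == 0 by rewrite scaler_nat mulr2n {1}GG addNr.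
by rewrite scaler_eq0 (negPf two).
Qed.

Lemma D_KO_contact e f : hom e f -> DKO f = Dc e f.
Proof.
move=> hf; rewrite /D_KO (extendE _ hf); last first.
  move=> e' x g h; rewrite !linearP /=.
  rewrite [X in smul X (Defs.partial _ _ _ _ _)]addrACA -scalerDr !smul_linear.
  rewrite !scalerDr !scalerA [x * _]mulrC.
  by rewrite [X in X + _ = _]addrACA [LHS]addrACA.
rewrite /T_H (extendE _ hf); last first.
  move=> e' x g h; rewrite scaler_sumr -big_split /=; apply: eq_bigr => i _.
  by rewrite linearP smul_linear scalerDr !scalerA [x * _]mulrC.
have E j : j \in rH -> (1 * (-1) ^+ (mu j && e)) *: smul (YH j f) (YH (pr j)) =
   (-1) ^+ (mu j && e) *: smul (pf j f) (partial (pr j))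
   + (-1) ^+ e *: smul (pf tau f ** var (pr j)) (partial (pr j))
   + smul (((-1) ^+ (mu j && e) * (-1) ^+ mu j) *: (YH j f ** var j)) (partial tau).
  move=> jr; rewrite (YH_def (pr j)) prK_H // smulDr -scaleN1r !smulZr smul_smul smulZ scalerDr; congr (_ + _); last first.
    rewrite !scalerA mu_pr_H //; congr (_ *: _).
    by case: (mu j); case: (e); rewrite /= ?expr0 ?expr1; ring.
  rewrite -!smulZ -smulDl; congr smul; rewrite YHE.
  rewrite (mulC (hom_partial tau hf) (hom_var F p N.+1 t (pr j))) mu_tau mu_pr_H //.
  apply: coefP => x; rewrite !coef_lin; gen_coef.
  by case: (mu j); case: (e); rewrite /= ?expr0 ?expr1; ring.
rewrite /contact (eq_big_seq _ E) !big_split /= -smul_sum (euler_KO hf).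
rewrite smulDl -(scaleN1r (2 *: f)) !smulZ scalerA mulN1r [RHS]addrC -!addrA; congr (_ + _).
  rewrite [RHS](big_pr (rH_uniq N) (@pr_rH N) (@prK_H N)); apply: eq_big_seq => j jr.
  rewrite prK_H // partialE; congr (_ *: _).
  by case: (mu _); case: (e).
rewrite !addrA; congr (_ + _ + _).
rewrite -scaler_sumr; congr (_ *: _); rewrite partialE /Euler.
rewrite -(big_pr (rH_uniq N) (@pr_rH N) (@prK_H N) (fun j => smul (pf tau f ** var j) (partial j))).
apply/lfunP => w; rewrite smulE !sum_lfunE mul_sumr; apply: eq_bigr => j _.
by rewrite !smulE mulA.
Qed.

Opaque D_KO.

Lemma pardeg_D_KO e f : hom e f -> pardeg (~~ e) (DKO f).
Proof.
move=> hf; rewrite (D_KO_contact hf) -addbT.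
exact: (contact_der (fun=> 1) (- 2) (@pr_rH N) h1 YH_der h2 hf).1.
Qed.

(* div_KO lambda is Dop (N lambda), up to a sign depending on the parity and a
   factor 2. *)
Definition Dop q : 'End(O) :=
  (Delta F p N.+1 t + ((Euler F p N.+1 t - q *: \1)%VF \o partial tau)%VF).

Lemma DopE q f : Dop q f = Delta F p N.+1 t f + Euler F p N.+1 t (pf tau f) - q *: pf tau f.
Proof. by rewrite !(add_lfunE, opp_lfunE, scale_lfunE, comp_lfunE, id_lfunE) partialE addrA. Qed.

Opaque Dop.

Lemma DeltaE f : Delta F p N.+1 t f = \sum_(1 <= i < N.+1) pf i (pf (pr i) f).
Proof. by rewrite sum_lfunE; apply: eq_bigr => i _; rewrite comp_lfunE !partialE. Qed.

Opaque Delta Euler.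

Lemma homDop q e f : hom e f -> hom (~~ e) (Dop q f).
Proof.
move=> hf; rewrite DopE DeltaE EulerE.
have ht : hom (~~ e) (pf tau f) by have := hom_partial tau hf; rewrite mu_tau addbT.
apply: homD; last exact/homN/homZ.
apply: homD.
  rewrite big_nat; apply: hom_sum => i /andP[i1 i2].
  have := hom_partial i (hom_partial (pr i) hf); rewrite mu_prime_H; last lia.
  by rewrite -addbA addNb addbb addbT.
apply: hom_sum => i _; rewrite -[~~ e](addKb (mu i)); apply: homM (hom_var _ _ _ _ _) _.
by rewrite addbC; exact: hom_partial.
Qed.

Lemma hpart_Dop q e f : hpart e (Dop q f) = Dop q (hpart (~~ e) f).
Proof.
rewrite {1}(hpartD f) !linearD /=.
have := homDop q (hom_hpart false f); have := homDop q (hom_hpart true f).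
set u := Dop q _; set v := Dop q _ => hu hv.
have H e' g : hom e' g -> hpart (~~ e') g = 0.
  move=> /homP hg; apply: coefP => x; rewrite coef_hpart dcoef0; case: eqP => // xe.
  by apply: hg; rewrite xe; case: (e').
case: e => /=; first by rewrite hv (H false) ?addr0.
by rewrite hu (H true) ?add0r.
Qed.

Lemma sum_YY f : \sum_(1 <= i < N.+1) YH i (YH (pr i) f) =
  Delta F p N.+1 t f + Euler F p N.+1 t (pf tau f) + N%:R *: pf tau f.
Proof.
have E i : (1 <= i < N.+1)%N -> YH i (YH (pr i) f) = pf i (pf (pr i) f) +
   (var i ** pf i (pf tau f) + var (pr i) ** pf (pr i) (pf tau f)) + pf tau f.
  move=> iN; have ir : i \in rH by rewrite mem_rH; lia.
  have [vi ni] := rH_valid ir; have [vi' ni'] := rH_valid (pr_rH ir).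
  have mi : mu i = false by rewrite /Defs.mu; lia.
  rewrite !YHE !linearB !linearZ /= !pmv !mu_tau mu_pr_H // mi prK_H // eqxx vi /= (eq_sym tau) ni.
  rewrite pf_tau2 !scale0r !mulf0 !scaler0 !addr0 (partialC tau (pr i)) mu_tau mu_pr_H // mi.
  rewrite !mul_lin; apply: coefP => x; rewrite !coef_lin /= ?expr0 ?expr1; gen_coef; ring.
rewrite (eq_big_nat _ _ E) !big_split /= DeltaE EulerE big_rH big_split /=; congr (_ + _ + _).
by rewrite big_const_nat subSS subn0 iter_addr_0 scaler_nat.
Qed.

(** Through the frame, [Dop q] becomes a second order operator built from superderivations, so its
    product rule can be read off. *)
Lemma Dop_YY q f : Dop q f = \sum_(1 <= i < N.+1) YH i (YH (pr i) f) - (N%:R + q) *: pf tau f.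
Proof. by rewrite sum_YY DopE; coef_ring. Qed.

Lemma superder2M (A B : 'End(O)) e f g : superder false A -> superder true B -> hom e f ->
  A (B (f ** g)) = A (B f) ** g + (-1) ^+ e *: (f ** A (B g)) + (B f ** A g + (-1) ^+ e *: (A f ** B g)).
Proof.
move=> hA hB hf; rewrite (superderM g hB hf) linearD linearZ /= (superderM _ hA hf).
rewrite (superderM g hA (hB.1 _ _ hf)) /= expr0 !scale1r; coef_ring.
Qed.

Lemma Dop_mul q e f g : hom e f -> Dop q (f ** g) = Dop q f ** g + (-1) ^+ e *: (f ** Dop q g)
  + \sum_(1 <= i < N.+1) (YH (pr i) f ** YH i g + (-1) ^+ e *: (YH i f ** YH (pr i) g)).
Proof.
move=> hf; rewrite !Dop_YY.
have E i : (1 <= i < N.+1)%N -> YH i (YH (pr i) (f ** g)) =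
   YH i (YH (pr i) f) ** g + (-1) ^+ e *: (f ** YH i (YH (pr i) g)) +
   (YH (pr i) f ** YH i g + (-1) ^+ e *: (YH i f ** YH (pr i) g)).
  move=> iN; have ir : i \in rH by rewrite mem_rH; lia.
  have mi : mu i = false by rewrite /Defs.mu; lia.
  have dA := YH_der ir; have dB := YH_der (pr_rH ir); rewrite (mu_pr_H ir) mi in dB; rewrite mi in dA.
  exact: (@superder2M (YH i) (YH (pr i)) e f g dA dB hf).
rewrite (eq_big_nat _ _ E) !big_split /= leibniz // mu_tau (sg_hom _ hf).
rewrite -mul_suml -scaler_sumr -mul_sumr !mul_lin -!scaler_sumr /=.
have H (A1 A2 A3 A4 A5 A6 : O) : A1 + (-1) ^+ e *: A2 + (A3 + (-1) ^+ e *: A4)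
    - (N%:R + q) *: (A5 + (-1) ^+ e *: A6)
  = A1 - (N%:R + q) *: A5 + (-1) ^+ e *: (A2 - (N%:R + q) *: A6) + (A3 + (-1) ^+ e *: A4) by coef_ring.
exact: H.
Qed.

(** [Dop q] behaves like a Batalin-Vilkovisky Laplacian: its deviation from the Leibniz rule
    consists of the products Y_j f Y_(j') g, which are the frame part of the field of f applied to
    g. *)
Lemma D_KO_Dop e q f g : hom e f -> DKO f g = - 2 *: (f ** pf tau g) +
  (-1) ^+ e *: (Dop q (f ** g) - Dop q f ** g - (-1) ^+ e *: (f ** Dop q g)).
Proof.
move=> hf; rewrite (D_KO_contact hf) contactE partialE (Dop_mul q g hf); congr (_ + _).
have H (a b c : O) : a + b + c - a - b = c by coef_ring.
rewrite H big_rH scaler_sumr; apply: eq_big_nat => i iN.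
have ir : i \in rH by rewrite mem_rH; lia.
have mi : mu i = false by rewrite /Defs.mu; lia.
rewrite (mu_pr_H ir) mi (prK_H ir).
have H2 (A1 A2 : O) : (1 * (-1) ^+ (false && e)) *: A1 + (1 * (-1) ^+ (~~ false && e)) *: A2
    = (-1) ^+ e *: (A2 + (-1) ^+ e *: A1).
  by case: (e); rewrite /= ?expr0 ?expr1; coef_ring.
exact: (H2 (YH i f ** YH (pr i) g) (YH (pr i) f ** YH i g)).
Qed.

(** On the kernel of [Dop q] the deviation from the Leibniz rule is [Dop q (f ** g)] itself. The two
    terms with a derivative in tau combine to -2 d_tau (f g), and subtracting them replaces q by q +
    2. *)
Lemma D_KO_bracket q e e' f g : hom e f -> hom e' g -> Dop q f = 0 -> Dop q g = 0 ->
  bracket pard (DKO f) (DKO g) = DKO ((-1) ^+ e *: Dop (q + 2) (f ** g)).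
Proof.
move=> hf hg f0 g0; rewrite (bracketE (pardeg_D_KO hf) (pardeg_D_KO hg)).
have hh : hom (e (+) e' (+) true) ((-1) ^+ e *: Dop (q + 2) (f ** g)).
  by rewrite addbT; apply/homZ/homDop/homM.
rewrite (D_KO_contact hh); apply/lfunP => w.
have := contact_bracket (rH_uniq N) (@pr_rH N) (@prK_H N) h1 YH_der h2 YH_YH h3 h4 h5 h6 h7 w hf hg.
rewrite /cbracket -!(D_KO_contact hf) -(D_KO_contact hg).
have e1 := D_KO_Dop q g hf; rewrite f0 g0 mul0l mulf0 scaler0 !subr0 in e1.
have e2 : Dop (q + 2) (f ** g) = Dop q (f ** g) - 2 *: pf tau (f ** g).
  have H (A1 A2 A3 : O) : A1 + A2 - (q + 2) *: A3 = A1 + A2 - q *: A3 - 2 *: A3 by coef_ring.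
  apply: etrans (DopE (q + 2) (f ** g)) _; apply: etrans (H _ _ _) _.
  by congr (_ - _); exact: esym (DopE q (f ** g)).
have e3 := leibniz charFp tau f g; rewrite mu_tau (sg_hom _ hf) mulZl in e3.
have -> : DKO f g - ((-1) ^+ (true && (e (+) true)) * -2) *: (partial tau f ** g) =
   (-1) ^+ e *: Dop (q + 2) (f ** g).
  have H (A1 A2 A3 : O) : -2 *: A1 + (-1) ^+ e *: A2
      - ((-1) ^+ (true && (e (+) true)) * -2) *: A3 =
      (-1) ^+ e *: (A2 - 2 *: (A3 + (-1) ^+ (true && e) *: A1)).
    by case: (e); rewrite /= ?expr0 ?expr1; coef_ring.
  rewrite partialE; apply: etrans (congr1 (fun A => A - _) e1) _.
  apply: etrans (H (f ** pf tau g) (Dop q (f ** g)) (pf tau f ** g)) _.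
  apply: (congr1 (fun A => (-1) ^+ e *: A)); apply: esym.
  exact: etrans e2 (congr1 (fun A => Dop q (f ** g) - 2 *: A) e3).
rewrite !addbT => H; exact: etrans (comm_lfunE _ (DKO f) (DKO g) w) H.
Qed.

Lemma op_part_D_KO e f : op_part pard e (DKO f) = DKO (hpart (~~ e) f).
Proof.
have -> : DKO f = DKO (hpart false f) + DKO (hpart true f) by rewrite -linearD -hpartD.
rewrite op_partD; apply: etrans (congr2 +%R (op_partE e (pardeg_D_KO (hom_hpart false f))) (op_partE e (pardeg_D_KO (hom_hpart true f)))) _.
by case: e; rewrite /= ?addr0 ?add0r.
Qed.

(** Evaluation at x_(k') gives Y_k g = 0 for every k, and evaluation at tau then gives -2 g = 0. *)
Lemma D_KO_inj f : DKO f = 0 -> f = 0.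
Proof.
have H e g : hom e g -> DKO g = 0 -> g = 0.
  move=> hg; rewrite (D_KO_contact hg) => g0.
  have YV j k : j \in rH -> k \in rH -> YH (pr j) (var k) = (k == pr j)%:R *: one.
    move=> jr kr; have [vk nk] := rH_valid kr; have [vj nj] := rH_valid (pr_rH jr).
    by rewrite YHE !partial_var // (eq_sym tau) nk scale0r mulf0 scaler0 subr0 vj andbT eq_sym.
  have Y0 k : k \in rH -> YH k g = 0.
    move=> kr; have := congr1 (fun D : 'End(O) => D (var (pr k))) g0.
    have [vk nk] := rH_valid (pr_rH kr).
    rewrite /= zero_lfunE contactE partialE partial_var // (eq_sym tau) nk scale0r mulf0 scaler0 add0r.
    rewrite (bigD1_seq k) ?rH_uniq //= YV ?pr_rH // eqxx scale1r mulf1 mul1r.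
    rewrite big1_seq ?addr0 => [|j /andP[jk jr]]; last first.
      rewrite YV ?pr_rH //; case: eqP => [E|_]; last by rewrite scale0r mulf0 scaler0.
      by rewrite -(prK_H jr) -E prK_H // eqxx in jk.
    by move/eqP; rewrite scaler_eq0 signr_eq0 => /eqP.
  have := congr1 (fun D : 'End(O) => D (var tau)) g0.
  rewrite /= zero_lfunE contactE partialE partial_var // eqxx tau_valid scale1r mulf1.
  rewrite big1_seq ?addr0 => [|j /andP[_ jr]]; last by rewrite Y0 // mul0l scaler0.
  by move/eqP; rewrite scaler_eq0 oppr_eq0 (negPf two) => /eqP.
move=> f0; have h0 e : hpart e f = 0.
  by apply: H (hom_hpart e f) _; rewrite -[e]negbK -op_part_D_KO f0 linear0.
by rewrite (hpartD f) !h0 addr0.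
Qed.

(** The summands d_i d_(i') are odd and anticommute, so the square equals its own negative. *)
Lemma Delta2 f : Delta F p N.+1 t (Delta F p N.+1 t f) = 0.
Proof.
set D := Delta _ _ _ _; pose d i j := pf i (pf (pr i) (pf j (pf (pr j) f))).
have E : D (D f) = \sum_(1 <= i < N.+1) \sum_(1 <= j < N.+1) d i j.
  rewrite [in LHS](DeltaE f) (DeltaE (\sum_(_ <= _ < _) _)); apply: eq_bigr => i _.
  by rewrite !linear_sum; apply: eq_bigr.
have dC i j : (1 <= i < N.+1)%N -> (1 <= j < N.+1)%N -> d i j = - d j i.
  move=> iN jN; have mi : mu i = false by rewrite /Defs.mu; lia.
  have mj : mu j = false by rewrite /Defs.mu; lia.
  have ir : i \in rH by rewrite mem_rH; lia.
  have jr : j \in rH by rewrite mem_rH; lia.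
  rewrite /d (partialC (pr i) j) mj andbF expr0 scale1r (partialC i j) mi expr0 scale1r.
  rewrite (partialC (pr i) (pr j)) mu_pr_H // mu_pr_H // mi mj expr1 !scaleN1r !linearN /=.
  by rewrite (partialC i (pr j)) mi expr0 scale1r.
have : D (D f) = - D (D f).
  rewrite {1}E exchange_big /= E -sumrN; apply: eq_big_nat => i iN; rewrite -sumrN.
  by apply: eq_big_nat => j jN; apply: dC.
move=> Eq; apply/eqP; have : 2 *: D (D f) == 0 by rewrite scaler_nat mulr2n {1}Eq addNr.
by rewrite scaler_eq0 (negPf two).
Qed.

Lemma partial_Euler k f : k \in rH -> pf k (Euler F p N.+1 t f) = pf k f + Euler F p N.+1 t (pf k f).
Proof.
move=> kr; have [vk nk] := rH_valid kr.
rewrite !EulerE linear_sum /=.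
have E j : j \in rH -> pf k (var j ** pf j f) = (if j == k then pf k f else 0) + var j ** pf j (pf k f).
  move=> jr; rewrite pmv vk andbT (partialC k j) mulZr scalerA -signr_addb addbb scale1r eq_sym.
  by case: eqP => [->|_]; rewrite ?scale1r ?scale0r.
by rewrite (eq_big_seq _ E) big_split /= sum_if_eq ?rH_uniq.
Qed.

Lemma partial_tau_Euler f : pf tau (Euler F p N.+1 t f) = Euler F p N.+1 t (pf tau f).
Proof.
rewrite !EulerE linear_sum /=; apply: eq_big_seq => j jr; have [_ nj] := rH_valid jr.
by rewrite pmv (eq_sym tau) nj scale0r add0r (partialC tau j) mulZr scalerA -signr_addb addbb scale1r.
Qed.

Lemma Delta_Euler f : Delta F p N.+1 t (Euler F p N.+1 t f) =
  Euler F p N.+1 t (Delta F p N.+1 t f) + 2 *: Delta F p N.+1 t f.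
Proof.
rewrite !DeltaE linear_sum scaler_sumr -big_split; apply: eq_big_nat => i iN /=.
have ir : i \in rH by rewrite mem_rH; lia.
rewrite partial_Euler ?pr_rH // linearD /= partial_Euler //.
by coef_ring.
Qed.

Lemma Delta_tau f : Delta F p N.+1 t (pf tau f) = - pf tau (Delta F p N.+1 t f).
Proof.
rewrite !DeltaE linear_sum -sumrN; apply: eq_big_nat => i iN /=.
have ir : i \in rH by rewrite mem_rH; lia.
have mi : mu i = false by rewrite /Defs.mu; lia.
rewrite (partialC (pr i) tau) mu_tau mu_pr_H // mi expr1 scaleN1r linearN /=.
by rewrite (partialC i tau) mi expr0 scale1r.
Qed.

(** Delta and d_tau anticommute and have square 0. Only mixed terms survive, and they cancel because
    Delta o Euler = (Euler + 2) o Delta, which explains the shift by 2. *)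
Lemma Dop_Dop q f : Dop q (Dop (q + 2) f) = 0.
Proof.
rewrite !DopE !linearB !linearD !linearZ /= Delta2 Delta_Euler Delta_tau.
rewrite partial_tau_Euler pf_tau2 !linear0 !linearN /=.
by coef_ring.
Qed.

Lemma div_KOE (lambda : F) f : div_KO lambda f = 2 *: Dop (N%:R * lambda) (sg true f).
Proof.
rewrite /div_KO /extend big_bool /= sgE.
have -> : Dop (N%:R * lambda) (hpart false f + (-1) ^+ true *: hpart true f) =
   Dop (N%:R * lambda) (hpart false f) - Dop (N%:R * lambda) (hpart true f).
  by rewrite linearD expr1 scaleN1r linearN.
rewrite !DopE !(add_lfunE, opp_lfunE, scale_lfunE, id_lfunE, partialE) /= expr0 expr1.
by coef_ring.
Qed.

Lemma Dop_sg q f : Dop q f = 0 -> Dop q (sg true f) = 0.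
Proof.
move=> f0; have H e : Dop q (hpart e f) = 0 by rewrite -[e]negbK -hpart_Dop f0 linear0.
by rewrite sgE linearD linearZ /= (H false) (H true) scaler0 addr0.
Qed.

Lemma div_KO_eq0 (lambda : F) f : div_KO lambda f = 0 <-> Dop (N%:R * lambda) f = 0.
Proof.
rewrite div_KOE; split=> [/eqP|f0]; last by rewrite Dop_sg ?scaler0.
by rewrite scaler_eq0 (negPf two) => /eqP/Dop_sg; rewrite sgK.
Qed.

(* The top coefficient is an integral: it vanishes on derivatives, which makes
   Dop (-1) adjoint to Dop 1 up to signs. *)
Section Integral.

Variable x0 : X.
Hypothesis x0_top : expo x0 = topm p N.+1 t.

Lemma int_partial k f : coef (pf k f) x0 = 0.
Proof.
case: (boolP (0 < k <= N + N.+1)%N) => [/validP[i ->]|nk]; last by rewrite partial_out // dcoef0.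
rewrite coef_partial big1 ?mulr0 // => y /eqP E; have /forallP/(_ i) := expo_bounded y.
by rewrite E x0_top !ffunE eqxx addn1 prednK ?ltnn // ltnW.
Qed.

Lemma int_parts k e f g : hom e f ->
  coef (pf k f ** g) x0 = - (-1) ^+ (mu k && e) * coef (f ** pf k g) x0.
Proof.
move=> hf; have := int_partial k (f ** g); rewrite leibniz // (sg_hom _ hf) mulZl coefD coefZ => /eqP.
by rewrite addr_eq0 mulNr => /eqP.
Qed.

(** By parts, x_j d_j contributes the top coefficient with sign -(-1)^mu(j), and the Euler field
    involves as many even as odd variables. *)
Lemma int_Euler f : coef (Euler F p N.+1 t f) x0 = 0.
Proof.
have E j : j \in rH -> coef (var j ** pf j f) x0 = - (-1) ^+ mu j * coef f x0.
  move=> jr; have [vj _] := rH_valid jr.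
  have := int_partial j (var j ** f); rewrite pmv eqxx vj scale1r coefD coefZ andbb => /eqP.
  rewrite addr_eq0 => /eqP->; case: (mu j); rewrite ?expr0 ?expr1; ring.
rewrite EulerE coef_sum (eq_big_seq _ E) big_rH big_nat big1 // => i iN.
have ir : i \in rH by rewrite mem_rH; lia.
rewrite mu_pr_H //; case: (mu i); rewrite /= ?expr0 ?expr1; ring.
Qed.

Lemma Euler_der : superder false (Euler F p N.+1 t).
Proof.
apply: superder_sum => j _; rewrite -(addbb (mu j)).
exact: superder_smul (hom_var F p N.+1 t j) (pder j).
Qed.

Lemma int_Dop q e f g : hom e f -> coef (Dop q f ** g) x0 = (-1) ^+ e * coef (f ** Dop (- q) g) x0.
Proof.
move=> hf; apply: etrans (congr1 (fun A => coef (A ** g) x0) (DopE q f)) _.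
apply: etrans _ (congr1 (fun A => (-1) ^+ e * coef (f ** A) x0) (esym (DopE (- q) g))).
rewrite !mul_lin !coef_lin.
have htau := hom_partial tau hf.
have -> : coef (Delta F p N.+1 t f ** g) x0 = (-1) ^+ e * coef (f ** Delta F p N.+1 t g) x0.
  rewrite !DeltaE mul_suml mul_sumr !coef_sum mulr_sumr; apply: eq_big_nat => i iN.
  have ir : i \in rH by rewrite mem_rH; lia.
  have mi : mu i = false by rewrite /Defs.mu; lia.
  rewrite (int_parts _ _ (hom_partial (pr i) hf)) mi (int_parts _ _ hf) mu_pr_H // mi.
  rewrite (partialC (pr i) i) mi andbF /= expr0 scale1r; ring.
have -> : coef (Euler F p N.+1 t (pf tau f) ** g) x0 = (-1) ^+ e * coef (f ** Euler F p N.+1 t (pf tau g)) x0.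
  have := int_Euler (pf tau f ** g); rewrite (superderM g Euler_der htau) expr0 scale1r coefD => /eqP.
  rewrite addr_eq0 => /eqP->; rewrite (int_parts _ _ hf) mu_tau partial_tau_Euler; ring.
rewrite (int_parts _ _ hf) mu_tau; ring.
Qed.

Lemma int_Dop2 e f g : hom e f -> coef (Dop 1 f ** Dop 1 g) x0 = 0.
Proof.
move=> hf; rewrite (int_Dop _ _ hf) (_ : 1 = -1 + 2); last by ring.
by rewrite opprD -[-1 + 2]/(_ + _) (_ : - -1 - 2 = -1) ?Dop_Dop ?mulf0 ?dcoef0 ?mulr0 //; ring.
Qed.

End Integral.

End KO.

(** * The special odd contact superalgebra SKO *)

Section MonProduct.

Variables (F : fieldType) (p m n : nat) (t : 'I_m -> nat).
Notation O := (dpsa F p n t).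
Notation mon := (@mon F p m n t).
Implicit Types (a b : {ffun 'I_(m + n) -> nat}) (i j : 'I_(m + n)).

Lemma lowE i j a : low i a j = (a j - (j == i))%N. Proof. exact: ffunE. Qed.
Lemma upE i j a : up i a j = (a j + (j == i))%N. Proof. exact: ffunE. Qed.
Lemma addxE a b i : addx a b i = (a i + b i)%N. Proof. exact: ffunE. Qed.

Lemma var_partial_mon i a : bounded p t a ->
  dp_mul (var F p n t i.+1) (partial_fun i.+1 (mon a)) = (a i)%:R *: mon a.
Proof.
move=> /forallP/(_ i) ba; rewrite varE partial_mon (ltn_eqF ba) andbT.
case: posnP => ai; first by rewrite ai mul0r scale0r mulf0 scale0r.
rewrite mulZr mul_mon -/(addx _ _) scalerA.
have -> : addx (unitx i) (low i a) = a.
  by apply/ffunP => j; rewrite addxE lowE ffunE; case: eqP => [->|_]; rewrite ?subn0 // subnKC.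
congr (_ *: _); rewrite sgn_unitl sgnk_low_ge // (bin_mulE _ i) lowE eqxx ffunE eqxx.
rewrite subnKC // bin1 /binx big1 => [|j /negPf ji]; last by rewrite ffunE ji bin0.
have [mi|mi] := boolP (mu m i.+1); last by rewrite sgnk_even //= !expr0; ring.
by rewrite /=; sign_ring.
Qed.

Lemma mul_mon_disj a b : (forall i, a i = 0%N \/ b i = 0%N) ->
  dp_mul (mon a) (mon b) = (-1) ^+ sgn a b *: mon (addx a b).
Proof.
move=> H; rewrite mul_mon -/(addx _ _) /bin_mul big1 ?mulr1 // => i _.
by case: (H i) => ->; rewrite ?bin0 // addn0 binn.
Qed.

End MonProduct.

Opaque D_KO Dop.

Section SKO.

Variables (F : fieldType) (p N : nat) (t : 'I_N -> nat).
Hypothesis charFp : p \in [pchar F].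
Hypothesis two : (2 : F) != 0.
Hypothesis three : (3 : F) != 0.
Hypothesis N2 : N%:R = 2 :> F.
Hypothesis N_gt1 : (1 < N)%N.
Hypothesis bnd_gt2 : forall i : 'I_N, (2 < p ^ t i)%N.
Notation O := (dpsa F p N.+1 t).
Notation X := (monomial p N.+1 t).
Notation mon := (@mon F p N N.+1 t).
Notation pf := (@partial_fun F p N N.+1 t).
Notation var := (var F p N.+1 t).
Notation one := (one F p N.+1 t).
Notation partial := (partial F p N.+1 t).
Notation DKO := (@D_KO F p N N.+1 t).
Notation Dop := (@Dop F p N t).
Notation "f ** g" := (dp_mul f g) (at level 40, left associativity).
Notation pard := (parity_proj F p N.+1 t).
Notation bnd := (@expo_bound p N N.+1 t).
Notation J := ('I_(N + N.+1)).
Implicit Types (f g h w : O) (d e : bool) (k l : J) (i j : 'I_N) (q : F) (a b : {ffun J -> nat}) (x y : X).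

(** The three kinds of indices: of x_i, of its odd partner xi_i = x_(i'), and of the extra odd
    variable tau. *)
Definition ev i : J := lshift N.+1 i.
Definition od i : J := rshift N (widen_ord (leqnSn N) i).
Definition ta : J := rshift N ord_max.

Lemma ev_od i j : (ev i == od j) = false. Proof. by rewrite -val_eqE /=; have := ltn_ord i; lia. Qed.
Lemma od_ev i j : (od i == ev j) = false. Proof. by rewrite eq_sym ev_od. Qed.
Lemma ev_ta i : (ev i == ta) = false. Proof. by rewrite -val_eqE /=; have := ltn_ord i; lia. Qed.
Lemma ta_ev i : (ta == ev i) = false. Proof. by rewrite eq_sym ev_ta. Qed.
Lemma od_ta i : (od i == ta) = false. Proof. by rewrite -val_eqE /=; have := ltn_ord i; lia. Qed.
Lemma ta_od i : (ta == od i) = false. Proof. by rewrite eq_sym od_ta. Qed.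
Lemma ev_ev i j : (ev i == ev j) = (i == j). Proof. by rewrite -!val_eqE. Qed.
Lemma od_od i j : (od i == od j) = (i == j). Proof. by rewrite -!val_eqE /= eqn_add2l. Qed.
Definition eqJ := (ev_od, od_ev, ev_ta, ta_ev, od_ta, ta_od, ev_ev, od_od, eqxx).

Variant J_spec : J -> Type := JEv i : J_spec (ev i) | JOd i : J_spec (od i) | JTa : J_spec ta.

Lemma JP k : J_spec k.
Proof.
rewrite -(splitK k); case: (split k) => [i|i] /=; first exact: JEv.
case: (unliftP ord_max i) => [j ->|->]; last exact: JTa.
have -> : lift ord_max j = widen_ord (leqnSn N) j by apply/val_inj; rewrite /= /bump leqNgt ltn_ord.
exact: JOd.
Qed.

Lemma bnd_ev i : bnd (ev i) = (p ^ t i)%N.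
Proof. by rewrite /expo_bound -[ev i]/(unsplit (inl i)) unsplitK. Qed.
Lemma bnd_od i : bnd (od i) = 2%N.
Proof. by rewrite /expo_bound -[od i]/(unsplit (inr _)) unsplitK. Qed.
Lemma bnd_ta : bnd ta = 2%N.
Proof. by rewrite /expo_bound -[ta]/(unsplit (inr _)) unsplitK. Qed.
Definition bndE := (bnd_ev, bnd_od, bnd_ta).

Lemma bnd1 k : (1 < bnd k)%N.
Proof. by case: (JP k) => [i|i|]; rewrite bndE // ltnW. Qed.

Lemma mu_ev i : mu N (ev i).+1 = false. Proof. by rewrite /mu /= ltnS leqNgt ltn_ord. Qed.
Lemma mu_od i : mu N (od i).+1. Proof. by rewrite /mu /= ltnS leq_addr. Qed.
Lemma mu_ta : mu N ta.+1. Proof. by rewrite /mu /= ltnS leq_addr. Qed.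

(** Removal of x_i xi_i, which is the effect of d_i d_(i') on exponents; [up2] is the reverse
    step. *)
Definition dn i a := low (ev i) (low (od i) a).
Definition up2 i a := up (ev i) (up (od i) a).
(** The eigenvalue of the Euler field, in which tau does not count. *)
Definition deg a : nat := (\sum_i (a (ev i) + a (od i)))%N.

Lemma prime_ev i : prime_H N i.+1 = (od i).+1.
Proof. by rewrite /prime_H ltn_ord /= addnC addnS. Qed.

Lemma Euler_mon a : bounded p t a -> Euler F p N.+1 t (mon a) = (deg a)%:R *: mon a.
Proof.
move=> ba; rewrite EulerE big_rH big_add1 big_mkord /= /deg natr_sum scaler_suml; apply: eq_bigr => i _.
rewrite prime_ev (var_partial_mon F (od i)) // -[i.+1]/((ev i).+1) (var_partial_mon F (ev i)) //.
by rewrite natrD scalerDl.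
Qed.

Lemma Dop_mon q a : bounded p t a -> Dop q (mon a) =
  \sum_i (((0 < a (ev i)) && (0 < a (od i)))%N%:R * (-1) ^+ sgnk (od i).+1 a) *: mon (dn i a)
  + ((0 < a ta)%N%:R * (-1) ^+ sgnk ta.+1 a * ((deg (low ta a))%:R - q)) *: mon (low ta a).
Proof.
move=> ba; have ba' k : (a k == bnd k) = false by rewrite ltn_eqF ?(forallP ba).
rewrite DopE DeltaE big_add1 big_mkord /= -addrA; congr (_ + _).
  apply: eq_bigr => i _; rewrite prime_ev partial_mon ba' andbT linearZ /=.
  rewrite -[i.+1]/((ev i).+1) partial_mon lowE eqJ subn0 ba' andbT sgnk_even ?mu_ev //.
  rewrite expr0 mulr1 scalerA; congr (_ *: _).
  by case: (0 < a (ev i))%N; case: (0 < a (od i))%N => /=; ring.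
have -> : N.*2.+1 = ta.+1 by rewrite /= -addnn.
rewrite partial_mon ba' andbT linearZ /= Euler_mon; last first.
  apply/forallP => k; apply: leq_ltn_trans (forallP ba k); rewrite lowE leq_subr //.
by rewrite !scalerA -scalerBl; congr (_ *: _); ring.
Qed.

Definition x_top : X := [ffun k => Ordinal (etrans (congr1 (leq^~ (bnd k)) (prednK (ltnW (bnd1 k)))) (leqnn (bnd k)))].

Lemma expo_x_top : expo x_top = topm p N.+1 t.
Proof. by apply/ffunP => k; rewrite !ffunE. Qed.

Definition topc f : F^o := coef f x_top.
Fact topc_linear : linear topc.
Proof. by move=> s f g; rewrite /topc coef_linE. Qed.
HB.instance Definition _ := GRing.isLinear.Build F O F^o _ topc topc_linear.

Definition top_coef0 : {vspace O} := lker (linfun topc).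

Lemma mem_top_coef0 f : (f \in top_coef0) = (coef f x_top == 0).
Proof. by rewrite memv_ker lfunE. Qed.

Definition im_Dop : {vspace O} := (Dop 1 @: top_coef0)%VS.

Lemma mem_im_Dop f : coef f x_top = 0 -> Dop 1 f \in im_Dop.
Proof. by move=> f0; apply: memv_img; rewrite mem_top_coef0 f0. Qed.

Definition DKO_lin := linfun DKO.
Definition DKO_im := (DKO_lin @: im_Dop)%VS.

Lemma DKO_linE f : DKO_lin f = DKO f. Proof. exact: lfunE. Qed.

Variable lambda : F.
Hypothesis Nlambda : N%:R * lambda = -1.

Notation SKO'' := (Lie_SKO'' p lambda t).
Notation SKO := (Lie_SKO p lambda t).

Lemma Dop_m1_1 f : Dop (-1) (Dop 1 f) = 0.
Proof. by have := Dop_Dop charFp two bnd1 (-1) f; rewrite (_ : -1 + 2 = 1) //; ring. Qed.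

Lemma ker_divP f : (f \in lker (linfun (@div_KO F p N N.+1 t lambda))) = (Dop (-1) f == 0).
Proof.
rewrite memv_ker lfunE -Nlambda; apply/eqP/eqP => H; exact/(div_KO_eq0 two lambda f).
Qed.

Lemma bracket_DKO_lin e e' f g : hom e f -> hom e' g -> Dop (-1) f = 0 -> Dop (-1) g = 0 ->
  bracket pard (DKO_lin f) (DKO_lin g) = DKO_lin ((-1) ^+ e *: Dop 1 (f ** g)).
Proof.
move=> hf hg f0 g0; rewrite !DKO_linE (D_KO_bracket charFp two bnd1 hf hg f0 g0).
by rewrite (_ : -1 + 2 = 1) //; ring.
Qed.

Lemma SKO'_sub : (derived pard SKO'' <= DKO_lin @: limg (Dop 1))%VS.
Proof.
rewrite /Lie_SKO''; apply: derived_sub => [e f|e e' f g hf hg].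
  by rewrite !ker_divP -[e]negbK -(hpart_Dop two) => /eqP->; rewrite linear0.
rewrite !ker_divP => /eqP f0 /eqP g0; rewrite (bracket_DKO_lin hf hg f0 g0); apply: memv_img.
by apply: memvZ; apply: memv_img; apply: memvf.
Qed.

Lemma derivedS (L L' : {vspace 'End(O)}) : (L <= L')%VS -> (derived pard L <= derived pard L')%VS.
Proof.
move=> LL'; apply/span_subvP => _ /allpairsP[[D E] /= [/vbasis_mem DL /vbasis_mem EL ->]].
by apply: mem_derived; apply: (subvP LL').
Qed.

Lemma SKO_sub : (SKO <= DKO_im)%VS.
Proof.
apply: subv_trans (derivedS SKO'_sub) _; apply: derived_sub => [e f|e e' f g hf hg].
  by case/memv_imgP => h _ ->; rewrite (hpart_Dop two) memv_img // memvf.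
move=> fI gI.
have f0 : Dop (-1) f = 0 by case/memv_imgP: fI => h _ ->; apply: Dop_m1_1.
have g0 : Dop (-1) g = 0 by case/memv_imgP: gI => h _ ->; apply: Dop_m1_1.
rewrite (bracket_DKO_lin hf hg f0 g0); apply: memv_img; apply: memvZ; apply: mem_im_Dop.
case/memv_imgP: fI => h _ fh; case/memv_imgP: gI => h' _ gh'.
have ff : f = Dop 1 (hpart (~~ e) h) by rewrite -(hpart_Dop two) -fh.
rewrite ff gh'; exact: (int_Dop2 charFp two bnd1 expo_x_top _ (hom_hpart _ _)).
Qed.

(** * Perfectness of [DKO_im]: products of elements of [im_Dop] reach every monomial but the top
    one *)

Definition in_derived h := DKO (Dop 1 h) \in derived pard DKO_im.

Lemma in_derivedM e e' f g : hom e f -> hom e' g -> f \in im_Dop -> g \in im_Dop -> in_derived (f ** g).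
Proof.
move=> hf hg fU gU.
have f0 : Dop (-1) f = 0 by case/memv_imgP: fU => h _ ->; apply: Dop_m1_1.
have g0 : Dop (-1) g = 0 by case/memv_imgP: gU => h _ ->; apply: Dop_m1_1.
have := memvZ ((-1) ^+ e) (mem_derived pard (memv_img DKO_lin fU) (memv_img DKO_lin gU)).
by rewrite (bracket_DKO_lin hf hg f0 g0) linearZ /= scalerA -signr_addb addbb scale1r DKO_linE.
Qed.

Lemma in_derivedD f g : in_derived f -> in_derived g -> in_derived (f + g).
Proof. by rewrite /in_derived !linearD; exact: rpredD. Qed.
Lemma in_derivedZ (s : F) f : in_derived f -> in_derived (s *: f).
Proof. by rewrite /in_derived !linearZ; exact: memvZ. Qed.
Lemma in_derived0 : in_derived 0.
Proof. by rewrite /in_derived !linear0 mem0v. Qed.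

Lemma in_derived_def h : in_derived h = (DKO (Dop 1 h) \in derived pard DKO_im). Proof. by []. Qed.

Opaque in_derived.

(** No product x_i xi_i divides the monomial, so Delta kills it. *)
Definition thin a := [forall i, (a (od i) == 0%N) || (a (ev i) == 0%N)].

Lemma bounded_up2 i a : bounded p t a -> ((a (ev i)).+1 < p ^ t i)%N -> a (od i) = 0%N ->
  bounded p t (up2 i a).
Proof.
move=> /forallP ba H u0; apply/forallP => k; rewrite !upE; case: (JP k) => [j|j|]; rewrite !eqJ ?addn0 //.
  by case: eqP => [->|_]; rewrite ?addn0 // addn1 bnd_ev.
by case: eqP => [->|_]; rewrite ?addn0 // u0 bnd_od.
Qed.

Lemma dn_up2 i a : dn i (up2 i a) = a.
Proof.
apply/ffunP => k; rewrite /dn /up2 !(lowE, upE); case: (JP k) => [j|j|]; rewrite !eqJ ?addn0 ?subn0 //.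
all: by case: (j == i) => /=; lia.
Qed.

Lemma up2_topm i j a : a (od j) = 0%N -> j != i -> up2 i a != topm p N.+1 t.
Proof.
move=> u0 ji; apply/eqP => /ffunP/(_ (od j)); rewrite !upE u0 ffunE bndE !eqJ (negPf ji) //.
Qed.

Lemma topm_ev i : topm p N.+1 t (ev i) = (p ^ t i).-1. Proof. by rewrite ffunE bndE. Qed.
Lemma topm_od i : topm p N.+1 t (od i) = 1%N. Proof. by rewrite ffunE bndE. Qed.
Lemma topm_ta : topm p N.+1 t ta = 1%N. Proof. by rewrite ffunE bndE. Qed.

Lemma im_Dop_mon a : a != topm p N.+1 t -> Dop 1 (mon a) \in im_Dop.
Proof.
move=> at_; apply: mem_im_Dop; rewrite coef_mon expo_x_top; case: eqP => // E; by rewrite E eqxx in at_.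
Qed.

(** As [a] is thin, the pair inserted at i is the only one that Delta can remove; all else is a term
    from which tau has been removed. *)
Lemma Dop_up2 q i a : thin a -> bounded p t (up2 i a) ->
  exists s : F, exists s' : F, s != 0 /\
  Dop q (mon (up2 i a)) = s *: mon a + (0 < a ta)%N%:R *: (s' *: mon (low ta (up2 i a))).
Proof.
move=> th bu; rewrite Dop_mon // (bigD1 i) //= dn_up2.
have ai : ((0 < up2 i a (ev i)) && (0 < up2 i a (od i)))%N by rewrite !upE !eqJ; lia.
have at_ : up2 i a ta = a ta by rewrite !upE !eqJ !addn0.
rewrite ai mul1r at_ big1 ?addr0.
  exists ((-1) ^+ sgnk (od i).+1 (up2 i a)).
  exists ((-1) ^+ sgnk ta.+1 (up2 i a) * ((deg (low ta (up2 i a)))%:R - q)).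
  by rewrite signr_eq0 scalerA mulrA.
move=> j ji; rewrite !upE !eqJ (negPf ji) !addn0.
by case/orP: (forallP th j) => /eqP ->; rewrite ?andbF mul0r scale0r.
Qed.

Lemma mon_im_Dop i a : thin a -> a ta = 0%N -> bounded p t a -> ((a (ev i)).+1 < p ^ t i)%N ->
  a (od i) = 0%N -> mon a \in im_Dop.
Proof.
move=> th a0 ba ai u0; have bu := bounded_up2 ba ai u0.
have [s [s' [s0 E]]] := Dop_up2 1 th bu.
rewrite a0 scale0r addr0 in E.
rewrite -[mon a]scale1r -(mulVf s0) -scalerA -E; apply/memvZ/im_Dop_mon.
by apply/eqP => /ffunP/(_ ta); rewrite topm_ta !upE !eqJ a0.
Qed.

(** Applied to the monomial with tau inserted, [Dop 1] returns the monomial itself times a sign and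
    (degree - 1). *)
Lemma mon_im_Dop_deg a : thin a -> a ta = 0%N -> bounded p t a -> (deg a)%:R != 1 :> F ->
  up ta a != topm p N.+1 t -> mon a \in im_Dop.
Proof.
move=> th a0 ba da nt.
have bu : bounded p t (up ta a).
  apply/forallP => k; rewrite upE; case: eqP => [->|_]; first by rewrite a0 bnd_ta.
  by rewrite addn0 (forallP ba).
have := Dop_mon 1 bu; rewrite big1 ?add0r; last first.
  move=> j _; rewrite !upE !eqJ !addn0.
  by case/orP: (forallP th j) => /eqP ->; rewrite ?andbF mul0r scale0r.
rewrite upK upE eqxx addn1 /= mul1r => E.
have s0 : (-1) ^+ sgnk ta.+1 (up ta a) * ((deg a)%:R - 1) != 0 :> F.
  by rewrite mulf_neq0 ?signr_eq0 ?subr_eq0.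
by rewrite -[mon a]scale1r -(mulVf s0) -scalerA -E; apply/memvZ/im_Dop_mon.
Qed.

(** Apart from tau a monomial is, up to sign, the product of its parts [evp] in the x_i and [odp] in
    the xi_i. Both are thin, which brings them into [im_Dop]. *)
Definition evp a : {ffun J -> nat} := [ffun k : J => if mu N k.+1 then 0%N else a k].
Definition odp a : {ffun J -> nat} := [ffun k : J => if mu N k.+1 && (k != ta) then a k else 0%N].

Lemma evpE a : (forall i, evp a (ev i) = a (ev i)) * (forall i, evp a (od i) = 0%N) * (evp a ta = 0%N).
Proof. by split; [split=> i|]; rewrite ffunE ?mu_ev ?mu_od ?mu_ta. Qed.
Lemma odpE a : (forall i, odp a (ev i) = 0%N) * (forall i, odp a (od i) = a (od i)) * (odp a ta = 0%N).
Proof. by split; [split=> i|]; rewrite ffunE ?mu_ev ?mu_od ?mu_ta ?eqJ. Qed.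

Lemma bounded_sub a b : bounded p t a -> (forall k, (b k <= a k)%N) -> bounded p t b.
Proof. by move=> /forallP ba H; apply/forallP => k; apply: leq_ltn_trans (H k) (ba k). Qed.

(** If some x_i is not at its top exponent, x_i xi_i can be inserted. Otherwise the degree is -N =
    -2 mod p, different from 1 since 3 != 0, and tau is inserted instead. *)
Lemma evp_im_Dop a : bounded p t a -> mon (evp a) \in im_Dop.
Proof.
move=> ba; have be : bounded p t (evp a).
  by apply: (bounded_sub ba) => k; rewrite ffunE; case: ifP.
have th : thin (evp a) by apply/forallP => i; rewrite evpE.
case: (pickP (fun i => (a (ev i)).+1 < p ^ t i)%N) => [i ai|nai].
  by apply: (mon_im_Dop (i := i) th _ be); rewrite !evpE.
have nt : up ta (evp a) != topm p N.+1 t.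
  by apply/eqP => /ffunP/(_ (od (Ordinal (ltnW N_gt1)))); rewrite topm_od upE evpE eqJ.
apply: (mon_im_Dop_deg th _ be _ nt); first by rewrite evpE.
have -> : (deg (evp a))%:R = - 2 :> F.
  rewrite /deg natr_sum (eq_bigr (fun=> -1)) => [|i _].
    by rewrite sumr_const card_ord mulNrn N2.
  rewrite !evpE addn0; have := nai i; have := forallP ba (ev i); rewrite bnd_ev => h1 h2.
  have t0 : (0 < t i)%N by have := bnd_gt2 i; case: (t i).
  have : (a (ev i)).+1%:R = 0 :> F.
    rewrite (_ : (a (ev i)).+1 = p ^ t i)%N; last by apply/eqP; rewrite eqn_leq h1 leqNgt h2.
    by rewrite natrX (pcharf0 charFp) expr0n; case: (t i) t0.
  by rewrite -addn1 natrD => /eqP; rewrite addr_eq0 => /eqP.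
rewrite eq_sym -subr_eq0 opprK (_ : 1 + 2 = 3 :> F) //; ring.
Qed.

(** If some xi_i is missing, x_i xi_i can be inserted. Otherwise the degree is N = 2 mod p,
    different from 1, and tau is inserted instead. *)
Lemma odp_im_Dop a : bounded p t a -> mon (odp a) \in im_Dop.
Proof.
move=> ba; have be : bounded p t (odp a).
  by apply: (bounded_sub ba) => k; rewrite ffunE; case: ifP.
have th : thin (odp a) by apply/forallP => i; rewrite !odpE eqxx orbT.
case: (pickP (fun i => a (od i) == 0%N)) => [i /eqP ai|nai].
  by apply: (mon_im_Dop (i := i) th _ be); rewrite !odpE // ltnW // bnd_gt2.
have nt : up ta (odp a) != topm p N.+1 t.
  apply/eqP => /ffunP/(_ (ev (Ordinal (ltnW N_gt1)))); rewrite topm_ev upE odpE eqJ.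
  by move=> H; have := bnd_gt2 (Ordinal (ltnW N_gt1)); case: (p ^ _)%N H => [|[]].
apply: (mon_im_Dop_deg th _ be _ nt); first by rewrite odpE.
have -> : (deg (odp a))%:R = 2 :> F.
  rewrite /deg natr_sum (eq_bigr (fun=> 1)) => [|i _].
    by rewrite sumr_const card_ord N2.
  rewrite !odpE add0n; have := nai i; have := forallP ba (od i); rewrite bnd_od.
  by case: (a (od i)) => [|[]].
by rewrite -subr_eq0 (_ : 2 - 1 = 1 :> F) ?oner_eq0 //; ring.
Qed.

Lemma ev_odp a : a ta = 0%N -> addx (evp a) (odp a) = a.
Proof.
move=> a0; apply/ffunP => k; rewrite addxE; case: (JP k) => [i|i|]; by rewrite ?(evpE, odpE, a0) // addn0.
Qed.

Lemma in_derived_tau0 a : a ta = 0%N -> in_derived (mon a).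
Proof.
move=> a0; case: (boolP (bounded p t a)) => [ba|/mon_out->]; last exact: in_derived0.
have := in_derivedM (hom_mon _ _ _ _) (hom_mon _ _ _ _) (evp_im_Dop ba) (odp_im_Dop ba).
rewrite mul_mon_disj => [|k]; last first.
  by case: (JP k) => [i|i|]; rewrite !(evpE, odpE); [right|left|left].
move/(in_derivedZ ((-1) ^+ sgn (evp a) (odp a))).
by rewrite scalerA -exprD addnn -mul2n exprM sqrrN !expr1n scale1r ev_odp.
Qed.

(** The product of x^b and [Dop 1] (x_i xi_i x^c) is a nonzero multiple of x^(b + c) plus a multiple
    of a monomial without tau, which [in_derived_tau0] covers. *)
Lemma in_derived_tau1 i b c : thin c -> ((c (ev i)).+1 < p ^ t i)%N -> c (od i) = 0%N -> bounded p t c ->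
  mon b \in im_Dop -> b ta = 0%N -> (forall k, b k = 0%N \/ c k = 0%N) -> c ta = 1%N -> up2 i c != topm p N.+1 t ->
  in_derived (mon (addx b c)).
Proof.
move=> thc ci u0 bc bU b0 dis c1 nt.
have bu := bounded_up2 bc ci u0.
have [s [s' [s0 E]]] := Dop_up2 1 thc bu.
have hD : hom (~~ parx (up2 i c)) (Dop 1 (mon (up2 i c))) by apply: (homDop two); apply: hom_mon.
have := in_derivedM (hom_mon _ _ _ _) hD bU (im_Dop_mon nt).
have dm := @mul_mon_disj F p N N.+1 t b c dis.
rewrite E c1 scale1r mulDr !mulZr dm => H.
have H2 : in_derived (s' *: (mon b ** mon (low ta (up2 i c)))).
  rewrite mul_mon; apply/in_derivedZ/in_derivedZ/in_derived_tau0.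
  by rewrite ffunE b0 lowE !upE !eqJ c1.
have := in_derivedD H (in_derivedZ (-1) H2); rewrite scaleN1r addrK scalerA => H3.
have := in_derivedZ (s * (-1) ^+ sgn b c)^-1 H3.
by rewrite scalerA mulVf ?scale1r // mulf_neq0 ?signr_eq0.
Qed.

(** In the presence of tau, the factor carrying tau must admit the insertion of x_i xi_i. If some
    xi_i is missing, tau goes with the odd part; if none is, it goes with the even part, and some
    x_i is below its top exponent because the monomial is not the top one. *)
Lemma in_derived_mon a : bounded p t a -> a != topm p N.+1 t -> in_derived (mon a).
Proof.
move=> ba at_; case: (posnP (a ta)) => [|a1]; first exact: in_derived_tau0.
have {}a1 : a ta = 1%N by have := forallP ba ta; rewrite bnd_ta; lia.
case: (pickP (fun i => a (od i) == 0%N)) => [i /eqP ai|nai].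
  have -> : a = addx (evp a) (up ta (odp a)).
    by apply/ffunP => k; rewrite addxE upE; case: (JP k) => [j|j|];
      rewrite !(evpE, odpE) !eqJ ?addn0 ?a1.
  apply: (in_derived_tau1 (i := i)); rewrite ?evpE ?upE ?odpE ?eqJ ?addn0 ?ai //.
  - by apply/forallP => j; rewrite !upE !eqJ !odpE eqxx orbT.
  - by rewrite ltnW ?bnd_gt2.
  - apply: (bounded_sub ba) => k; rewrite upE; case: (JP k) => [j|j|]; rewrite odpE !eqJ ?addn0 ?a1 //.
  - exact: evp_im_Dop.
  - by move=> k; rewrite upE; case: (JP k) => [j|j|]; rewrite !(evpE, odpE) !eqJ; auto.
  - apply/eqP => /ffunP/(_ (ev i)); rewrite topm_ev !upE odpE !eqJ => H.
    by have := bnd_gt2 i; case: (p ^ _)%N H => [|[|[]]].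
have u1 i : a (od i) = 1%N by have := nai i; have := forallP ba (od i); rewrite bnd_od; case: (a (od i)) => [|[]].
case: (pickP (fun i => (a (ev i)).+1 < p ^ t i)%N) => [i ai|full]; last first.
  case/eqP: at_; apply/ffunP => k; case: (JP k) => [i|i|]; rewrite ?topm_ev ?topm_od ?topm_ta //.
  have := full i; have := forallP ba (ev i); rewrite bnd_ev; move: (a _) (p ^ _)%N => u v; lia.
have -> : a = addx (odp a) (up ta (evp a)).
  by apply/ffunP => k; rewrite addxE upE; case: (JP k) => [j|j|];
    rewrite !(evpE, odpE) !eqJ ?addn0 ?a1.
apply: (in_derived_tau1 (i := i)); rewrite ?odpE ?upE ?evpE ?eqJ ?addn0 //.
- by apply/forallP => j; rewrite !upE !eqJ !evpE.
- apply: (bounded_sub ba) => k; rewrite upE; case: (JP k) => [j|j|]; rewrite evpE !eqJ ?addn0 ?a1 //.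
- exact: odp_im_Dop.
- by move=> k; rewrite upE; case: (JP k) => [j|j|]; rewrite !(evpE, odpE) !eqJ; auto.
(* A second index exists since N > 1; its xi_j is absent, so inserting x_i xi_i does not produce the
   top monomial. *)
- have [j ji] : exists j, j != i.
    case: (eqVneq i (Ordinal (ltnW N_gt1))) => [->|]; last by rewrite eq_sym; exists (Ordinal (ltnW N_gt1)).
    by exists (Ordinal N_gt1).
  by apply: (up2_topm (j := j)); rewrite ?upE ?evpE ?eqJ.
Qed.

Lemma DKO_im_derived : (DKO_im <= derived pard DKO_im)%VS.
Proof.
apply/subvP => _ /memv_imgP[_ /memv_imgP[g gG ->] ->]; rewrite DKO_linE.
rewrite (mon_expand g) linear_sum linear_sum; apply: memv_suml => x _.
rewrite !linearZ /=; case: (eqVneq x x_top) => [->|xx0].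
  by move: gG; rewrite mem_top_coef0 => /eqP->; rewrite scale0r mem0v.
apply: memvZ; rewrite -in_derived_def; apply: in_derived_mon; first exact: expo_bounded.
by rewrite -expo_x_top (inj_eq (@expo_inj _ _ _ _)).
Qed.

Lemma DKO_im_SKO'' : (DKO_im <= SKO'')%VS.
Proof.
apply: limgS; apply/subvP => _ /memv_imgP[g _ ->].
by rewrite ker_divP Dop_m1_1.
Qed.

(** [DKO_im] lies in SKO'' and in its own derived algebra, hence survives both derivations;
    [SKO_sub] is the other inclusion. *)
Lemma SKO_DKO_im : SKO = DKO_im.
Proof.
apply/eqP; rewrite eqEsubv SKO_sub.
apply: subv_trans DKO_im_derived _; apply: derivedS.
by apply: subv_trans DKO_im_derived _; apply: derivedS; exact: DKO_im_SKO''.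
Qed.

(* Delta removes x_i xi_i, so an index i is frozen when the exponents of x_i and
   xi_i are (top, 0) or (0, 1).  If some index is free, then Dop 1 o Dop 3 = 0
   expresses, at the picked index j, the monomials without xi_j through those
   with xi_j.  If all indices are frozen, Dop 1 only acts through tau, by the
   scalar degree - 1. *)
Definition free i a := if a (od i) == 0%N then ((a (ev i)).+1 < p ^ t i)%N else (0 < a (ev i))%N.
Definition pick_free a := [pick i | free i a].
Definition inB a := if pick_free a is Some i then a (od i) == 1%N
  else (a ta == 1%N) && ((deg (low ta a))%:R != 1 :> F).
Definition SB : {set X} := [set x | inB (expo x) && (x != x_top)].
Definition vB x : 'End(O) := DKO (Dop 1 (mon (expo x))).

Lemma od_le1 i a : bounded p t a -> (a (od i) <= 1)%N.
Proof. by move=> /forallP/(_ (od i)); rewrite bnd_od. Qed.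
Lemma ta_le1 a : bounded p t a -> (a ta <= 1)%N.
Proof. by move=> /forallP/(_ ta); rewrite bnd_ta. Qed.

Lemma dn_ev i j a : dn j a (ev i) = (a (ev i) - (i == j))%N.
Proof. by rewrite !lowE !eqJ subn0. Qed.
Lemma dn_od i j a : dn j a (od i) = (a (od i) - (i == j))%N.
Proof. by rewrite !lowE !eqJ subn0. Qed.
Lemma dn_ta j a : dn j a ta = a ta.
Proof. by rewrite !lowE !eqJ !subn0. Qed.
Lemma up2_ev i j a : up2 j a (ev i) = (a (ev i) + (i == j))%N.
Proof. by rewrite !upE !eqJ addn0. Qed.
Lemma up2_od i j a : up2 j a (od i) = (a (od i) + (i == j))%N.
Proof. by rewrite !upE !eqJ addn0. Qed.
Lemma up2_ta j a : up2 j a ta = a ta.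
Proof. by rewrite !upE !eqJ !addn0. Qed.

Lemma up2_dn j a : (0 < a (ev j))%N -> (0 < a (od j))%N -> up2 j (dn j a) = a.
Proof.
move=> h1 h2; apply/ffunP => k; case: (JP k) => [i|i|]; rewrite ?(up2_ev, up2_od, up2_ta) ?(dn_ev, dn_od, dn_ta) //.
all: by case: eqP => [->|_]; rewrite ?subn0 ?addn0 ?subnK.
Qed.

Lemma bounded_dn j a : bounded p t a -> bounded p t (dn j a).
Proof.
move=> ba; apply: (bounded_sub ba) => k; rewrite !lowE; apply: leq_trans (leq_subr _ _) _; exact: leq_subr.
Qed.
Lemma bounded_low k a : bounded p t a -> bounded p t (low k a).
Proof. by move=> ba; apply: (bounded_sub ba) => l; rewrite lowE leq_subr. Qed.

(** An index is free when its exponents belong to a couple (e, 0), (e + 1, 1) exchanged by inserting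
    or removing x_j xi_j. Such a step therefore changes neither which indices are free nor the
    picked one. *)
Lemma pick_free_dn j a : bounded p t a -> (0 < a (ev j))%N -> (0 < a (od j))%N -> pick_free (dn j a) = pick_free a.
Proof.
move=> ba h1 h2; apply: eq_pick => i; rewrite /free dn_ev dn_od.
case: (eqVneq i j) => [->|_]; last by rewrite !subn0.
have a1 : a (od j) = 1%N by have := od_le1 j ba; lia.
rewrite a1 /= subn1 prednK // h1; have := forallP ba (ev j); by rewrite bnd_ev.
Qed.

Lemma pick_free_low_ta a : pick_free (low ta a) = pick_free a.
Proof. by apply: eq_pick => i; rewrite /free !lowE !eqJ !subn0. Qed.

Lemma pick_free_Some a j : pick_free a = Some j -> free j a.
Proof. by rewrite /pick_free; case: pickP => // i fi [<-]. Qed.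

Lemma pick_free_None a j : pick_free a = None -> free j a = false.
Proof. by rewrite /pick_free; case: pickP => // nf _; exact: nf. Qed.

Lemma free_high j a : (0 < a (od j))%N -> free j a = (0 < a (ev j))%N.
Proof. by rewrite /free lt0n => /negPf->. Qed.

(* A monomial of Dop 1 (x^b) that occurs in no Dop 1 (x^a) with inB a, a <> b. *)
Definition lo a := if pick_free a is Some j then dn j a else low ta a.

Section Independent.

Variables a a' : {ffun J -> nat}.
Hypotheses (ba : bounded p t a) (ba' : bounded p t a') (Ba : inB a) (Ba' : inB a').

Lemma inB_Some b j : inB b -> pick_free b = Some j -> b (od j) = 1%N /\ (0 < b (ev j))%N.
Proof.
move=> + pb; rewrite /inB pb => /eqP b1; split=> //.
by have := pick_free_Some pb; rewrite free_high ?b1.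
Qed.

(** Removing a pair keeps the picked index, so [a] and [a'] share it, say j, and contain xi_j by
    [inB]. As [lo a] lacks xi_j, the pair removed from [a'] is the one at j. *)
Lemma lo_dn i : (0 < a' (ev i))%N -> (0 < a' (od i))%N -> lo a = dn i a' -> pick_free a = Some i /\ a = a'.
Proof.
rewrite /lo => h1 h2; case pa : (pick_free a) => [j|] E; last first.
  have := pick_free_None i (etrans (esym (pick_free_dn ba' h1 h2)) (etrans (congr1 pick_free (esym E)) (etrans (pick_free_low_ta a) pa))).
  by rewrite free_high // h1.
have [a1 e1] := inB_Some Ba pa.
have pa' : pick_free a' = Some j.
  by rewrite -(pick_free_dn ba' h1 h2) -E pick_free_dn // a1.
have [a1' e1'] := inB_Some Ba' pa'.
have ij : j = i.
  have := congr1 (fun b : {ffun J -> nat} => b (od j)) E; rewrite /= !dn_od a1 a1' eqxx.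
  by case: eqP.
by rewrite ij in E a1 e1 *; split=> //; rewrite -(up2_dn e1 _) ?a1 // E up2_dn.
Qed.

Lemma lo_low : (0 < a' ta)%N -> lo a = low ta a' -> pick_free a = None /\ a = a'.
Proof.
rewrite /lo => h; case pa : (pick_free a) => [j|] E.
  have [a1 e1] := inB_Some Ba pa.
  have pa' : pick_free a' = Some j by rewrite -pick_free_low_ta -E pick_free_dn // a1.
  have [a1' _] := inB_Some Ba' pa'.
  have := congr1 (fun b : {ffun J -> nat} => b (od j)) E.
  by rewrite /= dn_od lowE !eqJ a1 a1'.
split=> //; have : inB a by [].
rewrite /inB pa => /andP[/eqP ta1 _].
by rewrite -(lowK (i := ta) (a := a)) ?ta1 // E lowK.
Qed.

End Independent.

Lemma coef_Dop_lo x y z : inB (expo x) -> inB (expo y) -> expo z = lo (expo y) ->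
  (coef (Dop 1 (mon (expo x))) z == 0) = (x != y).
Proof.
move=> Bx By Ez; set a := expo x; set b := expo y.
have [ba bb] := (expo_bounded x, expo_bounded y); rewrite -/a -/b in ba bb Bx By Ez.
have xy : (x == y) = (a == b) by rewrite (inj_eq (@expo_inj _ _ _ _)).
rewrite (Dop_mon 1 ba) coefD coef_sum coefZ coef_mon Ez.
have Ei i : coef ((((0 < a (ev i)) && (0 < a (od i)))%N%:R * (-1) ^+ sgnk (od i).+1 a) *: mon (dn i a)) z
   = if (pick_free b == Some i) && (a == b) then (-1) ^+ sgnk (od i).+1 a else 0.
  rewrite coefZ coef_mon Ez; case: ifP => [/andP[/eqP pb /eqP ab]|H].
    have [b1 e1] := inB_Some By pb.
    by rewrite ab e1 b1 /lo pb eqxx mul1r mulr1.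
  case: (boolP ((0 < a (ev i)) && (0 < a (od i)))%N) => [/andP[h1 h2]|_]; last by rewrite !mul0r.
  case: eqP => [E|_]; last by rewrite mulr0.
  by have [pb ab] := lo_dn bb ba By Bx h1 h2 E; rewrite pb ab !eqxx in H.
under eq_bigr do rewrite Ei.
have Et : ((0 < a ta)%N%:R * (-1) ^+ sgnk ta.+1 a * ((deg (low ta a))%:R - 1)) * (lo b == low ta a)%:R
   = if (pick_free b == None) && (a == b) then (-1) ^+ sgnk ta.+1 a * ((deg (low ta a))%:R - 1) else 0 :> F.
  case: ifP => [/andP[/eqP pb /eqP ab]|H].
    have := By; rewrite /inB pb => /andP[/eqP ta1 _].
    by rewrite ab ta1 /lo pb eqxx mul1r mulr1.
  case: posnP => [_|h]; first by rewrite !mul0r.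
  case: eqP => [E|_]; last by rewrite mulr0.
  by have [pb ab] := lo_low bb By Bx h E; rewrite pb ab !eqxx in H.
rewrite Et xy; case: (eqVneq a b) => [ab|_]; last first.
  by rewrite andbF big1 ?addr0 ?eqxx // => i _; rewrite andbF.
case pb : (pick_free b) => [j|] /=.
  rewrite (bigD1 j) //= eqxx big1 => [|i ij]; first by rewrite !addr0 signr_eq0.
  by case: eqP => // -[ji]; rewrite ji eqxx in ij.
rewrite big1 // add0r mulf_eq0 signr_eq0 subr_eq0 /=; apply/negbTE.
by have := By; rewrite /inB pb -ab => /andP[].
Qed.

Lemma bounded_lo a : bounded p t a -> bounded p t (lo a).
Proof. by move=> ba; rewrite /lo; case: (pick_free a) => [j|]; [exact: bounded_dn | exact: bounded_low]. Qed.

Definition spanB : {vspace 'End(O)} := <<[seq vB y | y <- enum SB]>>%VS.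

Lemma spanB_inB a : bounded p t a -> a != topm p N.+1 t -> inB a -> DKO (Dop 1 (mon a)) \in spanB.
Proof.
move=> /boundedP[x <-] nt Bx; apply: memv_span; apply/mapP; exists x => //.
by rewrite mem_enum inE Bx -(inj_eq (@expo_inj _ _ _ _)) expo_x_top.
Qed.

Lemma spanB_mon a : bounded p t a -> a != topm p N.+1 t -> DKO (Dop 1 (mon a)) \in spanB.
Proof.
move=> ba nt; case: (boolP (inB a)) => [|nB]; first exact: spanB_inB.
case pa : (pick_free a) => [j|]; last first.
  rewrite (Dop_mon 1 ba) big1 ?add0r => [|i _].
    move: nB; rewrite /inB pa negb_and negbK => /orP[ta0|/eqP->]; last first.
      by rewrite subrr mulr0 scale0r linear0 mem0v.
    rewrite (_ : (0 < a ta)%N = false) ?mul0r ?scale0r ?linear0 ?mem0v //.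
    by have := ta_le1 ba; case: (a ta) ta0 => [|[]].
  have := pick_free_None i pa; case: (posnP (a (od i))) => [_|h]; first by rewrite andbF mul0r scale0r.
  by rewrite free_high // => ->; rewrite mul0r scale0r.
have u0 : a (od j) = 0%N.
  by have := od_le1 j ba; move: nB; rewrite /inB pa; case: (a (od j)) => [|[]].
have aj : ((a (ev j)).+1 < p ^ t j)%N by have := pick_free_Some pa; rewrite /free u0.
have bu := bounded_up2 ba aj u0.
have hj : (0 < up2 j a (ev j))%N /\ (0 < up2 j a (od j))%N by rewrite up2_ev up2_od eqxx !addn1.
have pu : pick_free (up2 j a) = Some j by rewrite -(pick_free_dn bu hj.1 hj.2) dn_up2.
(* Dop 1 o Dop 3 = 0 is applied to x_j xi_j x^a. The summand i = j of Dop 3 gives back x^a; all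
   other terms still contain xi_j and keep j as picked index, so they satisfy [inB]. *)
have E := congr1 (fun f => DKO (Dop 1 f)) (Dop_mon (1 + 2) bu).
rewrite /= (Dop_Dop charFp two bnd1) linear0 (bigD1 j) //= dn_up2 hj.1 hj.2 !linearD !linearZ /= -addrA in E.
move/esym/eqP: E; rewrite addr_eq0 mul1r => /eqP E.
have s0 : (-1) ^+ sgnk (od j).+1 (up2 j a) != 0 :> F by rewrite signr_eq0.
suff H : (-1) ^+ sgnk (od j).+1 (up2 j a) *: DKO (Dop 1 (mon a)) \in spanB.
  by have := memvZ ((-1) ^+ sgnk (od j).+1 (up2 j a))^-1 H; rewrite scalerA mulVf // scale1r.
have bl := bounded_low ta bu.
have inu b : pick_free b = Some j -> (0 < b (od j))%N -> bounded p t b -> inB b.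
  by move=> pb h bb; rewrite /inB pb; have := od_le1 j bb; case: (b (od j)) h => [|[]].
rewrite E rpredN rpredD //.
  rewrite linear_sum linear_sum /=; apply: memv_suml => i ij; rewrite !linearZ /=.
  case: (boolP ((0 < up2 j a (ev i)) && (0 < up2 j a (od i)))%N) => [/andP[h1 h2]|_]; last by rewrite mul0r scale0r mem0v.
  apply/memvZ/spanB_inB; first exact: bounded_dn.
    apply/eqP => /ffunP/(_ (od i)); rewrite topm_od dn_od eqxx => H.
    by have := od_le1 i bu; move: H; case: (up2 j a (od i)) => [|[]].
  apply: inu; last exact: bounded_dn.
    by rewrite pick_free_dn.
  by rewrite dn_od eq_sym (negPf ij) subn0 hj.2.
apply/memvZ/spanB_inB => //.
  apply/eqP => /ffunP/(_ ta); rewrite topm_ta lowE eqxx => H.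
  by have := ta_le1 bu; move: H; case: (up2 j a ta) => [|[]].
by apply: inu => //; rewrite ?pick_free_low_ta // lowE eqJ subn0 hj.2.
Qed.

Lemma DKO_im_span : (DKO_im <= spanB)%VS.
Proof.
apply/subvP => _ /memv_imgP[_ /memv_imgP[g gG ->] ->]; rewrite DKO_linE.
rewrite (mon_expand g) linear_sum linear_sum; apply: memv_suml => x _.
rewrite !linearZ /=; case: (eqVneq x x_top) => [->|xx0].
  by move: gG; rewrite mem_top_coef0 => /eqP->; rewrite scale0r mem0v.
apply/memvZ/spanB_mon; first exact: expo_bounded.
by rewrite -expo_x_top (inj_eq (@expo_inj _ _ _ _)).
Qed.

Lemma SKO_basis : graded_basis pard SKO SB vB (fun x => parx (expo x)).
Proof.
rewrite SKO_DKO_im; split.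
- move=> x; rewrite inE => /andP[_ xx0]; rewrite /vB -DKO_linE; apply/memv_img/im_Dop_mon.
  by rewrite -expo_x_top (inj_eq (@expo_inj _ _ _ _)).
(* [Dop 1] and [D_KO] both reverse parity, so the field has the parity of its monomial. *)
- move=> x _; rewrite /vB; have hx := homDop two 1 (hom_mon F p t (expo x)).
  by rewrite (op_partE _ (pardeg_D_KO charFp two hx)) negbK eqxx.
- move=> w w0 y yS; have := yS; rewrite inE => /andP[By _].
  pose f : O := \sum_(x in SB) w x *: Dop 1 (mon (expo x)).
  have f0 : f = 0.
    apply: (D_KO_inj charFp two bnd1); rewrite linear_sum -[RHS]w0; apply: eq_bigr => x _.
    by rewrite linearZ.
  have [z Ez] := elimT (boundedP p t _) (bounded_lo (expo_bounded y)).
  have := congr1 (fun g => coef g z) f0; rewrite /= dcoef0 coef_sum (bigD1 y) //= coefZ.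
  rewrite big1 ?addr0 => [|x /andP[xS xy]]; last first.
    move: xS; rewrite inE => /andP[Bx _]; rewrite coefZ.
    by have /eqP-> : coef (Dop 1 (mon (expo x))) z == 0; rewrite ?mulr0 // (coef_Dop_lo Bx By Ez).
  by move/eqP; rewrite mulf_eq0 (coef_Dop_lo By By Ez) eqxx orbF => /eqP.
apply: leq_trans (dimvS DKO_im_span) _; apply: leq_trans (dim_span _) _.
by rewrite size_map -cardE.
Qed.

(** * Counting the basis of SKO by parity *)

Lemma parxE a : parx a = odd (\sum_i a (od i) + a ta).
Proof.
rewrite /parx big_mkcond big_split_ord /= big1 ?add0n => [|i _]; last by rewrite -[lshift _ _]/(ev i) mu_ev.
rewrite big_ord_recr /=; congr (odd (_ + _)); last by rewrite -[rshift _ _]/ta mu_ta.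
by apply: eq_bigr => i _; rewrite -[rshift _ _]/(od i) mu_od.
Qed.

(** [inB] without the condition on the degree: this set is counted by involutions, and the monomials
    lost to the condition form [critical]. *)
Definition selected a := if pick_free a is Some i then a (od i) == 1%N else a ta == 1%N.

Lemma card_inj_pred (f : X -> X) (P1 P2 : pred X) : injective f ->
  (forall x, P1 (f x) = P2 x) -> #|[set x | P1 x]| = #|[set x | P2 x]|.
Proof.
move=> fi H; rewrite -(card_preimset _ fi); apply: eq_card => x; by rewrite !inE H.
Qed.

Section Involution.

Variable phi : {ffun J -> nat} -> {ffun J -> nat}.
Hypothesis phi_b : forall a, bounded p t a -> bounded p t (phi a).
Hypothesis phiK : forall a, bounded p t a -> phi (phi a) = a.

Definition invx x := mkx x (phi (expo x)).

Lemma expo_invx x : expo (invx x) = phi (expo x).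
Proof. by rewrite mkxE // phi_b ?expo_bounded. Qed.

Lemma invx_inj : injective invx.
Proof.
move=> x y /(congr1 (@expo _ _ _ _)); rewrite !expo_invx => /(congr1 phi).
by rewrite !phiK ?expo_bounded // => /expo_inj.
Qed.

Lemma card_phi (P1 P2 : pred {ffun J -> nat}) : (forall a, bounded p t a -> P1 (phi a) = P2 a) ->
  #|[set x : X | P1 (expo x)]| = #|[set x : X | P2 (expo x)]|.
Proof.
move=> H; apply: (card_inj_pred (f := invx) (P1 := fun x => P1 (expo x)) (P2 := fun x => P2 (expo x)) invx_inj) => x.
by rewrite expo_invx H ?expo_bounded.
Qed.

End Involution.

Lemma flip_ta_b a : bounded p t a -> bounded p t (flip ta a).
Proof. by move=> /boundedP[x <-]; apply: flip_bounded mu_ta. Qed.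

Lemma flip_ta_K a : bounded p t a -> flip ta (flip ta a) = a.
Proof. by move=> /boundedP[x <-]; apply: flipK mu_ta. Qed.

Lemma flip_ta_od i a : flip ta a (od i) = a (od i). Proof. by rewrite flipE eqJ. Qed.
Lemma flip_ta_ev i a : flip ta a (ev i) = a (ev i). Proof. by rewrite flipE eqJ. Qed.
Lemma flip_ta_ta a : flip ta a ta = (1 - a ta)%N. Proof. by rewrite flipE eqJ. Qed.

Lemma pick_free_flip_ta a : pick_free (flip ta a) = pick_free a.
Proof. by apply: eq_pick => i; rewrite /free flip_ta_od flip_ta_ev. Qed.

Lemma parx_flip_ta a : bounded p t a -> parx (flip ta a) = ~~ parx a.
Proof. by move=> /boundedP[x <-]; apply: parx_flip mu_ta. Qed.

Lemma pick_free_high a j : bounded p t a -> pick_free a = Some j -> a (od j) != 0%N -> (0 < a (ev j))%N /\ a (od j) = 1%N.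
Proof.
move=> ba pa h; have := pick_free_Some pa; rewrite /free (negPf h) => ->; split=> //.
by have := od_le1 j ba; case: (a (od j)) h => [|[]].
Qed.

Lemma pick_free_up2 j a : bounded p t a -> pick_free a = Some j -> a (od j) = 0%N ->
  bounded p t (up2 j a) /\ pick_free (up2 j a) = Some j.
Proof.
move=> ba pa u0; have aj : ((a (ev j)).+1 < p ^ t j)%N by have := pick_free_Some pa; rewrite /free u0.
have bu := bounded_up2 ba aj u0; split=> //.
by rewrite -(pick_free_dn (j := j) bu) ?dn_up2 ?up2_ev ?up2_od ?eqxx ?addn1.
Qed.

(** Exchanges the selected monomials with the others, by inserting or removing x_j xi_j at the
    picked index j, or tau if no index is free. *)
Definition swap a := if pick_free a is Some j then (if a (od j) == 0%N then up2 j a else dn j a) else flip ta a.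

Lemma pick_free_swap a : bounded p t a -> pick_free (swap a) = pick_free a.
Proof.
move=> ba; rewrite /swap; case pa : (pick_free a) => [j|]; last by rewrite pick_free_flip_ta.
case: eqP => [u0|/eqP h]; first by case: (pick_free_up2 ba pa u0).
by have [h1 h2] := pick_free_high ba pa h; rewrite pick_free_dn ?h2.
Qed.

Lemma swap_bounded a : bounded p t a -> bounded p t (swap a).
Proof.
move=> ba; rewrite /swap; case pa : (pick_free a) => [j|]; last exact: flip_ta_b.
case: eqP => [u0|_]; first by case: (pick_free_up2 ba pa u0).
exact: bounded_dn.
Qed.

Lemma swapK a : bounded p t a -> swap (swap a) = a.
Proof.
move=> ba; rewrite {1}/swap pick_free_swap //; case pa : (pick_free a) => [j|]; last first.
  by rewrite /swap pa flip_ta_K.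
rewrite /swap pa; case: (eqVneq (a (od j)) 0%N) => [u0|h].
  by rewrite up2_od u0 eqxx /= dn_up2.
have [h1 h2] := pick_free_high ba pa h.
by rewrite dn_od h2 eqxx /= up2_dn ?h2.
Qed.

Lemma selected_swap a : bounded p t a -> selected (swap a) = ~~ selected a.
Proof.
move=> ba; rewrite /selected pick_free_swap // /swap; case pa : (pick_free a) => [j|].
  case: (eqVneq (a (od j)) 0%N) => [u0|h]; first by rewrite up2_od u0 eqxx.
  by have [h1 h2] := pick_free_high ba pa h; rewrite dn_od h2 eqxx.
by rewrite flip_ta_ta; have := ta_le1 ba; case: (a ta) => [|[]].
Qed.

Definition i0 : 'I_N := Ordinal (ltnW N_gt1).

(** Used when no index is free: it exchanges the two frozen states (top, 0) and (0, 1) of the pair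
    with index 0 and so changes parity without touching tau. *)
Definition toggle0 a : {ffun J -> nat} :=
  [ffun k : J => if k == ev i0 then (p ^ t i0).-1 - a k else if k == od i0 then 1 - a k else a k]%N.

Lemma toggle0_ev i a : toggle0 a (ev i) = if i == i0 then ((p ^ t i0).-1 - a (ev i))%N else a (ev i).
Proof. by rewrite ffunE !eqJ. Qed.
Lemma toggle0_od i a : toggle0 a (od i) = if i == i0 then (1 - a (od i))%N else a (od i).
Proof. by rewrite ffunE !eqJ. Qed.
Lemma toggle0_ta a : toggle0 a ta = a ta.
Proof. by rewrite ffunE !eqJ. Qed.

Lemma pt_gt0 i : (0 < p ^ t i)%N. Proof. by have := bnd_gt2 i; case: (p ^ _)%N. Qed.

Lemma toggle0_bounded a : bounded p t a -> bounded p t (toggle0 a).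
Proof.
move=> /forallP ba; apply/forallP => k; have := ba k; case: (JP k) => [i|i|]; rewrite bndE.
- rewrite toggle0_ev; case: eqP => [->|//] _; have := pt_gt0 i0; move: (p ^ _)%N (a _) => u v; lia.
- by rewrite toggle0_od; case: eqP => // _ _; rewrite ltnS leq_subr.
- by rewrite toggle0_ta.
Qed.

Lemma toggle0K a : bounded p t a -> toggle0 (toggle0 a) = a.
Proof.
move=> /forallP ba; apply/ffunP => k; have := ba k; case: (JP k) => [i|i|]; rewrite bndE.
- rewrite !toggle0_ev; case: eqP => [->|//]; have := pt_gt0 i0; move: (p ^ _)%N (a _) => u v; lia.
- by rewrite !toggle0_od; case: eqP => // _; rewrite ltnS => h; rewrite subKn.
- by rewrite !toggle0_ta.
Qed.

Lemma nonfree a i : bounded p t a -> free i a = false ->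
  (a (od i) = 0%N /\ a (ev i) = (p ^ t i).-1) \/ (a (od i) = 1%N /\ a (ev i) = 0%N).
Proof.
move=> ba; rewrite /free; case: eqP => [u0|/eqP u0] h.
  left; split=> //; have := forallP ba (ev i); rewrite bnd_ev; move: h; move: (a _) (p ^ _)%N => u v; lia.
right; have := od_le1 i ba; move: h u0; case: (a (od i)) => [|[]] //; by case: (a (ev i)).
Qed.

Lemma pick_free_toggle0 a : bounded p t a -> pick_free a = None -> pick_free (toggle0 a) = None.
Proof.
move=> ba pa; rewrite /pick_free; case: pickP => // i; have := pick_free_None i pa; rewrite /free toggle0_ev toggle0_od.
case: (eqVneq i i0) => [->|_]; last by rewrite /free => ->.
case/(nonfree ba) => [[-> ->]|[-> ->]] /=; first by rewrite subnn.
by rewrite subn0 prednK ?ltnn // pt_gt0.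
Qed.

Lemma parx_toggle0 a : bounded p t a -> parx (toggle0 a) = ~~ parx a.
Proof.
move=> ba; rewrite !parxE toggle0_ta (bigD1 i0) //= [in RHS](bigD1 i0) //= toggle0_od eqxx.
rewrite (eq_bigr (fun i => a (od i))) => [|i /negPf ii]; last by rewrite toggle0_od ii.
by rewrite !oddD -!addbA -addNb; congr addb; have := od_le1 i0 ba; case: (a (od i0)) => [|[]].
Qed.

(** A parity-reversing involution under which selection is invariant. Selection is read off xi_j
    when an index j is picked, so tau may be flipped; otherwise it is read off tau, and a frozen
    pair is changed instead. *)
Definition toggle a := if pick_free a is Some j then flip ta a else toggle0 a.

Lemma pick_free_toggle a : bounded p t a -> pick_free (toggle a) = pick_free a.
Proof. by move=> ba; rewrite /toggle; case pa : (pick_free a) => [j|]; rewrite ?pick_free_flip_ta // pick_free_toggle0. Qed.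

Lemma toggle_bounded a : bounded p t a -> bounded p t (toggle a).
Proof. by move=> ba; rewrite /toggle; case: (pick_free a) => [j|]; [exact: flip_ta_b | exact: toggle0_bounded]. Qed.

Lemma toggleK a : bounded p t a -> toggle (toggle a) = a.
Proof.
move=> ba; rewrite {1}/toggle pick_free_toggle // /toggle; case: (pick_free a) => [j|]; [exact: flip_ta_K | exact: toggle0K].
Qed.

Lemma selected_toggle a : bounded p t a -> selected (toggle a) = selected a.
Proof.
move=> ba; rewrite /selected pick_free_toggle // /toggle; case: (pick_free a) => [j|]; first by rewrite flip_ta_od.
by rewrite toggle0_ta.
Qed.

Lemma parx_toggle a : bounded p t a -> parx (toggle a) = ~~ parx a.
Proof. by move=> ba; rewrite /toggle; case: (pick_free a) => [j|]; [exact: parx_flip_ta | exact: parx_toggle0]. Qed.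

Lemma card_selected e : (4 * #|[set x : X | selected (expo x) && (parx (expo x) == e)]| = #|{: X}|)%N.
Proof.
have E1 := card_phi swap_bounded swapK (P1 := fun a => selected a) (P2 := fun a => ~~ selected a) selected_swap.
have E2 e' : #|[set x : X | selected (expo x) && (parx (expo x) == e')]|
           = #|[set x : X | selected (expo x) && (parx (expo x) == ~~ e')]|.
  apply: (card_phi toggle_bounded toggleK (P1 := fun a => selected a && (parx a == e')) (P2 := fun a => selected a && (parx a == ~~ e'))) => a ba.
  by rewrite selected_toggle // parx_toggle //; case: (parx a); case: e'.
have E3 := card_bipart [set x : X | selected (expo x)] (fun x => parx (expo x)).
have E4 : (#|[set x : X | selected (expo x)]| + #|[set x : X | ~~ selected (expo x)]| = #|{: X}|)%N.
  rewrite -(cardsC [set x : X | selected (expo x)]); congr (_ + _)%N; apply: eq_card => x; by rewrite !inE.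
have E5 e' : [set x in [set x : X | selected (expo x)] | parx (expo x) == e'] = [set x : X | selected (expo x) && (parx (expo x) == e')].
  by apply/setP => x; rewrite !inE.
rewrite !E5 in E3; move: E1 E3 E4 (E2 false); case: e => /=; move: #|_| #|_| #|_| #|_| #|_|; lia.
Qed.

Variable k0 : nat.
Hypothesis k0P : forall k : nat, (k <= N)%N -> ((2 * k)%:R == 3 :> F) = (k == k0).

Definition critical : {set X} := [set x : X | [&& pick_free (expo x) == None, expo x ta == 1%N
  & (deg (low ta (expo x)))%:R == 1 :> F]].
Definition odds x : {set 'I_N} := [set i | expo x (od i) == 1%N].

Lemma pick_free_None_state x i : pick_free (expo x) = None ->
  expo x (od i) = (i \in odds x) :> nat /\ expo x (ev i) = (if i \in odds x then 0 else (p ^ t i).-1)%N.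
Proof.
move=> px; rewrite inE; case: (nonfree (expo_bounded x) (pick_free_None i px)) => [[-> ->]|[-> ->]] //.
Qed.

Lemma ptm1 i : ((p ^ t i).-1)%:R = -1 :> F.
Proof.
apply/eqP; rewrite -subr_eq0 opprK -[X in _ + X]/(1%:R) -natrD addn1 prednK ?pt_gt0 //.
have : (0 < t i)%N by have := bnd_gt2 i; case: (t i).
by rewrite natrX (pcharf0 charFp) expr0n; case: (t i).
Qed.

(** Modulo p a frozen pair contributes 1 if it contains xi_i, and p^t - 1 = -1 otherwise. The degree
    is thus 2 k - N = 2 k - 2, with k the number of xi_i present. *)
Lemma deg_critical x : pick_free (expo x) = None ->
  ((deg (low ta (expo x)))%:R == 1 :> F) = (#|odds x| == k0).
Proof.
move=> px; rewrite -k0P; last by rewrite -[X in (_ <= X)%N]card_ord max_card.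
have -> : (deg (low ta (expo x)))%:R = (2 * #|odds x|)%:R - 2 :> F.
  rewrite /deg natr_sum (eq_bigr (fun i => (2 * (i \in odds x))%:R - 1)) => [|i _]; last first.
    rewrite !lowE !eqJ !subn0; have [-> ->] := pick_free_None_state i px.
    case: (i \in odds x); rewrite ?add0n ?addn0 ?muln0 ?muln1 ?ptm1 ?sub0r //.
    by rewrite -[true%:R]/(1 : F); ring.
  rewrite sumrB sumr_const card_ord N2 -natr_sum; congr (_%:R - _).
  by rewrite -big_distrr /= -sum1_card; congr (_ * _)%N; rewrite [RHS]big_mkcond; apply: eq_bigr => i _; case: (i \in odds x).
by rewrite -(inj_eq (addIr 2)) subrK (_ : 1 + 2 = 3 :> F) //; ring.
Qed.

(** The monomial with tau and all indices frozen whose odd variables besides tau are those in A; it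
    inverts [odds] on such monomials. *)
Definition class_of (A : {set 'I_N}) : {ffun J -> nat} :=
  [ffun k : J => if mu N k.+1 then (if k == ta then 1 else [exists i in A, od i == k] : nat)
   else (if [exists i in A, ev i == k] then 0 else (bnd k).-1)]%N.

Lemma class_ev A i : class_of A (ev i) = (if i \in A then 0 else (p ^ t i).-1)%N.
Proof.
rewrite ffunE mu_ev bnd_ev; congr (if _ then _ else _); apply/exists_inP/idP => [[j jA]|iA].
  by rewrite eqJ => /eqP <-.
by exists i; rewrite ?eqJ.
Qed.
Lemma class_od A i : class_of A (od i) = (i \in A).
Proof.
rewrite ffunE mu_od eqJ; congr nat_of_bool; apply/exists_inP/idP => [[j jA]|iA].
  by rewrite eqJ => /eqP <-.
by exists i; rewrite ?eqJ.
Qed.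
Lemma class_ta A : class_of A ta = 1%N.
Proof. by rewrite ffunE mu_ta eqxx. Qed.

Lemma class_b A : bounded p t (class_of A).
Proof.
apply/forallP => k; case: (JP k) => [i|i|]; rewrite bndE ?class_ev ?class_od ?class_ta //.
  by case: ifP => _; rewrite ?pt_gt0 // prednK ?pt_gt0.
by case: (i \in A).
Qed.

Lemma pick_free_class A : pick_free (class_of A) = None.
Proof.
rewrite /pick_free; case: pickP => // i; rewrite /free class_ev class_od.
by case: (i \in A) => //=; rewrite prednK ?pt_gt0 // ltnn.
Qed.

Lemma card_critical : #|critical| = 'C(N, k0).
Proof.
have inj : {in critical &, injective odds}.
  move=> x y; rewrite !inE => /and3P[/eqP px /eqP tx _] /and3P[/eqP py /eqP ty _] E.
  apply: (@expo_inj p N N.+1 t); apply/ffunP => k; case: (JP k) => [i|i|]; last by rewrite tx ty.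
    by rewrite (pick_free_None_state i px).2 (pick_free_None_state i py).2 E.
  by rewrite (pick_free_None_state i px).1 (pick_free_None_state i py).1 E.
rewrite -(card_in_imset inj) -[N in RHS]card_ord -card_draws; apply: eq_card => A; rewrite [RHS]inE.
apply/imsetP/eqP => [[x]|kA].
  by rewrite inE => /and3P[/eqP px _]; rewrite deg_critical // => /eqP <- ->.
have [x Ex_] := elimT (boundedP p t _) (class_b A).
have oA : odds x = A by apply/setP => i; rewrite inE Ex_ class_od; case: (i \in A).
exists x; last by rewrite oA.
have px : pick_free (expo x) = None by rewrite Ex_ pick_free_class.
by rewrite inE px eqxx deg_critical // oA kA eqxx Ex_ class_ta.
Qed.

Lemma parx_critical x : x \in critical -> parx (expo x) = ~~ odd k0.
Proof.
rewrite inE => /and3P[/eqP px /eqP tx]; rewrite deg_critical // => /eqP <-.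
rewrite parxE tx addn1 /= -sum1_card [in RHS]big_mkcond /=; congr (~~ odd _); apply: eq_bigr => i _.
by rewrite (pick_free_None_state i px).1; case: (i \in odds x).
Qed.

Lemma pick_free_top : exists j, pick_free (expo x_top) = Some j.
Proof.
rewrite /pick_free; case: pickP => [j _|/(_ i0)]; first by exists j.
rewrite /free expo_x_top topm_od topm_ev /=; have := bnd_gt2 i0; case: (p ^ _)%N => [|[]] //.
Qed.

Lemma SBE : SB = [set x in [set x : X | selected (expo x)] :\: critical | x != x_top].
Proof.
apply/setP => x; rewrite !inE; congr andb; rewrite /inB /selected; case: (pick_free (expo x)) => [j|] //=.
by case: (_ == 1%N); rewrite ?andbF //= andbT.
Qed.

(** Two corrections to the quarter of [card_selected]: the top monomial, which is selected because
    it contains every xi_i, and the critical monomials, which all have the same parity. *)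
Lemma card_SB e : (4 * (#|[set x in SB | parx (expo x) == e]| + (parx (expo x_top) == e)
  + (~~ odd k0 == e) * 'C(N, k0)) = #|{: X}|)%N.
Proof.
rewrite -(card_selected e); congr (4 * _)%N.
rewrite -(cardsID critical [set x : X | selected (expo x) && _]) addnC; congr (_ + _)%N.
  have -> : [set x : X | selected (expo x) && (parx (expo x) == e)] :&: critical = if ~~ odd k0 == e then critical else set0.
    apply/setP => x; rewrite in_setI inE; case: (boolP (x \in critical)) => [xE|xE]; last first.
      by rewrite andbF; case: ifP; rewrite ?in_set0 ?(negPf xE).
    rewrite andbT (parx_critical xE); case: ifP => _; last by rewrite andbF inE.
    rewrite andbT xE; move: xE; rewrite inE => /and3P[/eqP px /eqP tx _].
    by rewrite /selected px tx.
  by case: ifP => _; rewrite ?mul1n ?card_critical // cards0.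
rewrite [RHS](cardsD1 x_top) [LHS]addnC; congr (_ + _)%N.
  have [j pj] := pick_free_top; congr nat_of_bool; rewrite !inE pj /= /selected pj expo_x_top topm_od eqxx.
  by rewrite -expo_x_top.
by apply: eq_card => x; rewrite SBE !inE; case: (x != x_top); rewrite ?andbF ?andbT //= ?andbA.
Qed.

End SKO.

(** * The special superalgebra S *)

Section S.

Variables (F : fieldType) (p m n : nat) (t : 'I_m -> nat).
Hypothesis two : (2 : F) != 0.
Hypothesis bnd_gt1 : forall i, (1 < @expo_bound p m n t i)%N.
Notation O := (dpsa F p n t).
Notation X := (monomial p n t).
Notation J := 'I_(m + n).
Notation bnd := (@expo_bound p m n t).
Notation mon := (@mon F p m n t).
Notation pf := (@partial_fun F p m n t).
Notation var := (var F p n t).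
Notation partial := (partial F p n t).
Notation DS := (@D_S F p m n t).
Notation topm := (topm p n t).
Implicit Types (f g h : O) (d e : bool) (i j k l : J) (a b : {ffun J -> nat}) (x y : X) (u : 'End(O)).

Lemma D_SE i j e f : hom e f -> DS i.+1 j.+1 f =
  (-1) ^+ (mu m i.+1 && mu m j.+1) *: smul (pf i.+1 f) (partial j.+1)
  - (-1) ^+ ((mu m i.+1 (+) mu m j.+1) && e) *: smul (pf j.+1 f) (partial i.+1).
Proof.
move=> hf; rewrite /D_S (extendE (e := e)) => [|e' s g h|//]; last first.
  by rewrite !linearP /= !smul_linear !scalerDr !scalerN !scalerA ![s * _]mulrC opprD addrACA.
rewrite !partialE mulnb; congr (_ - _ *: _).
by case: (mu m i.+1); case: (mu m j.+1); case: e {hf} => //=; rewrite !exprS expr0; ring.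
Qed.

Lemma Lie_S_ind (P : 'End(O) -> Prop) :
  (forall i j e f, hom e f -> P (DS i.+1 j.+1 f)) -> P 0 -> (forall u u', P u -> P u' -> P (u + u')) ->
  forall u, u \in Lie_S F p n t -> P u.
Proof.
move=> PD P0 Padd u; rewrite /Lie_S big_add1 big_mkord => /memv_sumP[w Hw ->].
apply: (big_ind P) => // i _; have := Hw i isT; rewrite big_add1 big_mkord => /memv_sumP[w' Hw' ->].
apply: (big_ind P) => // j _; have /memv_imgP[f _ ->] := Hw' j isT; rewrite lfunE /=.
rewrite (hpartD f) linearD; apply: Padd; exact: PD (hom_hpart _ f).
Qed.

Lemma mem_Lie_S i j f : DS i.+1 j.+1 f \in Lie_S F p n t.
Proof.
have Df : DS i.+1 j.+1 f \in limg (linfun (DS i.+1 j.+1)).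
  by rewrite -[DS _ _ _](lfunE (DS i.+1 j.+1)); apply/memv_img/memvf.
rewrite /Lie_S big_add1 big_mkord; apply: (subvP (sumv_sup i isT (subvv _))).
by rewrite big_add1 big_mkord; apply: (subvP (sumv_sup j isT (subvv _))).
Qed.

Lemma smul_var f j l : smul f (partial j.+1) (var l.+1) = (j == l)%:R *: f.
Proof. by rewrite smulE partialE (partial_var F bnd_gt1) ltn_ord eqSS !andbT mulZr mulf1 val_eqE.  Qed.

Lemma D_S_var i j e f l : hom e f -> DS i.+1 j.+1 f (var l.+1) =
  ((-1) ^+ (mu m i.+1 && mu m j.+1) * (j == l)%:R) *: pf i.+1 f
  - ((-1) ^+ ((mu m i.+1 (+) mu m j.+1) && e) * (i == l)%:R) *: pf j.+1 f.
Proof.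
by move=> hf; rewrite (D_SE _ _ hf) add_lfunE opp_lfunE !scale_lfunE !smul_var !scalerA.
Qed.

Lemma Lie_S_vec u : u \in Lie_S F p n t -> u = \sum_(j < m + n) smul (u (var j.+1)) (partial j.+1).
Proof.
move: u; apply: Lie_S_ind => [i j e f hf||u u' Hu Hu'].
- rewrite [LHS](D_SE _ _ hf).
  under eq_bigr => l _ do rewrite (D_S_var _ _ _ hf) smulDl -scaleNr !smulZ.
  rewrite big_split /= (bigD1 j) //= eqxx mulr1 big1 ?addr0; last first.
    by move=> l /negPf lj; rewrite eq_sym lj mulr0 scale0r.
  rewrite (bigD1 i) //= eqxx mulr1 big1 ?addr0 ?scaleNr // => l /negPf li.
  by rewrite eq_sym li mulr0 oppr0 scale0r.
- by rewrite big1 // => j _; rewrite zero_lfunE smul0l.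
- rewrite {1}Hu {1}Hu' -big_split; apply: eq_bigr => j _; by rewrite add_lfunE smulDl.
Qed.

Definition divergence u : O := \sum_(l < m + n) pf l.+1 (sg (mu m l.+1) (u (var l.+1))).

Lemma Lie_S_divergence u : u \in Lie_S F p n t -> divergence u = 0.
Proof.
move: u; apply: Lie_S_ind => [i j e f hf||u u' Hu Hu'].
- rewrite /divergence; under eq_bigr => l _ do rewrite (D_S_var _ _ _ hf) linearB linearB linearZ linearZ linearZ linearZ /=.
  rewrite sumrB (bigD1 j) //= eqxx mulr1 big1 ?addr0; last first.
    by move=> l /negPf lj; rewrite eq_sym lj mulr0 scale0r.
  rewrite (bigD1 i) //= eqxx mulr1 big1 ?addr0; last first.
    by move=> l /negPf lj; rewrite eq_sym lj mulr0 scale0r.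
  rewrite !(sg_hom _ (hom_partial _ hf)) !linearZ /= (partialC i.+1 j.+1) ?scalerN !scalerA -scalerBl.
  rewrite [X in X *: _](_ : _ = 0) ?scale0r //.
  by case: (mu m i.+1); case: (mu m j.+1); case: (e); rewrite /= ?expr0 ?expr1; ring.
- by rewrite /divergence big1 // => l _; rewrite zero_lfunE !linear0.
by rewrite -[RHS]addr0 -{1}Hu -Hu' -big_split; apply: eq_bigr => l _; rewrite add_lfunE !linearD.
Qed.

(* x^(top_but j) d_j is not in the algebra, although its divergence vanishes *)
Definition top_but j : {ffun J -> nat} := [ffun i => if i == j then 0 else (bnd i).-1]%N.

(** A derivative by another variable never reaches a monomial in which that variable has its top
    exponent, and D_ll has no d_l component when x_l is even. *)
Lemma Lie_S_top_but u l x : u \in Lie_S F p n t -> ~~ mu m l.+1 -> expo x = top_but l ->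
  coef (u (var l.+1)) x = 0.
Proof.
move=> uS ml xl.
have H i f : i != l -> coef (pf i.+1 f) x = 0.
  move=> il; rewrite coef_partial big_pred0 ?mulr0 // => y; apply/eqP => /ffunP/(_ i) E.
  have := forallP (expo_bounded y) i; rewrite E [up _ _ _]ffunE eqxx xl ffunE (negPf il) addn1.
  by rewrite prednK ?ltnn // ltnW.
move: u uS; apply: Lie_S_ind => [i j e f hf||u u' Hu Hu'].
- rewrite (D_S_var _ _ _ hf) coefD coefN !coefZ.
  case: (eqVneq j l) => [->|jl]; case: (eqVneq i l) => [->|il].
  - by rewrite (negPf ml) !expr0 mulr1 subrr.
  - by rewrite (H _ _ il) !(mulr0, mul0r) subr0.
  - by rewrite (H _ _ jl) !(mulr0, mul0r) subr0.
  - by rewrite !(mulr0, mul0r) subr0.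
- by rewrite zero_lfunE dcoef0.
- by rewrite add_lfunE coefD Hu Hu' addr0.
Qed.

Definition raisable a : option J := [pick i | ((a i).+1 < bnd i)%N].

(* Modulo Lie_S each x^a d_j is equivalent to a combination of those with (a, j)
   satisfying repA or repB: for b <> top the fields x^(b + e_j) d_j are all
   proportional modulo Lie_S, and repB picks j = raisable b. *)
Definition repA (v : X * J) := ~~ mu m v.2.+1 && (expo v.1 == top_but v.2).
Definition repB (v : X * J) := (0 < expo v.1 v.2)%N && (raisable (low v.2 (expo v.1)) == Some v.2).

Definition setS : {set X * J} := [set v | ~~ repA v && ~~ repB v].

Definition parS (v : X * J) := parx (expo v.1) (+) mu m v.2.+1.

Definition E_S (v : X * J) : 'End(O) := smul (mon (expo v.1)) (partial v.2.+1).

(** When x_j divides x^a, put b = a - e_j and i = [raisable b]: D_ij (x_i x^a) is x^a d_j up to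
    sign, corrected by a multiple of x_i x^b d_i, which is the [repB] representative for b. The
    default value is never reached, by [raisable_low]. *)
Definition vS (v : X * J) : 'End(O) :=
  if expo v.1 v.2 is 0%N then E_S v
  else let i := odflt v.2 (raisable (low v.2 (expo v.1))) in
    DS i.+1 v.2.+1 (mon (up i (expo v.1))).

Lemma pardeg_E v : pardeg (parS v) (E_S v).
Proof. exact: pardeg_smul (hom_mon _ _ _ _) (pardeg_partial _). Qed.

Lemma E_S_var v l y : coef (E_S v (var l.+1)) y = (v == (y, l))%:R.
Proof.
rewrite smul_var coefZ coef_monx -natrM mulnb andbC; congr (nat_of_bool _)%:R.
Qed.

Lemma partial_up i a : ((a i).+1 < bnd i)%N -> pf i.+1 (mon (up i a)) = (-1) ^+ sgnk i.+1 a *: mon a.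
Proof.
move=> H; rewrite partial_mon upK sgnk_up (_ : up i a i = (a i).+1) ?(ltn_eqF H) ?mul1r //.
by rewrite ffunE eqxx addn1.
Qed.

Lemma parx_up i a : parx (up i a) = parx a (+) mu m i.+1.
Proof. by rewrite -parx_unit -parxD; congr parx; apply/ffunP => j; rewrite !ffunE. Qed.

Lemma up_bounded i a : bounded p t a -> ((a i).+1 < bnd i)%N -> bounded p t (up i a).
Proof.
move=> /forallP H ai; apply/forallP => j; rewrite ffunE; case: eqP => [->|_]; last by rewrite addn0.
by rewrite addn1.
Qed.

Lemma raisable_low x j : (0 < expo x j)%N -> exists i, raisable (low j (expo x)) = Some i.
Proof.
move=> xj; rewrite /raisable; case: pickP => [i _|/(_ j)]; first by exists i.
by rewrite ffunE eqxx subn1 prednK // (forallP (expo_bounded x)).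
Qed.

Lemma raisable_lt a i : raisable a = Some i -> ((a i).+1 < bnd i)%N.
Proof. by rewrite /raisable; case: pickP => // j H [<-]. Qed.

(** Read in the coordinates indexed by [setS], the family [vS] is diagonal with nonzero entries: its
    correction terms lie at [repB] positions. *)
Lemma vS_spec v : v \in setS -> vS v \in Lie_S F p n t /\ exists s u,
  [/\ s != 0, pardeg (parS v) u, forall v', v' \in setS -> coef (u (var v'.2.+1)) v'.1 = 0
    & vS v = s *: E_S v + u].
Proof.
case: v => x j; rewrite inE /vS /repA /repB /=; case xj: (expo x j) => [|k] /=.
  rewrite andbT => nA; split; last first.
    exists 1, 0; split; [exact: oner_neq0|exact: pardeg0| |by rewrite scale1r addr0].
    by move=> v' _; rewrite zero_lfunE dcoef0.
  (* For odd x_j not dividing x^a, D_jj (x_j x^a) is 2 x^a d_j up to sign. *)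
  have [mj|mj] := boolP (mu m j.+1).
    have xj1 : ((expo x j).+1 < bnd j)%N by rewrite xj.
    have := mem_Lie_S j j (mon (up j (expo x))).
    rewrite (D_SE _ _ (hom_mon F p t _)) mj /= (partial_up xj1) -scalerBl smulZ scalerA => H.
    set s := _ * _ in H; have s0 : s != 0.
      by rewrite mulf_neq0 ?signr_eq0 // expr1 expr0 -opprD oppr_eq0.
    by have := memvZ s^-1 H; rewrite scalerA mulVf ?scale1r.
  (* Here x_j is even and [repA] fails, so some exponent other than the j-th can be raised; D_ij
     (x_i x^a) then has a single term, as x_j does not divide x^a. *)
  have [i ij xi] : exists2 i, i != j & ((expo x i).+1 < bnd i)%N.
    rewrite mj /= in nA; apply/exists_inP; apply: contraNT nA; rewrite negb_exists_in => /forall_inP H.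
    apply/eqP/ffunP => i; rewrite [RHS]ffunE; case: (eqVneq i j) => [->|ij]; first by rewrite xj.
    have := H i ij; have := forallP (expo_bounded x) i; move: (expo x i) (expo_bound _ _ _) => u v; lia.
  have := mem_Lie_S i j (mon (up i (expo x))).
  rewrite (D_SE _ _ (hom_mon F p t _)) (negPf mj) andbF (partial_up xi) partial_mon.
  rewrite [up i _ j]ffunE xj eq_sym (negPf ij) !mul0r scale0r smul0l scaler0 subr0 expr0 scale1r smulZ => H.
  by have := memvZ ((-1) ^+ sgnk i.+1 (expo x)) H; rewrite scalerA -expr2 sqrr_sign scale1r.
have xj0 : (0 < expo x j)%N by rewrite xj.
have [i ri] := raisable_low xj0; rewrite ri /= => /andP[_ ij]; split; first exact: mem_Lie_S.
have {}ij : i != j by apply: contraNneq ij => ->.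
set b := low j (expo x) in ri; have bi := raisable_lt ri.
have xi : ((expo x i).+1 < bnd i)%N by move: bi; rewrite ffunE (negPf ij) subn0.
have [x' bx] := low_bounded j x; rewrite -/b in bx.
have [y yE] : exists y : X, expo y = up i b by apply/boundedP/up_bounded; rewrite // -bx expo_bounded.
rewrite (D_SE _ _ (hom_mon F p t _)) (partial_up xi) partial_mon.
have -> : low j (up i (expo x)) = expo y.
  rewrite yE; apply/ffunP => l; rewrite !ffunE; case: (eqVneq l j) => [->|_]; last by rewrite !subn0.
  by rewrite eq_sym (negPf ij) !addn0.
rewrite !smulZ !scalerA -scaleNr; set w := (X in _ + X *: _); set s := (X in X *: _ + _).
exists s, (w *: E_S (y, i)); split => //; first by rewrite mulf_neq0 ?signr_eq0.
  apply: pardegZ; rewrite (_ : parS (x, j) = parS (y, i)); first exact: pardeg_E.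
  by rewrite /parS /= yE -(lowK xj0) !parx_up -!addbA !addbb.
move=> [y' l] /=; rewrite scale_lfunE coefZ E_S_var; case: eqP => [<-|_ _]; last by rewrite mulr0.
by rewrite inE /repB /= yE upK ri eqxx ffunE eqxx addn1 andbF.
Qed.

(** The coordinates outside [setS] are determined by the others: those at [repA] vanish on all of S,
    and the one at [repB] for b is the only remaining term in the coefficient of x^b in the
    divergence. *)
Lemma Lie_S_vanish u : u \in Lie_S F p n t ->
  (forall v, v \in setS -> coef (u (var v.2.+1)) v.1 = 0) -> u = 0.
Proof.
move=> uS u0; rewrite (Lie_S_vec uS) big1 // => j _; rewrite [u _](_ : _ = 0) ?smul0l //.
apply: coefP => x; rewrite dcoef0; case: (boolP ((x, j) \in setS)) => [/u0 //|].
rewrite inE negb_and !negbK => /orP[/andP[/= mj /eqP xj]|/andP[/= xj /eqP rj]].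
  exact: Lie_S_top_but.
have [y yE] := low_bounded j x; have xE : expo x = up j (expo y) by rewrite yE lowK.
have := congr1 (fun f => coef f y) (Lie_S_divergence uS).
rewrite /= /divergence dcoef0 coef_sum (bigD1 j) //= big1 ?addr0 => [|l lj].
  by rewrite (coef_partial_up _ xE) coef_sg => /eqP; rewrite !mulf_eq0 !signr_eq0 => /eqP.
rewrite coef_partial big1 ?mulr0 // => z /eqP zE; rewrite coef_sg (u0 (z, l)) ?mulr0 //.
rewrite inE /repA /repB /= zE upK yE rj; apply/andP; split; last first.
  by rewrite negb_and; apply/orP; right; apply: contraNneq lj => -[->].
by rewrite negb_and; apply/orP; right; apply/eqP => /ffunP/(_ l); rewrite !ffunE eqxx addn1.
Qed.

Lemma Lie_S_basis : graded_basis (parity_proj F p n t) (Lie_S F p n t) setS vS parS.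
Proof.
have cS v v' s u : (forall v', v' \in setS -> coef (u (var v'.2.+1)) v'.1 = 0) ->
    v' \in setS -> coef ((s *: E_S v + u) (var v'.2.+1)) v'.1 = s * (v == v')%:R.
  move=> u0 v'S; rewrite add_lfunE scale_lfunE coefD coefZ E_S_var u0 // addr0.
  by case: v' {v'S}.
split.
- by move=> v /vS_spec[].
- move=> v /vS_spec[_ [s [u [_ pu _ ->]]]].
  by rewrite (op_partE _ (pardegD (pardegZ s (pardeg_E v)) pu)) eqxx.
- move=> w w0 v vin; have := congr1 (fun D : 'End(O) => coef (D (var v.2.+1)) v.1) w0.
  rewrite zero_lfunE dcoef0 sum_lfunE coef_sum (bigD1 v) //= big1 ?addr0 => [|v' /andP[v'S v'v]].
    rewrite scale_lfunE coefZ; have [_ [s [u [s0 _ u0 ->]]]] := vS_spec vin.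
    by rewrite cS // eqxx mulr1 => /eqP; rewrite mulf_eq0 (negPf s0) orbF => /eqP.
  have [_ [s [u [_ _ u0 E]]]] := vS_spec v'S.
  by rewrite scale_lfunE coefZ E cS // (negPf v'v) !mulr0.
apply: (dim_le_family (v := vS)) => u uS.
(* Since [vS] is diagonal in the coordinates of [setS], each coefficient is a quotient of
   coordinates. *)
pose w (v : X * J) := coef (u (var v.2.+1)) v.1 / coef (vS v (var v.2.+1)) v.1.
exists w; apply/eqP; rewrite -subr_eq0; apply/eqP/Lie_S_vanish => [|v vin].
  by apply: rpredB => //; apply: memv_suml => v /vS_spec[vSv _]; apply: memvZ.
rewrite add_lfunE opp_lfunE coefD coefN sum_lfunE coef_sum (bigD1 v) //= big1 ?addr0 => [|v' /andP[v'S v'v]].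
  rewrite scale_lfunE coefZ /w; have [_ [s [u' [s0 _ u0 ->]]]] := vS_spec vin.
  by rewrite cS // eqxx mulr1 divfK // subrr.
have [_ [s [u' [_ _ u0 E]]]] := vS_spec v'S.
by rewrite scale_lfunE coefZ E cS // (negPf v'v) !mulr0.
Qed.

Section Count.

Hypotheses (m0 : (0 < m)%N) (n0 : (0 < n)%N).

Let i0 : J := rshift m (Ordinal n0).

Let mu0 : mu m i0.+1. Proof. by rewrite /mu /= addn0. Qed.

Lemma sum_odd_vars : (\sum_(i < m + n | mu m i.+1) 1 = n)%N.
Proof.
rewrite big_mkcond big_split_ord /= big1 => [|i _]; last by rewrite /mu /= ltnNge ltn_ord.
by rewrite add0n (eq_bigr (fun=> 1%N)) ?sum1_card ?card_ord // => i _; rewrite /mu /= ltnS leq_addr.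
Qed.

Lemma card_even_vars : #|[set j : J | ~~ mu m j.+1]| = m.
Proof.
have := cardsC [set j : J | mu m j.+1]; rewrite card_ord -sum1dep_card sum_odd_vars addnC.
by move=> /addIn E; rewrite -[RHS]E; apply: eq_card => j; rewrite !inE.
Qed.

Lemma parx_odd_top a : (forall i, mu m i.+1 -> a i = 1%N) -> parx a = odd n.
Proof. by move=> H; rewrite /parx (eq_bigr _ H) sum_odd_vars. Qed.

Lemma card_par e : (2 * #|[set v | parS v == e]| = (m + n) * #|{: X}|)%N.
Proof.
have H e' : (#|[set v | parS v == e']| <= #|[set v | parS v == ~~ e']|)%N.
  pose f (v : X * J) := (flipx i0 v.1, v.2).
  have f_inj : injective f by move=> [x j] [y l] [/(flipx_inj mu0)-> ->].
  rewrite -(card_imset _ f_inj); apply/subset_leq_card/subsetP => _ /imsetP[v + ->].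
  by rewrite !inE /parS /= flipxE // parx_flip // addNb => /eqP->.
have := card_bipart [set: X * J] parS; rewrite cardsT card_prod card_ord.
have E e' : [set i in [set: X * J] | parS i == e'] = [set v | parS v == e'] by apply/setP => v; rewrite !inE.
rewrite !E => EX; rewrite mul2n [RHS]mulnC -[RHS]EX -addnn.
have := H false; have := H true; case: e; rewrite /=; move: #|_| #|_|; lia.
Qed.

Lemma top_but_bounded j : bounded p t (top_but j).
Proof.
apply/forallP => i; rewrite ffunE; have := bnd_gt1 i; case: eqP => _; last by move=> H; rewrite prednK // ltnW.
exact: ltnW.
Qed.

(** Serves as the default value of [mkx]. *)
Variable xd : X.

(** There is one such pair for each even variable, and its monomial contains all n odd variables. *)
Lemma card_repA e : #|[set v | repA v && (parS v == e)]| = ((odd n == e) * m)%N.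
Proof.
have par_top j : ~~ mu m j.+1 -> parx (top_but j) = odd n.
  move=> mj; apply: parx_odd_top => i mi; rewrite ffunE bnd_odd //.
  by case: eqP => // ij; rewrite -ij mi in mj.
have -> : [set v | repA v && (parS v == e)]
    = if odd n == e then [set (mkx xd (top_but j), j) | j in [set j : J | ~~ mu m j.+1]] else set0.
  apply/setP => -[x j]; rewrite inE /repA /parS /=; case: (eqVneq (odd n) e) => [<-|ne]; last first.
    rewrite inE; apply/negbTE/negP => /andP[/andP[mj /eqP xj]].
    by rewrite xj par_top // (negPf mj) addbF (negPf ne).
  apply/andP/imsetP => [[/andP[mj /eqP xj] _]|[l]].
    by exists j; rewrite ?inE // -xj; congr (_, _); apply: expo_inj; rewrite mkxE // expo_bounded.
  rewrite inE => ml [-> ->]; rewrite mkxE ?top_but_bounded // par_top // ml (negPf ml) addbF.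
  by rewrite !eqxx.
case: eqP => _; last by rewrite cards0.
by rewrite card_imset ?card_even_vars ?mul1n // => j l [].
Qed.

(** These pairs correspond to the monomials x^b other than the top one, through (x_j x^b, j) with j
    = [raisable b], and have the parity of x^b. The missing top monomial has the parity of n. *)
Lemma card_repB e : (2 * (#|[set v | repB v && (parS v == e)]| + (odd n == e)) = #|{: X}|)%N.
Proof.
have [f fE] : exists f : X -> X * J, forall x, expo x != topm ->
    raisable (expo x) = Some (f x).2 /\ expo (f x).1 = up (f x).2 (expo x).
  exists (fun x => let j := odflt i0 (raisable (expo x)) in (mkx xd (up j (expo x)), j)) => x xt.
   have [i xi] : exists i, raisable (expo x) = Some i.
    rewrite /raisable; case: pickP => [i _|H]; first by exists i.
    case/eqP: xt; apply/ffunP => i; rewrite [RHS]ffunE.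
    have := H i; have := forallP (expo_bounded x) i; move: (expo x i) (expo_bound _ _ _) => u v; lia.
  by rewrite xi /= mkxE // up_bounded ?expo_bounded // raisable_lt.
pose Y := [set x : X | (expo x != topm) && (parx (expo x) == e)].
have f_inj : {in Y &, injective f}.
  move=> x y; rewrite !inE => /andP[/fE[_ xE] _] /andP[/fE[_ yE] _] E; apply: expo_inj.
  by rewrite -(upK (f x).2 (expo x)) -xE E yE upK.
have -> : [set v | repB v && (parS v == e)] = f @: Y.
  apply/setP => -[x j]; rewrite inE; apply/andP/imsetP => [[/andP[/= xj /eqP rj] /eqP pj]|[y + E]].
    have [y yE] := low_bounded j x; rewrite -yE in rj.
    have yt : expo y != topm.
      by apply: contraTneq (raisable_lt rj) => ->; rewrite ffunE prednK ?ltnn // ltnW.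
    have [] := fE y yt; rewrite rj => -[jE]; rewrite -jE yE lowK // => /expo_inj xE.
    exists y; last by rewrite [RHS]surjective_pairing -jE xE.
    by rewrite inE yt -pj /parS /= -(lowK xj) -yE parx_up -addbA addbb addbF eqxx.
  rewrite inE => /andP[/fE[ry yE] /eqP py]; rewrite -E /= in ry yE.
  rewrite /repB /parS /= yE upK ry eqxx ffunE eqxx addn1 parx_up -addbA addbb addbF py.
  by rewrite eqxx.
rewrite (card_in_imset f_inj).
have [xt xtE] : exists x : X, expo x = topm.
  by apply/boundedP/forallP => i; rewrite ffunE prednK // ltnW.
have := card_flip2 (p := p) (t := t) (P := predT) e mu0 (fun _ => erefl).
rewrite /= cardsT => <-; congr (2 * _)%N; rewrite [RHS](cardsD1 xt) [LHS]addnC; congr (_ + _)%N.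
  by rewrite inE xtE (parx_odd_top (a := topm)) // => i mi; rewrite ffunE bnd_odd.
by apply: eq_card => x; rewrite !inE -xtE (inj_eq (@expo_inj _ _ _ _)).
Qed.

(** Of the (m + n) d / 2 fields x^a d_j of a given parity, [repB] removes d / 2 and [repA] removes
    m, except that in the parity of n [repB] removes one less and in the other parity [repA] removes
    none. Hence m - 1, in one parity only. *)
Lemma Lie_S_card e :
  (2 * (#|[set v in setS | parS v == e]| + (odd n == e) * m.-1) = (m + n).-1 * #|{: X}|)%N.
Proof.
have := card_par e; have := card_repA e; have := card_repB e.
rewrite -(cardsID [set v | repA v] [set v | parS v == e]).
rewrite -(cardsID [set v | repB v] ([set v | parS v == e] :\: [set v | repA v])).
have -> : [set v | parS v == e] :&: [set v | repA v] = [set v | repA v && (parS v == e)].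
  by apply/setP => v; rewrite !inE andbC.
have -> : ([set v | parS v == e] :\: [set v | repA v]) :&: [set v | repB v] = [set v | repB v && (parS v == e)].
  apply/setP => v; rewrite !inE andbC andbCA andbA; case: (boolP (repB v)) => rB; last by rewrite andbF.
  rewrite (_ : repA v = false) // /repA; apply/negbTE/negP => /andP[_ /eqP E].
  by move: rB; rewrite /repB E ffunE eqxx.
have -> : ([set v | parS v == e] :\: [set v | repA v]) :\: [set v | repB v] = [set v in setS | parS v == e].
  by apply/setP => v; rewrite !inE; case: (repA v); case: (repB v).
move: #|_| #|_| #|_| #|_| => u w z y; have [k mk] : exists k : nat, m = k.+1 by exists m.-1; rewrite prednK.
by rewrite mk addSn /= mulSn; case: (odd n == e); rewrite ?mul1n ?mul0n; lia.
Qed.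

End Count.

End S.

(** * Comparison of dimensions *)

Lemma leq_bin n k : (0 < k < n)%N -> (n <= 'C(n, k))%N.
Proof.
elim: n k => [|n IH] [|k] //=; rewrite ltnS => kn.
case: k kn => [|k] kn; first by rewrite bin1.
by rewrite binS -addn1 addnC leq_add ?bin_gt0 // IH.
Qed.

(** (k + 1) C(2k + 1, k + 1) = (2k + 1) C(2k, k), where k + 1 is odd and the central binomial C(2k,
    k) = 2 C(2k - 1, k) is even. *)
Lemma odd_bin_mid k : (0 < k)%N -> ~~ odd k -> odd 'C((2 * k).+1, k.+1) = false.
Proof.
move=> k0 ek; have := mul_bin_diag (2 * k).+1 k => /(congr1 odd).
rewrite !oddM /= oddM (negPf ek) /= => <-.
have [l kl] : exists l, k = l.+1 by exists k.-1; rewrite prednK.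
have -> : (2 * k = (2 * l).+1.+1)%N by rewrite kl; lia.
have E : 'C((2 * l).+1, l) = 'C((2 * l).+1, l.+1) by rewrite -bin_sub; [congr (binomial _ _)|]; lia.
by rewrite kl binS E oddD addbb.
Qed.

Section Final.

Variables (F : fieldType) (p : nat).
Hypothesis charFp : p \in [pchar F].
Hypothesis p_gt3 : (3 < p)%N.
Variable r : 'I_(p + 2) -> nat.
Hypothesis r_gt0 : forall i, (0 < r i)%N.
Notation lambda := (((p - 1) %/ 2)%:R : F).
Notation SKO := (Lie_SKO p lambda r).

Let pr_p : prime p := pcharf_prime charFp.
Let odd_p : odd p. Proof. by case: (even_prime pr_p) p_gt3 => // ->. Qed.

Lemma natF_eq0 k : (k%:R == 0 :> F) = (p %| k)%N.
Proof. by rewrite (dvdn_pcharf charFp). Qed.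

Let two : (2 : F) != 0. Proof. by rewrite natF_eq0 gtnNdvd // ltnW. Qed.
Let three : (3 : F) != 0. Proof. by rewrite natF_eq0 gtnNdvd. Qed.

Let N2 : (p + 2)%:R = 2 :> F. Proof. by rewrite natrD (pcharf0 charFp) add0r. Qed.

Let Nlambda : (p + 2)%:R * lambda = -1.
Proof.
rewrite N2 -natrM mulnC divnK; last by rewrite dvdn2 oddB ?odd_p //; lia.
by rewrite natrB ?(pcharf0 charFp) ?sub0r //; lia.
Qed.

Let N_gt1 : (1 < p + 2)%N. Proof. by rewrite addn2. Qed.

Let bnd_gt2 i : (2 < p ^ r i)%N.
Proof. by apply: leq_trans (leq_pexp2l _ (r_gt0 i)); rewrite ?expn1; lia. Qed.

Definition k0 := (p + 3)./2.

Let k02 : (2 * k0 = p + 3)%N.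
Proof. by have := odd_double_half (p + 3); rewrite oddD odd_p -mul2n. Qed.

(** If 2 k = 3 mod p then 2 k + p - 3 = q p with q even, as p is odd. Being positive and at most 3 p
    + 1 < 4 p, it equals 2 p. *)
Lemma k0P k : (k <= p + 2)%N -> ((2 * k)%:R == 3 :> F) = (k == k0).
Proof.
move=> kN; have -> : ((2 * k)%:R == 3 :> F) = (p %| 2 * k + (p - 3))%N.
  by rewrite -natF_eq0 natrD (natrB _ (ltnW p_gt3)) (pcharf0 charFp) sub0r subr_eq0.
apply/idP/eqP => [/dvdnP[q E]|->]; last first.
  have -> : (2 * k0 + (p - 3) = 2 * p)%N by rewrite k02; lia.
  exact: dvdn_mull.
have oq : odd q = false.
  by have := congr1 odd E; rewrite oddD !oddM odd_p andbT oddB ?(ltnW p_gt3) // odd_p => <-.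
by case: q oq E => [|[|[|[|q]]]] //= _ E; nia.
Qed.

Let S e := #|[set x in SB F bnd_gt2 | parx (expo x) == e]|.
Let C := 'C(p + 2, k0).
Let d := #|{: monomial p (p + 2).+1 r}|.

Lemma C_gt2 : (2 < C)%N.
Proof. by apply: leq_trans (leq_bin _); lia. Qed.

(** The top monomial contains all p + 3 odd variables, so it is even; a critical one contains k0 + 1
    of them. *)
Let card_S e : (4 * (S e + (e == false) + (odd k0 != e) * C) = d)%N.
Proof.
rewrite /d; have <- := card_SB charFp two three N2 N_gt1 bnd_gt2 k0P e.
rewrite expo_x_top (parx_odd_top (a := topm p (p + 2).+1 r)) => [|i mi]; last by rewrite ffunE bnd_odd.
rewrite oddS oddD odd_p /= -/(S e) -/C eq_sym; congr (4 * (_ + _ * _))%N.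
by case: (odd k0); case: e.
Qed.

Let gr_SKO := SKO_basis charFp two three N2 N_gt1 bnd_gt2 Nlambda.
Let dis := @fixpart_dis F p.

Lemma SKO_not_HO m (t : 'I_m -> nat) : (0 < m)%N -> (forall i, (0 < t i)%N) ->
  ~ dpsa_isom SKO (Lie_HO F p t).
Proof.
move=> m0 t0; have b := bnd_gt1 (n := m) (prime_gt1 pr_p) t0.
move/(super_isom_card (dis _ _) (dis _ _) gr_SKO (Lie_HO_basis F b)) => H.
have := Lie_HO_card b m0; rewrite /= -!H -!/(S _).
by have := C_gt2; have := card_S true; have := card_S false; case: (odd k0) => /=; lia.
Qed.

Lemma SKO_not_K m n (t : 'I_m -> nat) : odd m -> (0 < n)%N -> (forall i, (0 < t i)%N) ->
  ~ dpsa_isom SKO (Lie_K F p n t).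
Proof.
move=> om n0 t0; have b := bnd_gt1 (n := n) (prime_gt1 pr_p) t0.
move/(super_isom_card (dis _ _) (dis _ _) gr_SKO (Lie_K_basis charFp two b om)) => H.
have := Lie_K_card charFp two b om true n0; have := Lie_K_card charFp two b om false n0.
rewrite /= -!H -!/(S _).
by have := C_gt2; have := card_S true; have := card_S false; case: (odd k0) => /=; lia.
Qed.

Lemma dvdn_card_monomial m n (t : 'I_m -> nat) : (0 < m)%N -> (forall i, (0 < t i)%N) ->
  (p %| #|{: monomial p n t}|)%N.
Proof.
move=> m0 t0; rewrite card_monomial dvdn_mulr // dvdn_exp //.
by rewrite (bigD1 (Ordinal m0)) //= addn_gt0 t0.
Qed.

Lemma log2_card_monomial m n (t : 'I_m -> nat) : logn 2 #|{: monomial p n t}| = n.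
Proof.
rewrite card_monomial lognM ?expn_gt0 ?prime_gt0 // pfactorK // lognX.
by rewrite (logn_coprime (p := 2)) ?muln0 // coprime2n.
Qed.

Lemma SKO_not_S m n (t : 'I_m -> nat) : (0 < m)%N -> (0 < n)%N -> (forall i, (0 < t i)%N) ->
  ~ dpsa_isom SKO (Lie_S F p n t).
Proof.
move=> m0 n0 t0; have b := bnd_gt1 (n := n) (prime_gt1 pr_p) t0.
move/(super_isom_card (dis _ _) (dis _ _) gr_SKO (Lie_S_basis two b)) => H.
have xd : monomial p n t := [ffun i => Ordinal (ltnW (b i))].
have SE := Lie_S_card two b m0 n0 xd.
have := SE true; have := SE false; rewrite -!H -!/(S _).
have pd : (p %| d)%N by apply: dvdn_card_monomial; rewrite ?addn2.
have pd' : (p %| #|{: monomial p n t}|)%N by apply: dvdn_card_monomial.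
have ld : logn 2 d = p.+3 by rewrite log2_card_monomial addn2.
have ld' : logn 2 #|{: monomial p n t}| = n by exact: log2_card_monomial.
have d0 : (0 < #|{: monomial p n t}|)%N by apply/card_gt0P; exists xd.
move: d pd ld (card_S true) (card_S false) pd' ld' d0 => d' pd ld.
move: #|{: monomial p n t}| => d1; have C2 := C_gt2.
have [ok|ek] := boolP (odd k0) => /= S1 S0 pd' ld' d0.
  case on: (odd n) => /= E0 E1; first by lia.
  have mC : m = (C + 2)%N by lia.
  (* N = 2 (k0 - 1) + 1 with k0 - 1 even, so C is the binomial treated by [odd_bin_mid]. *)
  have Ceven : odd C = false.
    rewrite /C (_ : p + 2 = (2 * k0.-1).+1)%N; last by lia.
    rewrite -(prednK (n := k0)); last by lia.
    by apply: odd_bin_mid; [lia|rewrite -oddS prednK ?ok //; lia].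
  (* In the odd parts, d' = 4 [S true] and 2 [S true] = (m + n - 1) d1; comparing powers of 2 gives
     n + 1 = p + 3. *)
  have : logn 2 ((m + n).-1 * d1 * 2) = logn 2 d' by congr logn; lia.
  rewrite lognM ?lognM ?muln_gt0 ?d0 ?andbT //; try lia.
  have -> : logn 2 (m + n).-1 = 0%N.
    by rewrite logn_coprime // coprime2n mC addn2 !addSn /= oddD Ceven on.
  rewrite ld ld' /= add0n (logn_prime 2) // addn1 => -[nE].
  by move: on; rewrite nE /= odd_p.
case on: (odd n) => /= E0 E1; last by lia.
have : (p %| 4)%N.
  (* In the even parts, d' = 4 ([S false] + 1) and 2 [S false] = (m + n - 1) d1, while both d' and
     d1 are multiples of p. *)
  have -> : 4%N = (d' - 2 * ((m + n).-1 * d1))%N by lia.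
  by rewrite dvdn_sub // !dvdn_mull.
by rewrite -[4%N]/(2 ^ 2)%N Euclid_dvdX // andbT => /(dvdn_leq (isT : 0 < 2)%N); lia.
Qed.

End Final.

Theorem corollary5p3 (F : fieldType) (p : nat) (charFp : p \in [pchar F])
    (p_gt3 : (3 < p)%N) (m n : nat) (m_gt2 : (2 < m)%N) (n_gt2 : (2 < n)%N)
    (r : 'I_(p + 2) -> nat) (r_gt0 : forall i, (0 < r i)%N)
    (t : 'I_m -> nat) (t_gt0 : forall i, (0 < t i)%N) :
  let SKO := Lie_SKO p (((p - 1) %/ 2)%:R : F) r in
  [/\ ~ dpsa_isom SKO (Lie_S F p n t),
      ~ dpsa_isom SKO (Lie_HO F p t)
    & odd m -> ~ dpsa_isom SKO (Lie_K F p n t)].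
Proof.
have m0 : (0 < m)%N := ltnW (ltnW m_gt2); have n0 : (0 < n)%N := ltnW (ltnW n_gt2).
split; [exact: SKO_not_S|exact: SKO_not_HO|move=> om; exact: SKO_not_K].
Qed.
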